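(* Let $(M,\omega)$ be a symplectic manifold of dimension $2n$ with $n\ge 2$, endowed with a symplectic connection $\nabla$ of Ricci-type. Then for every $p\in M$ there exists $A\in\mathfrak{sp}(\mathbb R^{2n+2},\Omega')$ with $e_0=(1,0,\dots,0)\in\Sigma_A=\{x\in\mathbb R^{2n+2}:\Omega'(x,Ax)=1\}$ such that a neighbourhood of $p$ in $(M,\omega,\nabla)$ is isomorphic, by a symplectic affine diffeomorphism, to an open subset of the symplectic manifold with Ricci-type connection $(D^{red},\omega^{red},\nabla^{red})$ obtained from $\Sigma_A$ by local reduction around $e_0$ in $(\mathbb R^{2n+2},\Omega')$ endowed with its standard flat connection.
   Context: A symplectic connection on $(M,\omega)$ is a torsion-free linear connection $\nabla$ with $\nabla\omega=0$. Its curvature is $R^\nabla(X,Y)Z=(\nabla_X\nabla_Y-\nabla_Y\nabla_X-\nabla_{[X,Y]})Z$; its Ricci tensor is $r^\nabla(X,Y)=\mathrm{Tr}(Z\mapsto R^\nabla(X,Z)Y)$ (symmetric); $\rho^\nabla$ is defined by $\omega(X,\rho^\nabla Y)=r^\nabla(X,Y)$. The connection is of Ricci-type if $$R^\nabla(X,Y)Z=\tfrac1{2n+2}\big(2\omega(X,Y)\rho^\nabla Z+\omega(X,Z)\rho^\nabla Y-\omega(Y,Z)\rho^\nabla X+\omega(X,\rho^\nabla Z)Y-\omega(Y,\rho^\nabla Z)X\big).$$ Let $\Omega'$ be the standard constant symplectic form on $\mathbb R^{2n+2}$; coordinates are ordered so that $\mathbb R^{2n+2}=\mathbb R^2\oplus\mathbb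 R^{2n}$ is an $\Omega'$-orthogonal decomposition, the first two basis vectors $e_0,e_1$ satisfying $\Omega'(e_0,e_1)=1$ and $\Omega'$ restricting to the standard form on $\mathbb R^{2n}$. $\mathfrak{sp}(\mathbb R^{2n+2},\Omega')$ is the Lie algebra of endomorphisms $A$ with $\Omega'(Au,v)+\Omega'(u,Av)=0$. Local reduction. Let $A\ne0$ in $\mathfrak{sp}(\mathbb R^{2n+2},\Omega')$ and let $x_0\in\Sigma_A$. The group $\exp tA$ preserves $\Sigma_A$ and $Ax$ vanishes nowhere on $\Sigma_A$, so there are a neighbourhood $U_{x_0}\subset\Sigma_A$ of $x_0$, a ball $D^{red}\subset\mathbb R^{2n}$ centred at $0$, an interval $I=(-\epsilon,\epsilon)$ and a diffeomorphism $\chi:D^{red}\times I\to U_{x_0}$ with $\chi(0,0)=x_0$ and $\chi(y,t)=\exp(-tA)\chi(y,0)$. Let $\pi=p_1\circ\chi^{-1}:U_{x_0}\to D^{red}$, with $p_1$ the first projection. For $x\in U_{x_0}$ let $\mathcal H_x=\{v:\Omega'(v,x)=\Omega'(v,Ax)=0\}\subset T_x\Sigma_A$; $\pi_{*x}$ restricts to an isomorphism $\mathcal H_x\to T_{\pi(x)}D^{red}$, and $\overline X$ denotes the horizontal lift of $X$ (with values in $\mathcal H$). One sets $$\omega^{red}_{\pi(x)}(X,Y)=\Omega'(\overline X_x,\overline Y_x),\qquad (\nabla^{red}_XY)_{\pi(x)}=\pi_{*x}\big(D_{\overline X}\overline Y-\Omega'(A\overline X,\overline Y)x+\Omega'(\overline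 X,\overline Y)Ax\big),$$ where $D$ is the standard flat connection of $\mathbb R^{2n+2}$. These are well defined, and $\nabla^{red}$ is a symplectic connection of Ricci-type on $(D^{red},\omega^{red})$. *)

(* Defs.v *)
From HB Require Import structures.
From mathcomp Require Import all_boot all_order all_algebra.
From mathcomp Require Import all_classical all_reals all_analysis.

Set Implicit Arguments.
Unset Strict Implicit.
Unset Printing Implicit Defensive.

Import Order.TTheory GRing.Theory Num.Theory.
Import numFieldNormedType.Exports.

Local Open Scope classical_set_scope.
Local Open Scope ring_scope.

(* C^oo on an open set of a finite-dimensional space: every iterated
   directional derivative exists and is differentiable. *)
Definition smooth_on (R : realType) (V W : normedModType R)
    (U : set V) (f : V -> W) : Prop :=
  forall (s : seq V) (x : V), U x ->
    differentiable (foldr (fun v (g : V -> W) => fun z => 'D_v g z) f s) x.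

Definition smooth_near (R : realType) (V W : normedModType R)
    (x : V) (f : V -> W) : Prop :=
  exists U : set V, [/\ open U, U x & smooth_on U f].

Definition diffeo (R : realType) (V W : normedModType R)
    (U : set V) (U' : set W) (f : V -> W) (g : W -> V) : Prop :=
  [/\ smooth_on U f, smooth_on U' g,
      (forall x, U x -> U' (f x) /\ g (f x) = x) &
      (forall y, U' y -> U (g y) /\ f (g y) = y)].

Section TensorsOnOpenSets.
Variables (R : realType) (m : nat).
Local Notation E := 'cV[R]_m.

(* Vector fields, 2-forms and covariant derivatives over an open subset V of
   R^m are total functions whose values outside V are irrelevant:
   [X x] is the value at x, [w x u v] is w_x(u, v), and
   [nabla X Y x] is (nabla_X Y)_x. *)
Definition vfield := E -> E.
Definition form2 := E -> E -> E -> R.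
Definition covderiv := vfield -> vfield -> vfield.

Definition lie_bracket (X Y : vfield) : vfield :=
  fun x => 'D_(X x) Y x - 'D_(Y x) X x.

Definition symplectic_form (V : set E) (w : form2) : Prop :=
  [/\ (forall x, V x -> forall (a : R) u u' v,
         w x (a *: u + u') v = a * w x u v + w x u' v),
      (forall x, V x -> forall u v, w x u v = - w x v u),
      (forall u v, smooth_on V (fun x => w x u v)),
      (* closedness, on constant (hence commuting) vector fields *)
      (forall x, V x -> forall u v t,
         'D_u (fun z => w z v t) x + 'D_v (fun z => w z t u) x +
         'D_t (fun z => w z u v) x = 0) &
      (forall x, V x -> forall u, (forall v, w x u v = 0) -> u = 0)].

(* Linear connection on V, acting on vector fields defined near a point. *)
Record linear_connection (V : set E) (nabla : covderiv) : Prop := {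
  conn_local : forall x X X' Y Y', V x ->
    smooth_near x X -> smooth_near x Y ->
    {near x, X =1 X'} -> {near x, Y =1 Y'} -> nabla X Y x = nabla X' Y' x;
  conn_smooth : forall x X Y, V x -> smooth_near x X -> smooth_near x Y ->
    smooth_near x (nabla X Y);
  conn_linearl : forall x (f : E -> R) (X X' Y : vfield), V x ->
    smooth_near x f -> smooth_near x X -> smooth_near x X' ->
    smooth_near x Y ->
    nabla (fun z => f z *: X z + X' z) Y x =
    f x *: nabla X Y x + nabla X' Y x;
  conn_leibniz : forall x (f : E -> R) (X Y Y' : vfield), V x ->
    smooth_near x f -> smooth_near x X -> smooth_near x Y ->
    smooth_near x Y' ->
    nabla X (fun z => f z *: Y z + Y' z) x =
    'D_(X x) f x *: Y x + f x *: nabla X Y x + nabla X Y' x }.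

Definition torsion_free (V : set E) (nabla : covderiv) : Prop :=
  forall x X Y, V x -> smooth_near x X -> smooth_near x Y ->
    nabla X Y x - nabla Y X x = lie_bracket X Y x.

Definition parallel_form (V : set E) (nabla : covderiv) (w : form2) : Prop :=
  forall x X Y Z, V x ->
    smooth_near x X -> smooth_near x Y -> smooth_near x Z ->
    'D_(X x) (fun z => w z (Y z) (Z z)) x =
    w x (nabla X Y x) (Z x) + w x (Y x) (nabla X Z x).

Definition curvature (nabla : covderiv) (X Y Z : vfield) : vfield :=
  fun x => nabla X (nabla Y Z) x - nabla Y (nabla X Z) x
           - nabla (lie_bracket X Y) Z x.

(* r_x(u, v) = Tr (z |-> R_x(u, z) v); the curvature being tensorial, tangent
   vectors are extended to constant fields. *)
Definition ricci (nabla : covderiv) : form2 :=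
  fun x u v =>
    \tr (\matrix_(i, j)
           curvature nabla (cst u) (cst (delta_mx j 0)) (cst v) x i 0).

(* With m = 2n, the factor 1/(2n+2) is (m+2)^-1. *)
Definition ricci_type (V : set E) (w : form2) (nabla : covderiv) : Prop :=
  exists rho : E -> E -> E,
    (forall x, V x -> forall u v, w x u (rho x v) = ricci nabla x u v) /\
    forall x X Y Z, V x ->
      smooth_near x X -> smooth_near x Y -> smooth_near x Z ->
      curvature nabla X Y Z x =
      (m + 2)%:R^-1 *:
        ((2 * w x (X x) (Y x)) *: rho x (Z x)
         + w x (X x) (Z x) *: rho x (Y x)
         - w x (Y x) (Z x) *: rho x (X x)
         + w x (X x) (rho x (Z x)) *: Y x
         - w x (Y x) (rho x (Z x)) *: X x).

(* Push-forward of vector fields by a diffeomorphism f with inverse g. *)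
Definition pushforward (f g : E -> E) (X : vfield) : vfield :=
  fun y => 'd f (g y) (X (g y)).

(* f : (V, w) -> (_, w') is symplectic: f^* w' = w on V. *)
Definition symplectic_map (V : set E) (w w' : form2) (f : E -> E) : Prop :=
  forall x, V x -> forall u v,
    w' (f x) ('d f x u) ('d f x v) = w x u v.

(* f : (V, nabla) -> (_, nabla'), with inverse g, is affine. *)
Definition affine_map (V : set E) (nabla nabla' : covderiv)
    (f g : E -> E) : Prop :=
  forall x X Y, V x -> smooth_near x X -> smooth_near x Y ->
    nabla' (pushforward f g X) (pushforward f g Y) (f x) =
    'd f x (nabla X Y x).

End TensorsOnOpenSets.

Record chart (R : realType) (m : nat) (M : Type) := Chart {
  cdom : set M;
  cmap : M -> 'cV[R]_m;
  cinv : 'cV[R]_m -> M }.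

Section Manifolds.
Variables (R : realType) (m : nat).

Definition crange (M : Type) (c : chart R m M) : set 'cV[R]_m :=
  cmap c @` cdom c.

Definition homeo_chart (M : topologicalType) (c : chart R m M) : Prop :=
  [/\ open (cdom c), open (crange c),
      (forall q, cdom c q -> cinv c (cmap c q) = q),
      {within cdom c, continuous (cmap c)} &
      {within crange c, continuous (cinv c)}].

(* Domain of the transition map [cmap d \o cinv c]. *)
Definition overlap (M : Type) (c d : chart R m M) : set 'cV[R]_m :=
  cmap c @` (cdom c `&` cdom d).

Record smooth_manifold := SmoothManifold {
  carrier :> topologicalType;
  atlas : set (chart R m carrier);
  manifold_hausdorff : hausdorff_space carrier;
  manifold_second_countable : @second_countable carrier;
  atlas_chart : forall c, atlas c -> homeo_chart c;
  atlas_cover : forall p, exists2 c, atlas c & cdom c p;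
  atlas_smooth : forall c d, atlas c -> atlas d ->
    smooth_on (overlap c d) (cmap d \o cinv c) }.

Variable M : smooth_manifold.

(* Forms and connections on M are families of local representatives, one in
   each chart of the atlas, that agree under the transition maps. *)
Definition manifold_form := chart R m M -> form2 R m.
Definition manifold_covderiv := chart R m M -> covderiv R m.

Definition manifold_symplectic_form (omega : manifold_form) : Prop :=
  (forall c, atlas c -> symplectic_form (crange c) (omega c)) /\
  (forall c d, atlas c -> atlas d ->
     symplectic_map (overlap c d) (omega c) (omega d) (cmap d \o cinv c)).

Definition manifold_connection (nabla : manifold_covderiv) : Prop :=
  (forall c, atlas c -> linear_connection (crange c) (nabla c)) /\
  (forall c d, atlas c -> atlas d ->
     affine_map (overlap c d) (nabla c) (nabla d)
       (cmap d \o cinv c) (cmap c \o cinv d)).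

Definition symplectic_connection (omega : manifold_form)
    (nabla : manifold_covderiv) : Prop :=
  manifold_connection nabla /\
  forall c, atlas c -> torsion_free (crange c) (nabla c) /\
                       parallel_form (crange c) (nabla c) (omega c).

Definition manifold_ricci_type (omega : manifold_form)
    (nabla : manifold_covderiv) : Prop :=
  forall c, atlas c -> ricci_type (crange c) (omega c) (nabla c).

(* A neighbourhood of p in (M, omega, nabla) is isomorphic, by a symplectic
   affine diffeomorphism f with inverse g, to an open subset of (D, w', nabla'),
   D being an open subset of R^m. *)
Definition locally_isomorphic_at (p : M)
    (omega : manifold_form) (nabla : manifold_covderiv)
    (D : set 'cV[R]_m) (w' : form2 R m) (nabla' : covderiv R m) : Prop :=
  exists (W : set M) (f : M -> 'cV[R]_m) (g : 'cV[R]_m -> M),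
    [/\ open W, W p & forall q, W q -> g (f q) = q] /\
    [/\ open (f @` W), f @` W `<=` D &
        forall c, atlas c ->
          let Wc := cmap c @` (W `&` cdom c) in
          let fc := f \o cinv c in
          let gc := cmap c \o g in
          [/\ diffeo Wc (f @` (W `&` cdom c)) fc gc,
              symplectic_map Wc (omega c) w' fc &
              affine_map Wc (nabla c) nabla' fc gc]].

End Manifolds.

Section StandardSymplectic.
Variable R : realType.

Definition stdJ (k : nat) : 'M[R]_(k + k) := block_mx 0 1%:M (- 1%:M) 0.

(* R^(2n+2) = R^2 (+) R^(2n), orthogonal for Omega'. *)
Definition OmegaMx (n : nat) : 'M[R]_(2 + (n + n)) :=
  block_mx (stdJ 1) 0 0 (stdJ n).

Definition Omega' (n : nat) (u v : 'cV[R]_(2 + (n + n))) : R :=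
  (u^T *m OmegaMx n *m v) 0 0.

Definition e0 (n : nat) : 'cV[R]_(2 + (n + n)) := delta_mx (lshift _ 0) 0.

Definition in_sp (n : nat) (A : 'M[R]_(2 + (n + n))) : Prop :=
  forall u v, Omega' (A *m u) v + Omega' u (A *m v) = 0.

Definition Sigma (n : nat) (A : 'M[R]_(2 + (n + n))) :
    set 'cV[R]_(2 + (n + n)) :=
  [set x | Omega' x (A *m x) = 1].

Definition expmx (k : nat) (B : 'M[R]_k) : 'M[R]_k :=
  lim (series (fun i => (i`!%:R)^-1 *: B ^+ i) @ \oo).

Definition eball (k : nat) (r : R) : set 'cV[R]_k :=
  [set y | \sum_i y i 0 ^+ 2 < r ^+ 2].

Definition cylinder (k : nat) (r eps : R) : set ('cV[R]_k * R) :=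
  [set yt | eball r yt.1 /\ - eps < yt.2 < eps].

End StandardSymplectic.

Section LocalReduction.
Variables (R : realType) (n : nat).
Local Notation E' := 'cV[R]_(2 + (n + n)).
Local Notation E := 'cV[R]_(n + n).
Variables (A : 'M[R]_(2 + (n + n))) (x0 : E').

(* U = nbhd_amb `&` Sigma A is the neighbourhood U_{x0} of x0 in Sigma A.
   That chi^-1 is smooth on the hypersurface piece U is expressed by giving
   chi_inv as a smooth map on the open set nbhd_amb of the ambient space; only
   its restriction to U matters below.  Such an extension always exists:
   precompose chi^-1 with the retraction z |-> z / sqrt (Omega' z (A z)). *)
Record local_reduction := LocalReduction {
  radius : R;
  epsilon : R;
  nbhd_amb : set E';
  chi : E * R -> E';
  chi_inv : E' -> E * R;
  radius_gt0 : 0 < radius;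
  epsilon_gt0 : 0 < epsilon;
  nbhd_amb_open : open nbhd_amb;
  chi_smooth : smooth_on (cylinder radius epsilon) chi;
  chi_inv_smooth : smooth_on nbhd_amb chi_inv;
  chi_image : chi @` cylinder radius epsilon = nbhd_amb `&` Sigma A;
  chiK : forall yt, cylinder radius epsilon yt -> chi_inv (chi yt) = yt;
  chi_center : chi (0, 0) = x0;
  chi_flow : forall y t, cylinder radius epsilon (y, t) ->
    chi (y, t) = expmx (- t *: A) *m chi (y, 0) }.

Variable L : local_reduction.

Definition Dred : set E := eball (radius L).

Definition pi_red (x : E') : E := (chi_inv L x).1.

Definition horizontal (x : E') : set E' :=
  [set v | Omega' v x = 0 /\ Omega' v (A *m x) = 0].

(* The vector of H_x that pi_* maps to u. *)
Definition hlift (x : E') (u : E) : E' :=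
  xget 0 [set v | horizontal x v /\ 'd pi_red x v = u].

Definition hlift_field (X : vfield R (n + n)) : E' -> E' :=
  fun x => hlift x (X (pi_red x)).

(* The reduced structures do not depend on the point x of the fibre of pi over
   y at which they are computed; we take x = chi (y, 0). *)
Definition omega_red : form2 R (n + n) :=
  fun y u v =>
    let x := chi L (y, 0) in
    Omega' (hlift x u) (hlift x v).

Definition nabla_red : covderiv R (n + n) :=
  fun X Y y =>
    let x := chi L (y, 0) in
    let X' := hlift_field X in
    let Y' := hlift_field Y in
    'd pi_red x ('D_(X' x) Y' x
                 - Omega' (A *m X' x) (Y' x) *: x
                 + Omega' (X' x) (Y' x) *: (A *m x)).

End LocalReduction.

(* Main.v *)
(* In a chart write the curvature endomorphism as B = - rho / (m + 2), m = 2n.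
   The second Bianchi identity and the Ricci identity, contracted, produce a
   vector field u and a function phi with
   (nabla_X B) h = omega(h, u) X - omega(X, h) u, nabla_X u = B^2 X - phi X and
   d phi (X) = - 2 omega(B X, u).
   Hence on the bundle R^2 + TM, with the form J + omega, the connection

     X . (a, b, h) = (- omega(X, u) b + omega(B X, h), - omega(X, h),
                      a X + b B X + nabla_X h)

   has curvature - 2 omega(X, Y) Aa, where the symplectic endomorphism
   Aa (a, b, h) = (phi b - omega(h, u), a, b u + B h) is parallel.  Radial
   transport therefore gives a symplectic frame F with A F = F Aa, A constant,
   and D_v F = F theta_v - lam_v A F: the failure of F to be parallel is tangent
   to the flow of A.  The map y |-> F(y) e0 takes values in Sigma_A and
   F (0, 0, w) spans the horizontal space, so its composition with the projection
   pi of any local reduction is a local diffeomorphism, and the structure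
   equation of F says precisely that it is symplectic and affine. *)
Require Import Defs.
From HB Require Import structures.
From mathcomp Require Import all_boot all_order all_algebra.
From mathcomp Require Import all_classical all_reals all_analysis.
From mathcomp Require Import ring lra.

Set Implicit Arguments.
Unset Strict Implicit.
Unset Printing Implicit Defensive.

Import Order.TTheory GRing.Theory Num.Theory.
Import numFieldNormedType.Exports.

Local Open Scope classical_set_scope.
Local Open Scope ring_scope.

(** * Smooth maps *)

Section Differentiability.
Context {R : realType} {V W : normedModType R}.

(** The connection on [R^2 + TM] is read off from the model: along [Sigma A] a vector splits as
    [a s + b A s + H h], with [s] the position and [H h] horizontal, and the flat derivative of such
    a vector has the displayed components. It is not flat over [M], because [M] is a quotient by the
    flow of [A] and a map from [M] into [Sigma A] is only determined up to that flow; the curvature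
    [- 2 omega] times the matrix of [A] records this. Parallel frames being out of reach, the frame
    is transported along rays, where this curvature can be integrated explicitly. The leftover
    one-form [lam] is harmless: replacing [F] by [exp (tau A) F] changes it by [- d tau], and a
    reduction divides by exactly these moves, so one [A] and one [F] serve every choice of
    reduction. The assumption on the dimension acts twice, as [m > 2]: the contracted Bianchi
    identity is solved by cancelling [m - 2], and the symmetry of the Ricci form uses a third basis
    vector. Smoothness of the frame rests on smooth dependence of linear differential equations on
    parameters, and the local isomorphism on the inverse function theorem. *)

Lemma differentiable_epsP (f : V -> W) a : differentiable f a ->
  forall e, 0 < e ->
    \forall h \near (0 : V), `|f (h + a) - f a - 'd f a h| <= e * `|h|.
Proof.
move=> /diff_locallyP[_ /eqaddoP fo] e e0.
by move: (fo e e0); apply: filterS => h /=; rewrite !fctE opprD addrA.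
Qed.

(** A guessed differential is certified by the epsilon estimate alone; inverse maps and solutions of
    differential equations are differentiated this way. *)
Lemma differentiable_eps (f : V -> W) a (df : {linear V -> W}) :
  continuous df ->
  (forall e, 0 < e ->
    \forall h \near (0 : V), `|f (h + a) - f a - df h| <= e * `|h|) ->
  differentiable f a /\ 'd f a = df :> (V -> W).
Proof.
move=> dfc fo.
have H : f \o shift a = cst (f a) + df +o_ 0 id.
  apply/eqaddoP => e e0; move: (fo e e0).
  by apply: filterS => h /=; rewrite !fctE opprD addrA.
have dE := diff_unique dfc H.
by split=> //; apply/diff_locallyP; rewrite dE.
Qed.

Lemma near_eq_diff (f g : V -> W) a : {near a, f =1 g} ->
  differentiable f a -> differentiable g a /\ 'd g a = 'd f a :> (V -> W).
Proof.
move=> fg df; apply: differentiable_eps; first exact: diff_continuous.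
move=> e e0; have ga := nbhs_singleton fg.
have : \forall h \near (0 : V), f (h + a) = g (h + a).
  by move: fg; rewrite (near_shift 0); apply: filterS => h /=; rewrite subr0.
move: (differentiable_epsP df e0).
by apply: filterS2 => h + fgh; rewrite -fgh -ga.
Qed.

Lemma near_eq_differentiable (f g : V -> W) a : {near a, f =1 g} ->
  differentiable f a -> differentiable g a.
Proof. by move=> fg /(near_eq_diff fg)[]. Qed.

Lemma derive_linear (f : V -> W) a (u v : V) (r : R) : differentiable f a ->
  'D_(r *: u + v) f a = r *: 'D_u f a + 'D_v f a.
Proof. by move=> df; rewrite !deriveE// linearP. Qed.

End Differentiability.

Section Smooth.
Context {R : realType}.
Implicit Types V W Z : normedModType R.

(** Bounding the number of derivatives makes induction on the order possible: [smooth_uptoS] peels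
    off the innermost derivative, the one on which product, chain and quotient rules act. *)
Definition smooth_upto V W k (U : set V) (f : V -> W) := forall (s : seq V),
  (size s <= k)%N -> forall x, U x ->
  differentiable (foldr (fun v (g : V -> W) => 'D_v g) f s) x.

Lemma smooth_uptoP V W (U : set V) (f : V -> W) :
  smooth_on U f <-> forall k, smooth_upto k U f.
Proof. by split=> [sf k s _ x /sf|sf s x]; [exact|apply: (sf (size s))]. Qed.

Lemma smooth_uptoS V W k (U : set V) (f : V -> W) :
  smooth_upto k.+1 U f <->
  (forall x, U x -> differentiable f x) /\ forall v, smooth_upto k U ('D_v f).
Proof.
split=> [sf|[df sf] s].
  split=> [x|v s ss x Ux]; first exact: (sf [::]).
  by have := sf (rcons s v); rewrite size_rcons foldr_rcons; apply.
case: (lastP s) => [_ x|{}s v]; first exact: df.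
by rewrite size_rcons foldr_rcons ltnS => /sf; apply.
Qed.

Lemma smooth_upto0 V W (U : set V) (f : V -> W) :
  smooth_upto 0 U f <-> (forall x, U x -> differentiable f x).
Proof.
split=> [sf x|sf s]; first exact: (sf [::]).
by rewrite leqn0 => /nilP -> x; exact: sf.
Qed.

Lemma smooth_upto_le V W k l (U : set V) (f : V -> W) : (k <= l)%N ->
  smooth_upto l U f -> smooth_upto k U f.
Proof. by move=> kl sf s sk; apply: sf; exact: leq_trans kl. Qed.

Lemma smooth_on_sub V W (U U' : set V) (f : V -> W) : U' `<=` U ->
  smooth_on U f -> smooth_on U' f.
Proof. by move=> UU sf s x /UU; exact: sf. Qed.

Lemma smooth_on_diff V W (U : set V) (f : V -> W) x :
  smooth_on U f -> U x -> differentiable f x.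
Proof. by move=> sf; exact: (sf [::]). Qed.

Lemma smooth_on_derive V W (U : set V) (f : V -> W) v :
  smooth_on U f -> smooth_on U ('D_v f).
Proof.
by move=> /smooth_uptoP sf; apply/smooth_uptoP => k; have /smooth_uptoS[_] := sf k.+1.
Qed.

Lemma smooth_upto_ext V W k (U : set V) (f g : V -> W) : open U ->
  (forall x, U x -> f x = g x) -> smooth_upto k U f -> smooth_upto k U g.
Proof.
move=> oU; elim: k f g => [|k IH] f g fg.
  rewrite !smooth_upto0 => sf x Ux; apply: (near_eq_differentiable _ (sf x Ux)).
  by apply: filterS fg _; exact: open_nbhs_nbhs.
have nfg x : U x -> {near x, f =1 g}.
  by move=> Ux; apply: filterS fg _; exact: open_nbhs_nbhs.
rewrite !smooth_uptoS => -[df sf]; split=> [x Ux|v].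
  exact: (near_eq_differentiable (nfg x Ux) (df x Ux)).
apply: IH (sf v) => x Ux; exact: near_eq_derive (nfg x Ux).
Qed.

Lemma smooth_on_ext V W (U : set V) (f g : V -> W) : open U ->
  (forall x, U x -> f x = g x) -> smooth_on U f -> smooth_on U g.
Proof.
move=> oU fg /smooth_uptoP sf; apply/smooth_uptoP => k.
exact: smooth_upto_ext fg (sf k).
Qed.

Lemma smooth_upto_cst V W k (U : set V) (c : W) : smooth_upto k U (cst c).
Proof.
elim: k c => [|k IH] c; first by apply/smooth_upto0 => x _; exact: differentiable_cst.
apply/smooth_uptoS; split=> [x _|v]; first exact: differentiable_cst.
rewrite (_ : 'D_v _ = cst 0) //.
by apply/funext => x /=; rewrite derive_cst.
Qed.

Lemma smooth_on_cst V W (U : set V) (c : W) : smooth_on U (fun=> c).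
Proof. by apply/smooth_uptoP => k; exact: smooth_upto_cst. Qed.

Lemma smooth_upto_linear V W Z k (U : set V) (f : V -> W) (L : {linear W -> Z}) :
  open U -> continuous L -> smooth_upto k U f -> smooth_upto k U (L \o f).
Proof.
move=> oU Lc; have dL w : differentiable L w by exact: linear_differentiable.
elim: k f => [|k IH] f.
  by rewrite !smooth_upto0 => sf x /sf; move=> df; apply: differentiable_comp.
rewrite !smooth_uptoS => -[df sf]; split=> [x /df dfx|v].
  exact: differentiable_comp.
apply: (smooth_upto_ext oU _ (IH _ (sf v))) => x /df dfx.
rewrite [RHS]deriveE; last exact: differentiable_comp.
by rewrite diff_comp// /= diff_lin// deriveE.
Qed.

Lemma smooth_on_linear V W Z (U : set V) (f : V -> W) (L : {linear W -> Z}) :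
  open U -> continuous L -> smooth_on U f -> smooth_on U (fun x => L (f x)).
Proof.
move=> oU Lc /smooth_uptoP sf; apply/smooth_uptoP => k.
exact: smooth_upto_linear.
Qed.

Lemma smooth_uptoD V W k (U : set V) (f g : V -> W) :
  open U -> smooth_upto k U f -> smooth_upto k U g ->
  smooth_upto k U (fun x => f x + g x).
Proof.
move=> oU; elim: k f g => [|k IH] f g.
  by rewrite !smooth_upto0 => sf sg x Ux; apply: differentiableD; [exact: sf|exact: sg].
rewrite !smooth_uptoS => -[df sf] [dg sg]; split=> [x Ux|v].
  by apply: differentiableD; [exact: df|exact: dg].
apply: (smooth_upto_ext oU _ (IH _ _ (sf v) (sg v))) => x Ux.
rewrite [RHS]deriveD//; apply: diff_derivable; [exact: df|exact: dg].
Qed.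

Lemma smooth_onD V W (U : set V) (f g : V -> W) :
  open U -> smooth_on U f -> smooth_on U g -> smooth_on U (fun x => f x + g x).
Proof.
move=> oU /smooth_uptoP sf /smooth_uptoP sg; apply/smooth_uptoP => k.
exact: smooth_uptoD.
Qed.

Lemma smooth_upto_sum V W k (U : set V) (I : Type) (r : seq I) (P : pred I)
    (f : I -> V -> W) : open U -> (forall i, P i -> smooth_upto k U (f i)) ->
  smooth_upto k U (fun x => \sum_(i <- r | P i) f i x).
Proof.
move=> oU sf; elim: r => [|i r IH].
  by under eq_fun do rewrite big_nil; exact: smooth_upto_cst.
under eq_fun do rewrite big_cons; have := sf i; case: (P i) => // /(_ isT) si.
exact: smooth_uptoD.
Qed.

Lemma smooth_on_sum V W (U : set V) (I : Type) (r : seq I) (P : pred I)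
    (f : I -> V -> W) : open U -> (forall i, P i -> smooth_on U (f i)) ->
  smooth_on U (fun x => \sum_(i <- r | P i) f i x).
Proof.
move=> oU sf; apply/smooth_uptoP => k; apply: smooth_upto_sum => // i /sf.
by move=> /smooth_uptoP.
Qed.

Lemma continuous_opp W : continuous (fun x : W => - x).
Proof. by move=> x; exact: (@continuousN _ _ _ id x). Qed.

Lemma smooth_onN V W (U : set V) (f : V -> W) :
  open U -> smooth_on U f -> smooth_on U (fun x => - f x).
Proof.
move=> oU sf; apply: (@smooth_on_linear _ _ _ _ _ (-%R)) => //.
exact: continuous_opp.
Qed.

Lemma smooth_onB V W (U : set V) (f g : V -> W) :
  open U -> smooth_on U f -> smooth_on U g -> smooth_on U (fun x => f x - g x).
Proof. by move=> oU sf sg; apply: smooth_onD => //; exact: smooth_onN. Qed.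

Lemma is_diff_bilin V W1 W2 Z (b : {bilinear W1 -> W2 -> Z}) f g x :
  continuous (fun p => b p.1 p.2) ->
  differentiable f x -> differentiable g x ->
  differentiable (fun y : V => b (f y) (g y)) x /\
  forall v, 'D_v (fun y => b (f y) (g y)) x = b ('D_v f x) (g x) + b (f x) ('D_v g x).
Proof.
move=> bc df dg.
pose h := fun y => (f y, g y).
have dh : differentiable h x by exact: differentiable_pair.
have db : differentiable (fun p => b p.1 p.2) (h x) by exact: differentiable_bilin.
have dbh := differentiable_comp dh db.
split=> // v; rewrite deriveE//.
rewrite (@diff_comp _ _ _ _ h (fun p => b p.1 p.2))// /= diff_bilin// diff_pair//=.
by rewrite -!deriveE// addrC.
Qed.

Lemma smooth_upto_bilin V W1 W2 Z k (U : set V) (b : {bilinear W1 -> W2 -> Z}) f g :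
  open U -> continuous (fun p => b p.1 p.2) ->
  smooth_upto k U f -> smooth_upto k U g ->
  smooth_upto k U (fun y => b (f y) (g y)).
Proof.
move=> oU bc; elim: k f g => [|k IH] f g.
  rewrite !smooth_upto0 => df dg x Ux.
  by have [] := is_diff_bilin bc (df x Ux) (dg x Ux).
move=> sf sg; have sfk := smooth_upto_le (leqnSn k) sf.
have sgk := smooth_upto_le (leqnSn k) sg.
move/smooth_uptoS: sf => [df sf]; move/smooth_uptoS: sg => [dg sg].
rewrite smooth_uptoS; split=> [x Ux|v].
  by have [] := is_diff_bilin bc (df x Ux) (dg x Ux).
apply: (smooth_upto_ext oU _ (smooth_uptoD oU (IH _ _ (sf v) sgk) (IH _ _ sfk (sg v)))).
by move=> x Ux; have [_ ->] := is_diff_bilin bc (df x Ux) (dg x Ux).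
Qed.

Lemma smooth_on_bilin V W1 W2 Z (U : set V) (b : {bilinear W1 -> W2 -> Z}) f g :
  open U -> continuous (fun p => b p.1 p.2) ->
  smooth_on U f -> smooth_on U g -> smooth_on U (fun y => b (f y) (g y)).
Proof.
move=> oU bc /smooth_uptoP sf /smooth_uptoP sg; apply/smooth_uptoP => k.
exact: smooth_upto_bilin.
Qed.

End Smooth.

Section ScaleBilinear.
Variables (R : realType) (W : normedModType R).

Definition scale_fun (k : R) (w : W) : W := k *: w.

Lemma scale_fun_is_bilinear :
  bilinear_for
    (GRing.Scale.Law.clone _ _ *:%R _) (GRing.Scale.Law.clone _ _ *:%R _)
    scale_fun.
Proof.
by rewrite /scale_fun; split=> [u'|u] a x y /=;
  rewrite ?scalerDl ?scalerDr ?scalerA// mulrC.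
Qed.

HB.instance Definition _ := bilinear_isBilinear.Build R R W W _ _ scale_fun
  scale_fun_is_bilinear.

Lemma scale_fun_continuous : continuous (fun p => scale_fun p.1 p.2).
Proof. exact: scale_continuous. Qed.

End ScaleBilinear.

Section SmoothAlgebra.
Context {R : realType}.
Implicit Types V W Z : normedModType R.

Lemma derive_scale V W (k : V -> R) (f : V -> W) x v :
  differentiable k x -> differentiable f x ->
  'D_v (fun y => k y *: f y) x = 'D_v k x *: f x + k x *: 'D_v f x.
Proof.
move=> dk df.
by have [_ /(_ v)] := is_diff_bilin (@scale_fun_continuous R W) dk df.
Qed.

Lemma smooth_upto_scale V W k (U : set V) (c : V -> R) (f : V -> W) :
  open U -> smooth_upto k U c -> smooth_upto k U f ->
  smooth_upto k U (fun x => c x *: f x).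
Proof. by move=> oU; exact: (smooth_upto_bilin oU (@scale_fun_continuous R W)). Qed.

Lemma smooth_on_scale V W (U : set V) (c : V -> R) (f : V -> W) :
  open U -> smooth_on U c -> smooth_on U f -> smooth_on U (fun x => c x *: f x).
Proof. by move=> oU; exact: (smooth_on_bilin oU (@scale_fun_continuous R W)). Qed.

Lemma mulr_continuous2 : continuous (fun p : R * R => p.1 * p.2).
Proof. by move=> ?; exact: mul_continuous. Qed.

Lemma smooth_uptoM V k (U : set V) (f g : V -> R) :
  open U -> smooth_upto k U f -> smooth_upto k U g ->
  smooth_upto k U (fun x => f x * g x).
Proof. by move=> oU; exact: (smooth_upto_bilin oU mulr_continuous2). Qed.

Lemma smooth_onM V (U : set V) (f g : V -> R) :
  open U -> smooth_on U f -> smooth_on U g -> smooth_on U (fun x => f x * g x).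
Proof. by move=> oU; exact: (smooth_on_bilin oU mulr_continuous2). Qed.

Lemma smooth_on_prod V (U : set V) (I : Type) (r : seq I) (P : pred I)
    (f : I -> V -> R) : open U -> (forall i, P i -> smooth_on U (f i)) ->
  smooth_on U (fun x => \prod_(i <- r | P i) f i x).
Proof.
move=> oU sf; elim: r => [|i r IH].
  by under eq_fun do rewrite big_nil; exact: smooth_on_cst.
under eq_fun do rewrite big_cons; have := sf i; case: (P i) => // /(_ isT) si.
exact: smooth_onM.
Qed.

Lemma derive_inv V (f : V -> R) x v : f x != 0 -> differentiable f x ->
  differentiable (fun y => (f y)^-1) x /\
  'D_v (fun y => (f y)^-1) x = - ((f x)^-1 * (f x)^-1 * 'D_v f x).
Proof.
move=> fx df; split; first exact: differentiableV.
rewrite (@deriveV _ _ f)//; last exact: diff_derivable.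
by rewrite /GRing.scale/= -exprVn expr2 mulNr.
Qed.

Lemma smooth_upto_inv V k (U : set V) (f : V -> R) :
  open U -> (forall x, U x -> f x != 0) -> smooth_upto k U f ->
  smooth_upto k U (fun x => (f x)^-1).
Proof.
move=> oU f0; elim: k => [|k IH].
  rewrite !smooth_upto0 => df x Ux.
  by have [] := derive_inv 0 (f0 x Ux) (df x Ux).
move=> sf; have sfk := smooth_upto_le (leqnSn k) sf.
move/smooth_uptoS: sf => [df sf]; rewrite smooth_uptoS; split=> [x Ux|v].
  by have [] := derive_inv 0 (f0 x Ux) (df x Ux).
have sfi := IH sfk.
apply: (smooth_upto_ext oU (f := fun x => (- 1) * ((f x)^-1 * (f x)^-1 * 'D_v f x))).
  by move=> x Ux; have [_ ->] := derive_inv v (f0 x Ux) (df x Ux); rewrite mulN1r.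
by do !apply: smooth_uptoM => //; exact: smooth_upto_cst.
Qed.

Lemma smooth_on_inv V (U : set V) (f : V -> R) :
  open U -> (forall x, U x -> f x != 0) -> smooth_on U f ->
  smooth_on U (fun x => (f x)^-1).
Proof.
move=> oU f0 /smooth_uptoP sf; apply/smooth_uptoP => k; exact: smooth_upto_inv.
Qed.

Lemma smooth_on_pair V W Z (U : set V) (f : V -> W) (g : V -> Z) :
  open U -> smooth_on U f -> smooth_on U g -> smooth_on U (fun x => (f x, g x)).
Proof.
move=> oU sf sg; apply/smooth_uptoP => k.
move/smooth_uptoP/(_ k): sf; move/smooth_uptoP/(_ k): sg.
elim: k f g => [|k IH] f g.
  by rewrite !smooth_upto0 => dg df x Ux; apply: differentiable_pair; [exact: df|exact: dg].
rewrite !smooth_uptoS => -[dg sg] [df sf]; split=> [x Ux|v].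
  by apply: differentiable_pair; [exact: df|exact: dg].
apply: (smooth_upto_ext oU _ (IH _ _ (sg v) (sf v))) => x Ux.
have [dfx dgx] := (df x Ux, dg x Ux).
rewrite [RHS]deriveE; last exact: differentiable_pair.
by rewrite diff_pair//= -!deriveE.
Qed.

(* Finite dimensionality in the form needed by the chain rule: a finite family
   with continuous coordinate functions. *)
Definition finite_frame W := exists k (e : 'I_k -> W) (l : 'I_k -> {linear W -> R}),
  (forall i, continuous (l i)) /\ forall w, w = \sum_i l i w *: e i.

Lemma finite_frame_R : finite_frame R.
Proof.
exists 1%N, (fun=> 1), (fun=> idfun); split=> [_ x|w]; first exact: cvg_id.
by rewrite big_ord1 /GRing.scale/= mulr1.
Qed.

Definition coord_mx m n i j (N : 'M[R]_(m, n)) : R := N i j.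

Lemma coord_mx_is_linear m n i j : linear (@coord_mx m n i j).
Proof. by move=> a u v; rewrite /coord_mx !mxE. Qed.

HB.instance Definition _ m n i j := GRing.isLinear.Build R _ _ _
  (@coord_mx m n i j) (@coord_mx_is_linear m n i j).

Lemma finite_frame_mx m n : finite_frame 'M[R]_(m, n).
Proof.
exists #|{: 'I_m * 'I_n}|, (fun k => delta_mx (enum_val k).1 (enum_val k).2),
  (fun k => @coord_mx m n (enum_val k).1 (enum_val k).2 : {linear _ -> _}); split=> [k|M].
  exact: coord_continuous.
rewrite [LHS]matrix_sum_delta pair_big /=.
by rewrite (reindex _ (onW_bij _ (@enum_val_bij _))).
Qed.

Lemma finite_frame_pair V W : finite_frame V -> finite_frame W ->
  finite_frame (V * W)%type.
Proof.
move=> [k [e [l [lc le]]]] [k' [e' [l' [lc' le']]]].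
exists (k + k')%N,
  (fun i : 'I_(k + k') => match fintype.split i with inl a => (e a, 0) | inr b => (0, e' b) end),
  (fun i : 'I_(k + k') => match fintype.split i with
            | inl a => (l a \o @fst V W : {linear (V * W)%type -> R})
            | inr b => (l' b \o @snd V W : {linear (V * W)%type -> R}) end); split=> [i p|[v w]].
  case: (fintype.split i) => [a|b]; rewrite /= .
    by apply: (@continuous_comp _ _ _ fst (l a)); [exact: cvg_fst|exact: lc].
  by apply: (@continuous_comp _ _ _ snd (l' b)); [exact: cvg_snd|exact: lc'].
rewrite big_split_ord/=.
under eq_bigr do rewrite (unsplitK (inl _))/=.
under [X in _ + X]eq_bigr do rewrite (unsplitK (inr _))/=.
have pE (q : V * W) : q = (q.1, q.2) by case: q.
rewrite [RHS]pE; congr (_, _).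
  rewrite /= (raddf_sum fst) (raddf_sum fst)/= [X in _ + X]big1 ?addr0; last first.
    by move=> i _ /=; rewrite scaler0.
  exact: le.
rewrite /= (raddf_sum snd) (raddf_sum snd)/= [X in X + _]big1 ?add0r; last first.
  by move=> i _ /=; rewrite scaler0.
exact: le'.
Qed.

(** The frame writes the derivative of the composite as a sum of
    [l i ('D_v f x) *: 'D_(e i) g (f x)]; the directions [e i] are constant, so the induction
    hypothesis applies to each ['D_(e i) g]. *)
Lemma smooth_upto_comp V W Z k (U : set V) (U' : set W) (f : V -> W) (g : W -> Z) :
  finite_frame W -> open U -> (forall x, U x -> U' (f x)) ->
  smooth_upto k U f -> smooth_upto k U' g -> smooth_upto k U (g \o f).
Proof.
move=> [d [e [l [lc le]]]] oU fU; elim: k Z f g fU => [|k IH] Z f g fU.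
  by rewrite !smooth_upto0 => df dg x Ux; apply: differentiable_comp; [exact: df|exact/dg/fU].
move=> sf; have sfk := smooth_upto_le (leqnSn k) sf.
move/smooth_uptoS: sf => [df sf]; rewrite !smooth_uptoS => -[dg sg].
split=> [x Ux|v]; first by apply: differentiable_comp; [exact: df|exact/dg/fU].
apply: (smooth_upto_ext oU
  (f := fun x => \sum_i l i ('D_v f x) *: ('D_(e i) g \o f) x)) => [x Ux|].
  have dfx := df x Ux; have dgx := dg _ (fU x Ux).
  rewrite [RHS]deriveE; last exact: differentiable_comp.
  rewrite diff_comp//= [in RHS](le ('d f x v)) linear_sum.
  by apply: eq_bigr => i _; rewrite linearZ/= !deriveE.
apply: smooth_upto_sum => // i _; apply: smooth_upto_scale => //.
  exact: smooth_upto_linear.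
exact: IH.
Qed.

Lemma smooth_on_comp V W Z (U : set V) (U' : set W) (f : V -> W) (g : W -> Z) :
  finite_frame W -> open U -> (forall x, U x -> U' (f x)) ->
  smooth_on U f -> smooth_on U' g -> smooth_on U (fun x => g (f x)).
Proof.
move=> fW oU fU /smooth_uptoP sf /smooth_uptoP sg; apply/smooth_uptoP => k.
exact: smooth_upto_comp (sf k) (sg k).
Qed.

Lemma derive_comp V W Z (f : V -> W) (g : W -> Z) x v :
  differentiable f x -> differentiable g (f x) ->
  'D_v (fun y => g (f y)) x = 'D_('D_v f x) g (f x).
Proof.
move=> df dg; rewrite deriveE; last exact: differentiable_comp.
by rewrite (@diff_comp _ _ _ _ f g)//= !deriveE.
Qed.

Lemma continuous_mx_entries V m n (f : V -> 'M[R]_(m, n)) x :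
  (forall i j, {for x, continuous (fun y => f y i j)}) -> {for x, continuous f}.
Proof.
move=> fc; apply/cvgrPdist_le => e e0; near=> y.
rewrite /Num.Def.normr/= mx_normrE (bigmax_le _ (ltW e0))//= => i _.
rewrite !mxE; move: i; near: y; apply: filter_forall => /= i.
exact: ((cvgrPdist_le _ _).1 (fc i.1 i.2)).
Unshelve. all: by end_near. Qed.

Lemma linear_mx_continuous W m n (L : {linear 'M[R]_(m, n) -> W}) : continuous L.
Proof.
move=> M; rewrite (_ : (L : _ -> _) = \sum_i \sum_j (fun N : 'M[R]_(m, n) => N i j *: L (delta_mx i j))).
  have dL : differentiable (\sum_i \sum_j (fun N : 'M[R]_(m, n) => N i j *: L (delta_mx i j))) M.
    apply: differentiable_sum => i; apply: differentiable_sum => j.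
    by apply: (@differentiableZl _ _ _ (fun N : 'M[R]_(m, n) => N i j)); exact: differentiable_coord.
  exact: differentiable_continuous.
apply/funext => N; rewrite [in LHS](matrix_sum_delta N) linear_sum fct_sumE.
by apply: eq_bigr => i _; rewrite linear_sum fct_sumE; apply: eq_bigr => j _; rewrite linearZ.
Qed.

Lemma smooth_on_linmx V W m n (U : set V) (f : V -> 'M[R]_(m, n)) (L : {linear 'M[R]_(m, n) -> W}) :
  open U -> smooth_on U f -> smooth_on U (fun x => L (f x)).
Proof. by move=> oU; apply: smooth_on_linear => //; exact: linear_mx_continuous. Qed.

Lemma derive_linmx V W m n (f : V -> 'M[R]_(m, n)) (L : {linear 'M[R]_(m, n) -> W}) x v :
  differentiable f x -> 'D_v (fun y => L (f y)) x = L ('D_v f x).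
Proof.
move=> df; have dL : differentiable L (f x).
  exact/linear_differentiable/linear_mx_continuous.
rewrite (derive_comp (g := L))// deriveE//.
by rewrite diff_lin //; exact: linear_mx_continuous.
Qed.

Lemma differentiable_linmx V W m n (f : V -> 'M[R]_(m, n)) (L : {linear 'M[R]_(m, n) -> W}) x :
  differentiable f x -> differentiable (fun y => L (f y)) x.
Proof.
move=> df; apply: (@differentiable_comp _ _ _ _ f L) => //.
exact/linear_differentiable/linear_mx_continuous.
Qed.

Lemma smooth_on_mxP V m n (U : set V) (f : V -> 'M[R]_(m, n)) : open U ->
  smooth_on U f <-> forall i j, smooth_on U (fun x => f x i j).
Proof.
move=> oU; split=> [sf i j|sf]; first exact: (smooth_on_linmx (@coord_mx m n i j)).
have -> : f = fun x => \sum_i \sum_j f x i j *: delta_mx i j.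
  by apply/funext => x; exact: matrix_sum_delta.
apply: smooth_on_sum => // i _; apply: smooth_on_sum => // j _.
by apply: smooth_on_scale => //; exact: smooth_on_cst.
Qed.

Lemma mulmx_continuous2 m n p :
  continuous (fun q : 'M[R]_(m, n) * 'M[R]_(n, p) => q.1 *m q.2).
Proof.
move=> q; apply: continuous_mx_entries => i j.
rewrite (_ : (fun _ => _) = \sum_k (fun q : 'M[R]_(m, n) * 'M[R]_(n, p) => q.1 i k * q.2 k j)).
  apply: differentiable_continuous; apply: differentiable_sum => k.
  apply: (@differentiableM _ _ (fun q : 'M[R]_(m, n) * 'M[R]_(n, p) => q.1 i k) (fun q => q.2 k j)).
    apply: (@differentiable_comp _ _ _ _ fst (fun M : 'M[R]_(m, n) => M i k)).
      by apply: linear_differentiable => ?; exact: cvg_fst.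
    exact: differentiable_coord.
  apply: (@differentiable_comp _ _ _ _ snd (fun M : 'M[R]_(n, p) => M k j)).
    by apply: linear_differentiable => ?; exact: cvg_snd.
  exact: differentiable_coord.
by apply/funext => r; rewrite mxE fct_sumE.
Qed.

Lemma smooth_on_mulmx V m n p (U : set V) (f : V -> 'M[R]_(m, n)) (g : V -> 'M[R]_(n, p)) :
  open U -> smooth_on U f -> smooth_on U g -> smooth_on U (fun x => f x *m g x).
Proof. by move=> oU; exact: (smooth_on_bilin oU (@mulmx_continuous2 m n p)). Qed.

Lemma derive_mulmx V m n p (f : V -> 'M[R]_(m, n)) (g : V -> 'M[R]_(n, p)) x v :
  differentiable f x -> differentiable g x ->
  'D_v (fun y => f y *m g y) x = 'D_v f x *m g x + f x *m 'D_v g x.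
Proof.
move=> df dg.
by have [_ /(_ v)] := is_diff_bilin (@mulmx_continuous2 m n p) df dg.
Qed.

Lemma differentiable_mulmx V m n p (f : V -> 'M[R]_(m, n)) (g : V -> 'M[R]_(n, p)) x :
  differentiable f x -> differentiable g x -> differentiable (fun y => f y *m g y) x.
Proof.
move=> df dg.
by have [] := is_diff_bilin (@mulmx_continuous2 m n p) df dg.
Qed.

Lemma smooth_on_det V n (U : set V) (f : V -> 'M[R]_n) : open U ->
  smooth_on U f -> smooth_on U (fun x => \det (f x)).
Proof.
move=> oU /(smooth_on_mxP _ oU) sf; apply: smooth_on_sum => // s _.
by apply: smooth_onM => //; [exact: smooth_on_cst|exact: smooth_on_prod].
Qed.

Lemma smooth_on_invmx V n (U : set V) (f : V -> 'M[R]_n) : open U ->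
  (forall x, U x -> f x \in unitmx) ->
  smooth_on U f -> smooth_on U (fun x => invmx (f x)).
Proof.
move=> oU fU sf.
apply: (smooth_on_ext oU (f := fun x => (\det (f x))^-1 *: \adj (f x))) => [x /fU fx|].
  by rewrite /invmx fx.
apply: smooth_on_scale => //.
  apply: smooth_on_inv => // [x /fU|]; first by rewrite unitmxE unitfE.
  exact: smooth_on_det.
apply/(smooth_on_mxP _ oU) => i j; move/(smooth_on_mxP _ oU) : (sf) => se.
apply: (smooth_on_ext oU (f := fun x => (-1) ^+ (j + i) * \det (row' j (col' i (f x))))) => [x _|].
  by rewrite mxE /cofactor.
apply: smooth_onM => //; first exact: smooth_on_cst.
apply: smooth_on_det => //; apply/(smooth_on_mxP _ oU) => a b.
by apply: (smooth_on_ext oU (f := fun x => f x (lift j a) (lift i b))) => // x _; rewrite !mxE.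
Qed.

Lemma smooth_on_id V (U : set V) : open U -> smooth_on U (fun x => x).
Proof.
move=> oU; apply/smooth_uptoP => -[|k].
  by apply/smooth_upto0 => x _; exact: (@ex_diff _ _ _ _ _ _ _ (is_diff_id x)).
apply/smooth_uptoS; split=> [x _|v]; first exact: (@ex_diff _ _ _ _ _ _ _ (is_diff_id x)).
have -> : 'D_v (fun x : V => x) = cst v by apply/funext => x /=; rewrite derive_id.
exact: smooth_upto_cst.
Qed.

Lemma smooth_on_apply V W (U : set V) (f : V -> W) (X : V -> V) :
  finite_frame V -> open U -> smooth_on U f -> smooth_on U X ->
  smooth_on U (fun x => 'd f x (X x)).
Proof.
move=> [d [e [l [lc le]]]] oU sf sX.
apply: (smooth_on_ext oU (f := fun x => \sum_i l i (X x) *: 'D_(e i) f x)) => [x Ux|].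
  have dfx := smooth_on_diff sf Ux.
  rewrite [X in 'd f x X]le linear_sum; apply: eq_bigr => i _.
  by rewrite linearZ -deriveE.
apply: smooth_on_sum => // i _; apply: smooth_on_scale => //.
  exact: smooth_on_linear.
exact: smooth_on_derive.
Qed.

End SmoothAlgebra.

(** * Strict differentiability and the inverse function theorem *)

(** Completeness of matrix spaces is what the fixed point theorem and absolutely convergent series
    call for below. *)
HB.instance Definition _ (R : realType) m n :=
  Uniform_isComplete.Build 'M[R]_(m, n) (@mx_complete R m n).

Section StrictDifferentiability.
Context {R : realType}.
Implicit Types V W : normedModType R.

Lemma is_derive_line V W (f : V -> W) (x h : V) (t : R) :
  differentiable f (t *: h + x) ->
  is_derive t 1 (fun s : R => f (s *: h + x)) ('D_h f (t *: h + x)).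
Proof.
move=> df; pose l := fun s : R => s *: h + x.
have dl : differentiable l t.
  by apply: differentiableD; [exact: differentiableZl|exact: differentiable_cst].
have dfl : differentiable (fun s => f (l s)) t by exact: (@differentiable_comp _ _ _ _ l f).
apply: DeriveDef; first exact: diff_derivable.
rewrite (@derive_comp _ _ _ _ l f)//; congr ('D_ _ f _).
have di : differentiable (id : R -> R) t by [].
have D1 : derivable (fun s : R => s *: h) t 1.
  by apply: diff_derivable; exact: differentiableZl.
rewrite (deriveD D1 (derivable_cst x t 1)) derive_cst addr0.
have dh : differentiable (fun=> h : V) t by exact: differentiable_cst.
by rewrite (derive_scale (k := id) 1 di dh) derive_id derive_cst scaler0 addr0 scale1r.
Qed.

Lemma mvt_direction V (f : V -> R) (x h : V) :
  (forall t : R, 0 <= t <= 1 -> differentiable f (t *: h + x)) ->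
  exists2 t : R, 0 < t < 1 & f (h + x) - f x = 'D_h f (t *: h + x).
Proof.
move=> df; have [||t t01] := @MVT R (fun s => f (s *: h + x)) (fun s => 'D_h f (s *: h + x)) 0 1 ltr01.
- move=> s /[!in_itv]/= /andP[s0 s1]; apply: is_derive_line; apply: df.
  by rewrite !ltW.
- apply: derivable_within_continuous => s /[!in_itv]/= s01.
  by have /is_derive_line[] := df s s01.
- by rewrite subr0 mulr1 scale0r add0r scale1r; exists t => //; rewrite in_itv in t01.
Qed.

(** Continuity of the differential in operator norm: the frame reduces uniformity in [h] to finitely
    many directional derivatives. *)
Lemma derive_near V W (f : V -> W) (U : set V) a e :
  finite_frame V -> open U -> smooth_on U f -> U a -> 0 < e ->
  \forall z \near a, forall h, `|'D_h f z - 'D_h f a| <= e * `|h|.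
Proof.
move=> [d [b [l [lc le]]]] oU sf Ua e0.
have [C C0 Cl] : exists2 C : R, 0 < C & forall i h, `|l i h| <= C * `|h|.
  have H i : exists2 C : R, 0 < C & forall h, `|l i h| <= C * `|h|.
    by have [k k0 kl] := linear_lipschitz (lc i); exists k.
  pose c i := sval (cid2 (H i)).
  exists (1 + \sum_i c i) => [|i h].
    by apply: ltr_wpDr => //; apply: sumr_ge0 => i _; rewrite /c; case: cid2 => /= x /ltW.
  have ci : forall j, 0 <= c j by move=> j; rewrite /c; case: cid2 => /= x /ltW.
  apply: (@le_trans _ _ (c i * `|h|)).
    by rewrite /c; case: cid2 => /= x _; apply.
  rewrite ler_wpM2r// (bigD1 i)//= addrCA lerDl addr_ge0//; exact: sumr_ge0.
(* The [d] coordinate terms, each at most [C * e' * |h|], must add up to at most [e * |h|]. *)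
pose e' := e / (1 + C *+ d).
have D0 : 0 < 1 + C *+ d by apply: ltr_wpDr => //; rewrite mulrn_wge0// ltW.
have e'0 : 0 < e' by rewrite divr_gt0.
have Dn : \forall z \near a, forall i, `|'D_(b i) f a - 'D_(b i) f z| <= e'.
  apply: filter_forall => i.
  have : {for a, continuous ('D_(b i) f)}.
    by apply: differentiable_continuous; exact: smooth_on_diff (smooth_on_derive _ sf) Ua.
  by move/cvgrPdist_le; apply.
near=> z => h.
have dz : differentiable f z.
  by apply: smooth_on_diff sf _; near: z; exact: open_nbhs_nbhs.
have da : differentiable f a by exact: smooth_on_diff sf _.
have -> : 'D_h f z - 'D_h f a = \sum_i l i h *: ('D_(b i) f z - 'D_(b i) f a).
  rewrite !deriveE// [in LHS](le h) !linear_sum -big_split/=; apply: eq_bigr => i _.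
  by rewrite !deriveE// [X in X + _]linearZ [X in _ - X]linearZ/= scalerBr.
apply: (le_trans (ler_norm_sum _ _ _)).
apply: (@le_trans _ _ (\sum_(i < d) (C * e' * `|h|))).
  apply: ler_sum => i _; rewrite normrZ mulrAC ler_pM//.
  by rewrite distrC; apply: (near Dn z).
rewrite sumr_const card_ord -mulrnAl ler_wpM2r//.
rewrite -mulrnAl /e' mulrCA ger_pMr// ler_pdivrMr// mul1r lerDr //.
Unshelve. all: by end_near. Qed.

(** The derivative may be taken at any point [z] of the ball. The inverse function theorem uses
    [z = a]; the equation with parameters uses the moving base point. *)
Definition strictly_differentiable V W (U : set V) (f : V -> W) (a : V) :=
  forall e, 0 < e -> exists2 r : R, 0 < r &
    ball a r `<=` U /\ forall x y z, ball a r x -> ball a r y -> ball a r z ->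
      `|f x - f y - 'D_(x - y) f z| <= e * `|x - y|.

Lemma ball_segment V (a : V) (r : R) x y (t : R) : 0 <= t <= 1 ->
  ball a r x -> ball a r y -> ball a r (t *: (x - y) + y).
Proof.
rewrite -ball_normE /ball_/= => /andP[t0 t1] ax ay.
have -> : a - (t *: (x - y) + y) = t *: (a - x) + (1 - t) *: (a - y).
  have -> : (1 - t) *: (a - y) = (a - y) - t *: (a - y) by rewrite scalerBl scale1r.
  rewrite addrCA -scalerBr [a - x - _](_ : _ = - (x - y)).
    by rewrite scalerN opprD addrA addrAC.
  by rewrite opprB addrC subrKA opprB.
apply: le_lt_trans (ler_normD _ _) _; rewrite !normrZ ger0_norm// ger0_norm ?subr_ge0//.
have [->|tn0] := eqVneq t 0; first by rewrite mul0r add0r subr0 mul1r.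
apply: (@lt_le_trans _ _ (t * r + (1 - t) * r)); last by rewrite -mulrDl addrCA subrr addr0 mul1r.
by apply: ltr_leD; [rewrite ltr_pM2l// lt_neqAle eq_sym tn0|rewrite ler_wpM2l ?subr_ge0// ltW].
Qed.

(** The mean value theorem produces a point of the segment; this point and [z] are each compared
    with [a], whence the two halves of [e]. *)
Lemma strict_differentiabilityR V (f : V -> R) (U : set V) a :
  finite_frame V -> open U -> smooth_on U f -> U a -> strictly_differentiable U f a.
Proof.
move=> fV oU sf Ua e e0.
have e20 : 0 < e / 2 by rewrite divr_gt0.
have /nbhs_ballP[r r0 H] : \forall z \near a, U z /\ forall h, `|'D_h f z - 'D_h f a| <= e / 2 * `|h|.
  by near=> z; split; near: z; [exact: open_nbhs_nbhs|exact: derive_near Ua e20].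
exists r => //; split=> [z /H[]//|x y z rx ry rz].
have rt t : 0 <= t <= 1 -> ball a r (t *: (x - y) + y) by move=> t01; exact: ball_segment.
have [|t /andP[t0 t1]] := @mvt_direction V f y (x - y).
  by move=> t /rt /H[Ut _]; exact: smooth_on_diff sf Ut.
rewrite subrK => ->; rewrite -(subrKA ('D_(x - y) f a)) [e]splitr mulrDl.
apply: (le_trans (ler_normD _ _)); apply: lerD; last rewrite distrC.
  by have [|_] := H (t *: (x - y) + y); [apply: rt; rewrite !ltW|exact].
by have [|_] := H z.
Unshelve. all: by end_near. Qed.

Lemma derive_coord V m n (f : V -> 'M[R]_(m, n)) x v i j : differentiable f x ->
  'D_v (fun y => f y i j) x = ('D_v f x) i j.
Proof. by move=> df; exact: (derive_linmx (@coord_mx R m n i j) v df). Qed.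

Lemma mx_norm_le m n (M : 'M[R]_(m, n)) c : 0 <= c ->
  (forall i j, `|M i j| <= c) -> `|M| <= c.
Proof.
by move=> c0 H; rewrite /Num.Def.normr/= mx_normrE (bigmax_le _ c0)//= => i _; exact: H.
Qed.

Lemma mx_norm_ge m n (M : 'M[R]_(m, n)) i j : `|M i j| <= `|M|.
Proof.
rewrite [leRHS]/Num.Def.normr/= mx_normrE.
exact: (le_bigmax _ (fun k : 'I_m * 'I_n => `|M k.1 k.2|) (i, j)).
Qed.

(** The mean value theorem is scalar: the estimate is made entry by entry, then the radii are shrunk
    to a common one. *)
Lemma strict_differentiability V m n (f : V -> 'M[R]_(m, n)) (U : set V) a :
  finite_frame V -> open U -> smooth_on U f -> U a -> strictly_differentiable U f a.
Proof.
move=> fV oU sf Ua e e0.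
have /(smooth_on_mxP _ oU) se := sf.
have H i j := @strict_differentiabilityR V (fun x => f x i j) U a fV oU (se i j) Ua e e0.
have : \forall r \near 0^'+, forall k : 'I_m * 'I_n, forall x y z, ball a r x -> ball a r y -> ball a r z ->
      `|f x k.1 k.2 - f y k.1 k.2 - 'D_(x - y) (fun x => f x k.1 k.2) z| <= e * `|x - y|.
  apply: filter_forall => k; have [r r0 [_ Hr]] := H k.1 k.2.
  near=> s => x y z sx sy sz; have sr : s <= r by near: s; exact: nbhs_right_le.
  by apply: Hr; exact: le_ball sr _ _.
move=> Hn; have /nbhs_ballP[r1 r10 r1U] : nbhs a U by exact: open_nbhs_nbhs.
near (0 : R)^'+ => r; exists r => //.
have rU : ball a r `<=` U.
  by apply: subset_trans r1U; apply: le_ball; near: r; exact: nbhs_right_le.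
split=> // x y z rx ry rz; apply: mx_norm_le => [|i j]; first by rewrite mulr_ge0// ltW.
rewrite !mxE -derive_coord; last by apply: smooth_on_diff sf _; exact: rU.
by apply: (near Hn r _ (i, j)).
Unshelve. all: by end_near. Qed.

Lemma sub_cross (a b c d : R) : a - b - (c - d) = a - c - (b - d).
Proof. by ring. Qed.

Lemma sub_increments (a b p q r : R) :
  a - b - r = (a - p - (q + r)) - (b - p - q).
Proof. by ring. Qed.

(** The second difference at scale [s] is [s^2 D_v D_u f + o(s^2)]: the mean value theorem in the
    direction [u], then the first-order expansion of ['D_u f] at [x]. Since the difference is
    symmetric in [u] and [v], mixed derivatives commute. *)
Lemma second_difference V (f : V -> R) (U : set V) x u v e :
  open U -> smooth_on U f -> U x -> 0 < e ->
  \forall s \near 0^'+,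
   `|f (s *: u + (s *: v + x)) - f (s *: v + x) - (f (s *: u + x) - f x)
     - s * (s * 'D_v ('D_u f) x)| <= s * (e * s).
Proof.
move=> oU sf Ux e0.
have dp : differentiable ('D_u f) x by exact: smooth_on_diff (smooth_on_derive _ sf) Ux.
(* Large enough to absorb the norms of the two increments [t *: u + s *: v] and [t *: u]
   together. *)
pose c := 1 + 2 * (`|u| + `|v|).
have c0 : 0 < c by rewrite ltr_wpDr// mulr_ge0// addr_ge0.
have ec0 : 0 < e / c by rewrite divr_gt0.
have /nbhs_ballP[r r0 rH] := differentiable_epsP dp ec0.
have /nbhs_ballP[r' r'0 rU] : nbhs x U by exact: open_nbhs_nbhs.
near=> s.
have s0 : 0 < s by [].
have sr : s * c < r.
  by rewrite -ltr_pdivlMr//; near: s; apply: nbhs_right_lt; rewrite divr_gt0.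
have sr' : s * c < r'.
  by rewrite -ltr_pdivlMr//; near: s; apply: nbhs_right_lt; rewrite divr_gt0.
have bnd t t' : 0 <= t <= s -> 0 <= t' <= s -> `|t *: u + t' *: v| < s * c.
  move=> /andP[t0 ts] /andP[t'0 t's]; apply: le_lt_trans (ler_normD _ _) _.
  rewrite !normrZ !ger0_norm//.
  apply: (@le_lt_trans _ _ (s * `|u| + s * `|v|)); first by rewrite lerD// ler_wpM2r.
  rewrite -mulrDr ltr_pM2l// /c.
  have : 0 <= `|u| + `|v| by rewrite addr_ge0.
  lra.
have inU t t' : 0 <= t <= s -> 0 <= t' <= s -> U (t *: u + (t' *: v + x)).
  move=> ht ht'; apply: rU; rewrite -ball_normE /ball_/= addrA opprD addrCA subrr addr0 normrN.
  exact: lt_trans (bnd _ _ ht ht') sr'.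
have s0s : 0 <= s <= s by rewrite lexx ltW.
have z0s : (0 : R) <= 0 <= s by rewrite lexx ltW.
pose g t := f (t *: u + (s *: v + x)) - f (t *: u + x).
have dg t : 0 <= t <= s -> is_derive t 1 g ('D_u f (t *: u + (s *: v + x)) - 'D_u f (t *: u + x)).
  move=> ht; apply: is_deriveB; apply: is_derive_line; apply: smooth_on_diff sf _.
    exact: inU.
  by have := inU t 0 ht z0s; rewrite scale0r add0r.
have [||t t0s] := @MVT R g (fun t => 'D_u f (t *: u + (s *: v + x)) - 'D_u f (t *: u + x)) 0 s s0.
- by move=> t /[!in_itv]/= /andP[t0 t1]; apply: dg; rewrite !ltW.
- apply: derivable_within_continuous => t /[!in_itv]/= ht.
  by have [] := dg t ht.
rewrite /g !scale0r !add0r subr0 => Hg.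
have -> : f (s *: u + (s *: v + x)) - f (s *: v + x) - (f (s *: u + x) - f x) =
   s * ('D_u f (t *: u + (s *: v + x)) - 'D_u f (t *: u + x)).
  by rewrite mulrC -Hg sub_cross.
rewrite -mulrBr normrM (ger0_norm (ltW s0)) ler_wpM2l ?(ltW s0)//.
have ht : 0 <= t <= s by move: t0s; rewrite in_itv/= => /andP[? ?]; rewrite !ltW.
have inr t' : 0 <= t' <= s -> ball 0 r (t *: u + t' *: v).
  by move=> ht'; rewrite -ball_normE /ball_/= sub0r normrN; exact: lt_trans (bnd _ _ ht ht') sr.
have H1 := rH _ (inr s s0s); have H2 := rH _ (inr 0 z0s).
rewrite /= scale0r addr0 in H1 H2.
have -> : 'D_u f (t *: u + (s *: v + x)) - 'D_u f (t *: u + x) - s * 'D_v ('D_u f) x =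
  ('D_u f (t *: u + s *: v + x) - 'D_u f x - 'd ('D_u f) x (t *: u + s *: v)) -
  ('D_u f (t *: u + x) - 'D_u f x - 'd ('D_u f) x (t *: u)).
  have dsv : 'd ('D_u f) x (s *: v) = s * 'd ('D_u f) x v by rewrite linearZ.
  rewrite (deriveE v dp) [in RHS]linearD/= dsv [in LHS]addrA; exact: sub_increments.
apply: (le_trans (ler_normB _ _)); apply: (le_trans (lerD H1 H2)).
rewrite -mulrDr -mulrA ler_wpM2l ?(ltW e0)// mulrC ler_pdivrMr// .
have N1 : `|t *: u + s *: v| <= s * (`|u| + `|v|).
  apply: le_trans (ler_normD _ _) _; move/andP: ht => [t0 ts].
  by rewrite !normrZ (ger0_norm t0) (ger0_norm (ltW s0)) mulrDr lerD// ler_wpM2r.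
have N2 : `|t *: u| <= s * `|u|.
  by move/andP: ht => [t0 ts]; rewrite normrZ ger0_norm// ler_wpM2r.
apply: (le_trans (lerD N1 N2)); rewrite -mulrDr ler_wpM2l ?(ltW s0)// /c.
by have := normr_ge0 v; lra.
Unshelve. all: by end_near. Qed.

Lemma cross_difference (a b c d p q k : R) :
  `|a - b - (c - d) - p| <= k -> `|a - c - (b - d) - q| <= k ->
  `|p - q| <= k + k.
Proof.
move=> H1 H2; have -> : p - q = (a - c - (b - d) - q) - (a - b - (c - d) - p) by ring.
exact: le_trans (ler_normB _ _) (lerD H2 H1).
Qed.

Lemma schwarzR V (f : V -> R) (U : set V) x u v :
  open U -> smooth_on U f -> U x -> 'D_v ('D_u f) x = 'D_u ('D_v f) x.
Proof.
move=> oU sf Ux; apply/eqP; rewrite -subr_eq0 -normr_le0.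
apply/ler_addgt0Pl => e e0; rewrite addr0.
have e20 : 0 < e / 2 by rewrite divr_gt0.
have N1 := second_difference u v oU sf Ux e20.
have N2 := second_difference v u oU sf Ux e20.
near (0 : R)^'+ => s; have s0 : 0 < s by [].
have H1 : `|f (s *: u + (s *: v + x)) - f (s *: v + x) - (f (s *: u + x) - f x)
     - s * (s * 'D_v ('D_u f) x)| <= s * (e / 2 * s) by apply: (near N1 s).
have H2 : `|f (s *: v + (s *: u + x)) - f (s *: u + x) - (f (s *: v + x) - f x)
     - s * (s * 'D_u ('D_v f) x)| <= s * (e / 2 * s) by apply: (near N2 s).
rewrite addrCA in H2.
have : `|s * (s * 'D_v ('D_u f) x) - s * (s * 'D_u ('D_v f) x)| <= s * (e * s).
  have -> : s * (e * s) = s * (e / 2 * s) + s * (e / 2 * s).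
    by rewrite -mulrDr -mulrDl -splitr.
  exact: cross_difference H1 H2.
rewrite -mulrBr -mulrBr !normrM (ger0_norm (ltW s0)) ler_pM2l// mulrC.
by rewrite ler_pM2r.
Unshelve. all: by end_near. Qed.

Lemma schwarz V m n (f : V -> 'M[R]_(m, n)) (U : set V) x u v :
  open U -> smooth_on U f -> U x -> 'D_v ('D_u f) x = 'D_u ('D_v f) x.
Proof.
move=> oU sf Ux; apply/matrixP => i j.
have H w z : ('D_w ('D_z f) x) i j = 'D_w ('D_z (fun y => f y i j)) x.
  rewrite -derive_coord; last exact: smooth_on_diff (smooth_on_derive _ sf) Ux.
  apply: near_eq_derive; near=> y.
  rewrite derive_coord//; apply: smooth_on_diff sf _.
  by near: y; exact: open_nbhs_nbhs.
have sfij : smooth_on U (fun y => f y i j) by move/(smooth_on_mxP _ oU): sf; exact.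
have Huv := schwarzR u v oU sfij Ux.
apply: (etrans (H v u)).
apply: (etrans Huv).
exact: (esym (H u v)).
Unshelve. all: by end_near. Qed.

End StrictDifferentiability.

(** * The inverse function theorem by Newton's iteration *)

Section InverseFunction.
Context {R : realType} {N : nat}.
Local Notation E := 'cV[R]_N.

Definition jac (f : E -> E) (x : E) : 'M[R]_N :=
  \matrix_(i, j) ('D_(delta_mx j 0) f x) i 0.

Lemma mul_jac (f : E -> E) x h : differentiable f x -> jac f x *m h = 'D_h f x.
Proof.
move=> df; rewrite deriveE// [in RHS](matrix_sum_delta h) linear_sum.
apply/matrixP => i j; rewrite !mxE ord1 summxE; apply: eq_bigr => k _.
by rewrite big_ord1 linearZ/= !mxE -deriveE// mulrC.
Qed.

Lemma smooth_on_jac (U : set E) (f : E -> E) : open U -> smooth_on U f ->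
  smooth_on U (jac f).
Proof.
move=> oU sf; apply/(smooth_on_mxP _ oU) => i j.
have /(smooth_on_mxP _ oU) s := smooth_on_derive (delta_mx j 0) sf.
by apply: (smooth_on_ext oU _ (s i 0)) => x _; rewrite mxE.
Qed.

Lemma inj_unitmx (J : 'M[R]_N) : (forall h : E, J *m h = 0 -> h = 0) -> J \in unitmx.
Proof.
move=> Jinj; rewrite -unitmx_tr -row_free_unit -kermx_eq0.
apply/eqP/row_matrixP => i; rewrite row0; apply: trmx_inj; rewrite trmx0.
apply: Jinj; set u := row i _.
have -> : J *m u^T = (u *m J^T)^T by rewrite trmx_mul trmxK.
have /sub_kermxP -> : (u <= kermx J^T)%MS by exact: row_sub.
by rewrite trmx0.
Qed.

Lemma mulmx_bound (J : 'M[R]_N) : exists2 C : R, 0 < C & forall h : E, `|J *m h| <= C * `|h|.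
Proof.
by have [k k0 H] := linear_lipschitz (@linear_mx_continuous R E N 1 (mulmx J)); exists k.
Qed.

(** With [J] the inverse Jacobian at [a], strict differentiability makes [x - J (f x)] a contraction
    of ratio one half; closeness of the differentials to the one at [a] keeps every Jacobian of the
    ball injective. *)
Lemma newton_contraction (U : set E) (f : E -> E) a :
  open U -> smooth_on U f -> U a -> (forall h, 'D_h f a = 0 -> h = 0) ->
  exists (J : 'M[R]_N) (r : R), [/\ J \in unitmx, 0 < r, ball a r `<=` U,
    (forall x y, ball a r x -> ball a r y ->
      `|x - y - J *m (f x - f y)| <= 2^-1 * `|x - y|) &
    (forall z, ball a r z -> jac f z \in unitmx)].
Proof.
move=> oU sf Ua Dinj; have dfa := smooth_on_diff sf Ua.
have Ju : jac f a \in unitmx by apply: inj_unitmx => h; rewrite mul_jac//; exact: Dinj.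
have [C C0 HC] := mulmx_bound (invmx (jac f a)).
(* As [C] bounds the inverse Jacobian, this tolerance becomes the ratio [2^-1] after multiplication
   by it. *)
have e0 : 0 < (2 * C)^-1 by rewrite invr_gt0 mulr_gt0.
have [r0 r00 [r0U Hr0]] := strict_differentiability (finite_frame_mx N 1) oU sf Ua e0.
have /nbhs_ballP[r1 /= r10 Hr1] := derive_near (finite_frame_mx N 1) oU sf Ua e0.
pose r := Num.min r0 r1.
have r_gt0 : 0 < r by rewrite lt_min r00.
have rr0 : ball a r `<=` ball a r0 by apply: le_ball; rewrite ge_min lexx.
have rr1 : ball a r `<=` ball a r1 by apply: le_ball; rewrite ge_min lexx orbT.
have CE t : C * ((2 * C)^-1 * t) = 2^-1 * t.
  by rewrite invfM mulrA [_^-1 * _^-1]mulrC mulrA mulfV ?gt_eqF// mul1r.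
exists (invmx (jac f a)), r; split.
- by rewrite unitmx_inv.
- exact: r_gt0.
- exact: subset_trans r0U.
- move=> x y /rr0 rx /rr0 ry; have -> : x - y - invmx (jac f a) *m (f x - f y) =
     - (invmx (jac f a) *m (f x - f y - 'D_(x - y) f a)).
    by rewrite -(mul_jac _ dfa) [in RHS]mulmxBr mulKmx// opprB.
  rewrite normrN; apply: (le_trans (HC _)); rewrite -CE ler_pM2l//.
  by apply: Hr0 => //; exact: ballxx.
- move=> z rz; have dfz := smooth_on_diff sf (r0U _ (rr0 _ rz)).
apply: inj_unitmx => h; rewrite mul_jac// => Dh.
have kb := Hr1 z (rr1 _ rz) h; rewrite Dh sub0r normrN in kb.
have : `|h| <= 2^-1 * `|h|.
  rewrite -CE; apply: (@le_trans _ _ (C * `|'D_h f a|)); last by rewrite ler_pM2l.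
  by rewrite -[X in `|X|](mulKmx Ju) (mul_jac h dfa).
have := normr_ge0 h; move=> h0 h1; apply/eqP; rewrite -normr_le0.
by lra.
Qed.

(** The contraction estimate makes [f] injective with Lipschitz inverse, and its fixed points make
    images open. Openness is stated for all open subsets of [O], since images of smaller chart
    pieces must be open later. *)
Theorem inverse_function (U : set E) (f : E -> E) a :
  open U -> smooth_on U f -> U a -> (forall h, 'D_h f a = 0 -> h = 0) ->
  exists (O : set E) (g : E -> E), [/\ open O, O a, O `<=` U,
    (forall V, open V -> V `<=` O -> open (f @` V)) &
    smooth_on (f @` O) g /\ (forall x, O x -> g (f x) = x)].
Proof.
move=> oU sf Ua Dinj.
have [J [r [Ju r0 rU Hc Hu]]] := newton_contraction oU sf Ua Dinj.
have [C C0 HC] := mulmx_bound J.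
pose O := ball a r; have oO : open O by exact: ball_open.
have Lip x y : O x -> O y -> `|x - y| <= 2 * C * `|f x - f y|.
  move=> Ox Oy; have H1 := Hc x y Ox Oy; have H2 := HC (f x - f y).
  have H3 := ler_normD (x - y - J *m (f x - f y)) (J *m (f x - f y)).
  rewrite subrK in H3; rewrite -mulrA; lra.
have finj x y : O x -> O y -> f x = f y -> x = y.
  move=> Ox Oy fxy; have := Lip x y Ox Oy.
  by rewrite fxy subrr normr0 mulr0 normr_le0 subr_eq0 => /eqP.
have fopen V : open V -> V `<=` O -> open (f @` V).
  move=> oV VO; rewrite openE => _ [x0 Vx0 <-]; rewrite /interior.
  have /nbhs_ballP[s' /= s'0 sV'] : nbhs x0 V by exact: open_nbhs_nbhs.
  pose s := s' / 2; have s0 : 0 < s by rewrite divr_gt0.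
  pose K := [set x : E | `|x0 - x| <= s].
  have KV : K `<=` V.
    move=> x /= Kx; apply: sV'; rewrite -ball_normE /ball_/=.
    by apply: le_lt_trans Kx _; rewrite /s ltr_pdivrMr// ltr_pMr// ltr1n.
  have cK : closed K.
    rewrite (_ : K = (fun x => `|x0 - x|) @^-1` [set t | t <= s]) //.
    apply: closed_comp; last exact: closed_le.
    move=> x _; apply: continuous_comp; last exact: norm_continuous.
    by apply: continuousB; [exact: cst_continuous|exact: cvg_id].
  (* With [|J h| <= C |h|], this radius gives [|x0 - phi x0| <= s / 2], so the contraction maps the
     closed ball [K] into itself. *)
  apply/nbhs_ballP; exists (s / (2 * C)); first by rewrite /= divr_gt0// mulr_gt0.
  move=> y; rewrite -ball_normE /ball_/= => fy.
  (* Newton's map with frozen inverse Jacobian; its fixed points solve [f x = y]. *)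
  pose phi x := x - J *m (f x - y).
  have phiL x x' : K x -> K x' -> `|phi x - phi x'| <= 2^-1 * `|x - x'|.
    move=> /KV /VO Ox /KV /VO Ox'.
    have -> : phi x - phi x' = x - x' - J *m (f x - f x').
      have -> : f x - f x' = (f x - y) - (f x' - y) by rewrite opprB addrA subrK.
      rewrite /phi [in RHS]mulmxBr; set p := J *m (f x - y); set q := J *m _.
      by rewrite !opprB addrACA [RHS]addrACA [- p - x']addrC.
    exact: Hc.
  have Kx0 : K x0 by rewrite /K/= subrr normr0 ltW.
  have phiK : set_fun K K phi.
    move=> x Kx; have H1 := phiL x0 x Kx0 Kx.
    have H2 : `|x0 - phi x0| <= 2^-1 * s.
      rewrite /phi opprB addrCA subrr addr0; apply: (le_trans (HC _)).
      by move: fy; rewrite ltr_pdivlMr ?mulr_gt0// => /ltW; rewrite mulrA mulrC; lra.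
    rewrite /K/=; have H3 := ler_normD (x0 - phi x0) (phi x0 - phi x).
    rewrite addrA subrK in H3; move: Kx; rewrite /K/= => Kx; lra.
  pose phif : {fun K >-> K} := HB.pack phi (isFun.Build _ _ K K phi phiK).
  have [||x Kx xE] := @banach_fixed_point R E K phif _ cK; last first.
  - exists x; first exact: KV.
    apply/eqP; rewrite -subr_eq0; apply/eqP.
    have : J *m (f x - y) = 0.
      have /eqP := xE; rewrite /phif/= /phi eq_sym -subr_eq0 addrAC subrr add0r oppr_eq0.
      by move/eqP.
    by move/(congr1 (mulmx (invmx J))); rewrite mulKmx// mulmx0.
  - by exists x0.
  - exists (2^-1)%:nng; split => /=; first by rewrite invf_lt1// ltr1n.
    by move=> -[x x'] [/= Kx Kx']; exact: phiL.
pose g y := xget 0 [set x | O x /\ f x = y].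
have gK x : O x -> g (f x) = x.
  move=> Ox; rewrite /g; case: xgetP => [x' -> [Ox' fx']|/(_ x)]; first exact: finj.
  by move=> /(_ (conj Ox erefl)).
have Og y : (f @` O) y -> O (g y) /\ f (g y) = y by move=> [x Ox <-]; rewrite gK.
have oD : open (f @` O) by exact: fopen.
exists O, g; split=> //; first exact: ballxx.
split=> //.
have gdiff y : (f @` O) y -> differentiable g y /\
    forall w, 'D_w g y = invmx (jac f (g y)) *m w.
  move=> Dy; have [Ogy fgy] := Og y Dy.
  set x := g y in Ogy fgy *.
  have dfx : differentiable f x := smooth_on_diff sf (rU _ Ogy).
  have [B B0 HB] := mulmx_bound (invmx (jac f x)).
  have Jc : continuous (mulmx (invmx (jac f x)) : E -> E) by exact: linear_mx_continuous.
  have [|dg dgE] := differentiable_eps (f := g) (a := y) Jc; last first.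
  - by split=> // w; rewrite deriveE// dgE.
  - move=> e e0.
    (* Here [2 * C] is the Lipschitz constant of the inverse, and [B] bounds the inverse Jacobian at
       [x]. *)
    have e'0 : 0 < e / (2 * C * B) by rewrite divr_gt0// !mulr_gt0.
    have /nbhs_ballP[d /= d0 Hd] := differentiable_epsP dfx e'0.
    have /nbhs_ballP[d' /= d'0 Hd'] : nbhs y (f @` O) by exact: open_nbhs_nbhs.
    have Nd' := @nbhs0_lt _ E _ d'0.
    have Nd : \forall k \near (0 : E), `|k| < d / (2 * C).
      by apply: nbhs0_lt; rewrite divr_gt0 ?mulr_gt0.
    near=> k.
    have Dk : (f @` O) (k + y).
      apply: Hd'; rewrite -ball_normE /ball_/= opprD addrCA subrr addr0 normrN.
      exact: (near Nd' k).
    have [Ok fk] := Og _ Dk.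
    set x' := g (k + y) in Ok fk *.
    have kE : k = f x' - f x by rewrite fk fgy addrK.
    have Lk : `|x' - x| <= 2 * C * `|k| by rewrite kE; exact: Lip.
    have := Hd (x' - x) _; rewrite subrK -kE => Hk.
    have -> : x' - x - invmx (jac f x) *m k =
        - (invmx (jac f x) *m (k - 'd f x (x' - x))).
      by rewrite -deriveE// -(mul_jac _ dfx) [in RHS]mulmxBr mulKmx ?Hu// opprB.
    rewrite normrN; apply: (le_trans (HB _)).
    apply: (@le_trans _ _ (B * (e / (2 * C * B) * (2 * C * `|k|)))).
      rewrite ler_pM2l//; apply: (le_trans (Hk _)); last by rewrite ler_pM2l.
      rewrite -ball_normE /ball_/= sub0r normrN; apply: (le_lt_trans Lk).
      rewrite mulrC -ltr_pdivlMr ?mulr_gt0//.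
      exact: (near Nd k).
    have B00 : B != 0 by rewrite gt_eqF. have C00 : C != 0 by rewrite gt_eqF.
    by rewrite le_eqVlt; apply/orP; left; apply/eqP; field; rewrite C00 B00.
(* The derivative of [g] is the inverse Jacobian composed with [g], hence as smooth as [g] itself:
   each round gains one order. *)
apply/smooth_uptoP; elim=> [|k IH].
  by apply/smooth_upto0 => y /gdiff[].
apply/smooth_uptoS; split=> [y /gdiff[]//|w].
have sJ : smooth_on O (fun x => invmx (jac f x)).
  apply: smooth_on_invmx => //; apply: smooth_on_jac => //.
  exact: smooth_on_sub sf.
have sJk : smooth_upto k O (fun x => mulmxr w (invmx (jac f x))).
  by move/smooth_uptoP: (smooth_on_linmx (mulmxr w) oO sJ); exact.
apply: (smooth_upto_ext oD _ (smooth_upto_comp (finite_frame_mx N 1) oD _ IH sJk)).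
  by move=> y /gdiff[_ ->].
by move=> y /Og[].
Unshelve. all: by end_near.
Qed.

End InverseFunction.

(** * Linear differential equations with parameters *)

Section LinearODE.
Context {R : realType}.

(** Integration starts at [-1] so that the derivative at the initial time [0] is two-sided; the
    primitive is then renormalised to vanish at [0]. *)
Lemma antiderivative (f : R -> R) : continuous f ->
  exists F : R -> R, F 0 = 0 /\ forall t : R, -1 < t -> is_derive t 1 F (f t).
Proof.
move=> fc.
pose G x := (\int[@lebesgue_measure R]_(t in `[(-1 : R), x]) f t)%R.
exists (fun x => G x - G 0); split=> [|t t1]; first by rewrite subrr.
have [||dG GE] := @continuous_FTC1_closed R f (-1) t (t + 1) _ _ t1 (fc t).
- by rewrite ltrDl.
- apply: continuous_compact_integrable; first exact: segment_compact.
  by apply: continuous_subspaceT => x; exact: fc.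
rewrite -[f t]subr0; apply: is_deriveB.
by apply: DeriveDef; [exact: dG|rewrite -derive1E; exact: GE].
Qed.

Lemma is_derive_mx p q (F : R -> 'M[R]_(p, q)) (t : R) (D : 'M[R]_(p, q)) :
  (forall i j, is_derive t 1 (fun s => F s i j) (D i j)) -> is_derive t 1 F D.
Proof.
move=> H; have dF : derivable F t 1 by apply/derivable_mxP => i j; have [] := H i j.
apply: DeriveDef => //; rewrite derive_mx//; apply/matrixP => i j.
by rewrite mxE; have [] := H i j.
Qed.

Lemma is_derive_entry p q (F : R -> 'M[R]_(p, q)) (t : R) (D : 'M[R]_(p, q)) i j :
  is_derive t 1 F D -> is_derive t 1 (fun s => F s i j) (D i j).
Proof.
move=> [dF <-]; rewrite -derive_coord; last exact/derivable1_diffP.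
by apply: derivableP; move/derivable_mxP: dF; apply.
Qed.

Lemma antiderivative_mx p q (f : R -> 'M[R]_(p, q)) : continuous f ->
  exists F : R -> 'M[R]_(p, q), F 0 = 0 /\ forall t : R, -1 < t -> is_derive t 1 F (f t).
Proof.
move=> fc.
have H i j : exists F : R -> R, F 0 = 0 /\ forall t : R, -1 < t -> is_derive t 1 F (f t i j).
  apply: antiderivative => t.
  by apply: (@continuous_comp _ _ _ f (fun M : 'M[R]_(p, q) => M i j)); [exact: fc|exact: coord_continuous].
pose F i j := sval (cid (H i j)).
have FP i j : F i j 0 = 0 /\ forall t : R, -1 < t -> is_derive t 1 (F i j) (f t i j).
  exact: svalP (cid (H i j)).
exists (fun t => \matrix_(i, j) F i j t); split=> [|t t1].
  by apply/matrixP => i j; rewrite !mxE (FP i j).1.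
apply: is_derive_mx => i j; have := (FP i j).2 t t1.
suff -> : (fun s => (\matrix_(k, l) F k l s) i j) = F i j by [].
by apply/funext => s; rewrite mxE.
Qed.

Lemma ge0_of_derive (H h : R -> R) (T : R) : 0 <= T -> 0 <= H 0 ->
  (forall t : R, 0 <= t <= T -> is_derive t 1 H (h t)) ->
  (forall t : R, 0 <= t <= T -> 0 <= h t) -> 0 <= H T.
Proof.
rewrite le_eqVlt => /predU1P[<-//|T0] H0 dH h0.
have [||t t0T HE] := @MVT R H h 0 T T0.
- by move=> t /[!in_itv]/= /andP[t0 tT]; apply: dH; rewrite !ltW.
- by apply: derivable_within_continuous => t /[!in_itv]/= ht; have [] := dH t ht.
move: t0T; rewrite in_itv/= => /andP[t0 tT].
have h1 : 0 <= h t by apply: h0; rewrite !ltW.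
by have := mulr_ge0 h1 (ltW T0); rewrite subr0 in HE; rewrite -HE; lra.
Qed.

(** For each entry, [G + F i j] and [G - F i j] have nonnegative derivative and start
    nonnegative. *)
Lemma mx_bound_of_derive p q (F f : R -> 'M[R]_(p, q)) (G g : R -> R) (T : R) :
  0 <= T -> F 0 = 0 -> 0 <= G 0 ->
  (forall t : R, 0 <= t <= T -> is_derive t 1 F (f t)) ->
  (forall t : R, 0 <= t <= T -> is_derive t 1 G (g t)) ->
  (forall t : R, 0 <= t <= T -> `|f t| <= g t) -> `|F T| <= G T.
Proof.
move=> T0 F0 G0 dF dG fg; apply: mx_norm_le => [|i j].
  by apply: (ge0_of_derive T0 G0 dG) => t /fg; exact: le_trans.
have fgij t : 0 <= t <= T -> `|f t i j| <= g t.
  by move=> /fg; apply: le_trans; exact: mx_norm_ge.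
have Fij t : 0 <= t <= T -> is_derive t 1 (fun s => F s i j) (f t i j).
  by move=> /dF; exact: is_derive_entry.
have F0ij : F 0 i j = 0 by rewrite F0 mxE.
rewrite ler_norml; apply/andP; split; rewrite -subr_ge0.
- rewrite opprK addrC.
  apply: (@ge0_of_derive (fun t => G t + F t i j) (fun t => g t + f t i j)) => // [|t ht|t /fgij].
  + by rewrite F0ij addr0.
  + by have d1 := dG t ht; have d2 := Fij t ht; exact: is_deriveD.
  + by rewrite ler_norml => /andP[+ _]; lra.
- apply: (@ge0_of_derive (fun t => G t - F t i j) (fun t => g t - f t i j)) => // [|t ht|t /fgij].
  + by rewrite F0ij subr0.
  + by have d1 := dG t ht; have d2 := Fij t ht; exact: is_deriveB.
  + by rewrite ler_norml => /andP[_ +]; lra.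
Qed.

Lemma mulmx_norm p q r (A : 'M[R]_(p, q)) (B : 'M[R]_(q, r)) :
  `|A *m B| <= q%:R * `|A| * `|B|.
Proof.
apply: mx_norm_le => [|i j]; first by rewrite !mulr_ge0.
rewrite mxE; apply: (le_trans (ler_norm_sum _ _ _)).
apply: (@le_trans _ _ (\sum_(k < q) `|A| * `|B|)).
  by apply: ler_sum => k _; rewrite normrM ler_pM//; exact: mx_norm_ge.
by rewrite sumr_const card_ord -mulrA mulr_natl.
Qed.

(** The interval reaches [2] so that time [1], where solutions are evaluated, is interior and they
    can be differentiated there. *)
Definition linear_solution N (a : R -> 'M[R]_N) (S : R -> 'M[R]_N) :=
  S 0 = 1%:M /\ forall t : R, 0 <= t <= 2 -> is_derive t 1 S (S t *m a t).

(** The retraction of the line onto [[0, 2]]; composing with it turns a coefficient that is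
    continuous on the interval into a globally continuous one. *)
Definition clamp (t : R) : R := (`|t| - `|t - 2| + 2) / 2.

Lemma clamp_id t : 0 <= t <= 2 -> clamp t = t.
Proof.
move=> /andP[t0 t2]; rewrite /clamp ger0_norm// ler0_norm; last lra.
by field.
Qed.

Lemma clamp_range t : 0 <= clamp t <= 2.
Proof.
rewrite /clamp; have := ler_normB t (t - 2); rewrite opprB addrCA subrr addr0.
rewrite (ger0_norm (_ : 0 <= 2))// => H1.
have := ler_normD t (2 - t); rewrite addrCA subrr addr0 (ger0_norm (_ : 0 <= 2))// [`|2 - t|]distrC => H2.
have := ler_normD (t - 2) 2; rewrite subrK (ger0_norm (_ : 0 <= 2))// => H3.
have := ler_normB t 2; rewrite (ger0_norm (_ : 0 <= 2))// => H4.
apply/andP; split; lra.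
Qed.

Lemma clamp_continuous : continuous clamp.
Proof.
move=> t; rewrite /continuous_at /clamp; apply: cvgM; last exact: cvg_cst.
apply: cvgD; last exact: cvg_cst.
apply: cvgB; apply: cvg_norm; first exact: cvg_id.
by apply: cvgB; [exact: cvg_id|exact: cvg_cst].
Qed.

Lemma continuous_bound p q (f : R -> 'M[R]_(p, q)) (T : R) : 0 <= T ->
  (forall t : R, 0 <= t <= T -> {for t, continuous f}) ->
  exists2 C : R, 0 < C & forall t, 0 <= t <= T -> `|f t| <= C.
Proof.
move=> T0 fc.
have [|c c01 cmax] := @EVT_max R (fun t => `|f t|) 0 T T0.
  apply: continuous_in_subspaceT => t; rewrite inE/= in_itv/= => ht.
  by apply: continuous_comp; [exact: fc|exact: norm_continuous].
exists (1 + `|f c|) => [|t ht]; first by rewrite ltr_wpDr.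
by have := cmax t; rewrite in_itv/= => /(_ ht); lra.
Qed.

Lemma is_derive_expRM (K c t : R) :
  is_derive t 1 (fun s => c * expR (K * s)) (c * K * expR (K * t)).
Proof.
have d1 : is_derive t 1 (fun s : R => K * s) K.
  have d0 : is_derive t 1 (id : R -> R) 1 by exact: is_derive_id.
  by have := is_deriveZ K d0; rewrite /GRing.scale/= mulr1.
have d2 : is_derive t 1 (fun s => expR (K * s)) (K * expR (K * t)).
  by rewrite mulrC; exact: (@is_derive1_comp R expR (fun s : R => K * s) t (expR (K * t)) K (is_derive_expR _) d1).
by have := is_deriveZ c d2; rewrite /GRing.scale/= mulrA.
Qed.

Lemma le0_geometric (x c : R) : (forall n, x <= c * 2^-1 ^+ n) -> x <= 0.
Proof.
move=> H; have z1 : `|2^-1 : R| < 1 by rewrite ger0_norm// invf_lt1// ltr1n.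
have gc := @cvg_geometric R c _ z1.
rewrite -(cvg_lim (@Rhausdorff R) gc); apply: limr_ge; first by apply/cvg_ex; exists 0.
by apply: nearW => n; exact: H.
Qed.

Lemma cvg_of_geometric p q (u : nat -> 'M[R]_(p, q)) (B : R) : 0 <= B ->
  (forall n, `|u n.+1 - u n| <= B * 2^-1 ^+ n) ->
  exists l, forall n, `|l - u n| <= 2 * B * 2^-1 ^+ n.
Proof.
move=> B0 ub; have z1 : `|2^-1 : R| < 1 by rewrite ger0_norm// invf_lt1// ltr1n.
have uc : cvgn u.
  have sc : cvgn (series (telescope u)).
    apply: normed_cvg; apply: (@series_le_cvg _ _ (geometric B 2^-1)) => [n|n|n|].
    - exact: normr_ge0.
    - by apply: mulr_ge0 => //; rewrite exprn_ge0.
    - exact: ub.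
    - exact: is_cvg_geometric_series.
  have -> : u = (fun n => u 0%N + series (telescope u) n).
    by apply/funext => n; exact: eq_sum_telescope.
  by apply: is_cvgD => //; exact: is_cvg_cst.
have tail n k : `|u (k + n)%N - u n| <= 2 * B * (2^-1 ^+ n - 2^-1 ^+ (k + n)).
  elim: k => [|k IH]; first by rewrite add0n !subrr mulr0 normr0.
  rewrite -(subrKA (u (k + n)%N)); apply: (le_trans (ler_normD _ _)).
  apply: (le_trans (lerD (ub _) IH)); rewrite addSn exprS.
  by set x := _ ^+ (k + n); set y := _ ^+ n; lra.
exists (limn u) => n.
have cl : closed [set x : 'M[R]_(p, q) | `|x - u n| <= 2 * B * 2^-1 ^+ n].
  rewrite (_ : [set _ | _] = (fun x : 'M[R]_(p, q) => `|x - u n|) @^-1` [set t | t <= 2 * B * 2^-1 ^+ n]) //.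
  apply: closed_comp; last exact: closed_le.
  move=> x _; apply: (@continuous_comp _ _ _ (fun x : 'M[R]_(p, q) => x - u n)); last exact: norm_continuous.
  by apply: continuousB; [exact: cvg_id|exact: cst_continuous].
suff uA : \forall m \near \oo, [set x : 'M[R]_(p, q) | `|x - u n| <= 2 * B * 2^-1 ^+ n] (u m).
  exact: (closed_cvg _ cl uA _ uc).
exists n => //= m /= nm; have := tail n (m - n)%N.
rewrite subnK//= => H; apply: (le_trans H); rewrite ler_wpM2l ?mulr_ge0//.
by rewrite gerBl exprn_ge0.
Qed.

(** Picard iteration, measured against the weight [expR (2 * K * t)]: each integration then halves
    the distance between iterates, whatever the length of the interval. *)
Lemma linear_ode_exists N (a : R -> 'M[R]_N) : continuous a ->
  exists S, linear_solution a S.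
Proof.
move=> ac.
have [C C0 Ca] : exists2 C : R, 0 < C & forall t, 0 <= t <= 2 -> `|a t| <= C.
  by apply: continuous_bound => // t _; exact: ac.
(* The factor [N] comes from the bound on a matrix product in the maximum norm; adding [1] keeps [K]
   positive. *)
pose K : R := N%:R * C + 1.
have K0 : 0 < K by rewrite ltr_wpDl// mulr_ge0// ltW.
have step (T : R -> 'M[R]_N) : exists F : R -> 'M[R]_N, continuous T ->
    F 0 = 0 /\ forall t : R, -1 < t -> is_derive t 1 F (T t *m a t).
  have [Tc|nTc] := pselect (continuous T); last by exists (cst 0) => /nTc.
  have [|F FP] := @antiderivative_mx _ _ (fun t => T t *m a t); last by exists F.
  move=> t; exact: (cvg_comp2 (Tc t) (ac t) (@mulmx_continuous2 R N N N (_, _))).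
pose P T := sval (cid (step T)).
have PP T : continuous T -> P T 0 = 0 /\ forall t : R, -1 < t -> is_derive t 1 (P T) (T t *m a t).
  exact: svalP (cid (step T)).
(* The previous iterate is clamped before integration, because [antiderivative] asks for continuity
   on the whole line. *)
pose T := fix T n := if n is n'.+1 then (fun t => 1%:M + P (T n' \o clamp) t) else fun=> 1%:M.
have dPc F : continuous (F \o clamp) -> forall t : R, -1 < t ->
    {for t, continuous (fun t => 1%:M + P (F \o clamp) t)}.
  move=> Fc t t1; have [_ /(_ t t1)[dP _]] := PP _ Fc.
  apply: continuousD; first exact: cst_continuous.
  exact/differentiable_continuous/derivable1_diffP.
have clamp_gt t : -1 < clamp t by have /andP[+ _] := clamp_range t; lra.
have Pc F : continuous (F \o clamp) -> continuous ((fun t => 1%:M + P (F \o clamp) t) \o clamp).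
  move=> Fc t; apply: continuous_comp; first exact: clamp_continuous.
  exact: dPc.
have Tc n : continuous (T n \o clamp).
  elim: n => [|n IH]; first exact: cst_continuous.
  exact: Pc.
(* [K] times this weight is the derivative of the weight of rank [n.+1]. *)
pose g n (t : R) := 2^-1 ^+ n * expR (2 * K * t).
have g0 n (t : R) : 0 <= g n t by rewrite mulr_ge0 ?expR_ge0// exprn_ge0.
have mulK (A : 'M[R]_N) (t b : R) : 0 <= t <= 2 -> `|A| <= b -> `|A *m a t| <= K * b.
  move=> ht Ab; apply: (le_trans (mulmx_norm _ _)); have b0 := le_trans (normr_ge0 _) Ab.
  apply: (@le_trans _ _ (N%:R * b * C)); first by rewrite ler_pM ?mulr_ge0// ?Ca// ler_wpM2l.
  by rewrite /K mulrAC mulrDl mul1r lerDl.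
pose c0 : R := `|1%:M : 'M[R]_N|.
have c00 : 0 <= c0 by exact: normr_ge0.
have dg n (t : R) : is_derive t 1 (fun s => c0 * g n.+1 s) (c0 * (K * g n t)).
  have -> : c0 * (K * g n t) = (c0 * 2^-1 ^+ n.+1) * (2 * K) * expR (2 * K * t).
    by rewrite /g exprS; field.
  rewrite (_ : (fun s => _) = fun s => (c0 * 2^-1 ^+ n.+1) * expR (2 * K * s)).
    exact: is_derive_expRM.
  by apply/funext => s; rewrite mulrA.
have T_S n (t : R) : 0 <= t <= 2 -> is_derive t 1 (T n.+1) (T n (clamp t) *m a t).
  move=> /andP[t0 _]; rewrite -[X in is_derive _ _ _ X]add0r; apply: is_deriveD.
  by have [_] := PP _ (Tc n); apply; lra.
have T_0 n : T n 0 = 1%:M by case: n => //= n; rewrite (PP _ (Tc n)).1 addr0.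
have Tbound n : forall t : R, 0 <= t <= 2 -> `|T n.+1 t - T n t| <= c0 * g n t.
  elim: n => [|n IH] t /andP[t0 t2].
    apply: (@mx_bound_of_derive _ _ (fun t => T 1%N t - T 0%N t) (fun t => 1%:M *m a t)
      (fun t => c0 * g 0%N t) (fun t => c0 * (2 * K) * expR (2 * K * t))).
    - exact: t0.
    - by rewrite !T_0 subrr.
    - by rewrite mulr_ge0.
    - move=> s /andP[s0 st]; have s2 : 0 <= s <= 2 by rewrite s0 (le_trans st).
      rewrite -[_ *m _]subr0; apply: is_deriveB; exact: T_S.
    - move=> s _; rewrite /g expr0; rewrite (_ : (fun t => _) = fun t => c0 * expR (2 * K * t)); last by apply/funext => r; rewrite mul1r.
      exact: is_derive_expRM.
    - move=> s /andP[s0 st]; have s2 : 0 <= s <= 2 by rewrite s0 (le_trans st).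
      apply: (le_trans (mulK _ s c0 s2 _)) => //; rewrite mulrC -mulrA ler_wpM2l//.
      have : 1 <= expR (2 * K * s) by rewrite -expR0 ler_expR !mulr_ge0// ltW.
      move=> e1; apply: (@le_trans _ _ (2 * K * 1)); first by rewrite mulr1; lra.
      by rewrite ler_wpM2l// mulr_ge0// ltW.
  apply: (@mx_bound_of_derive _ _ (fun t => T n.+2 t - T n.+1 t)
      (fun t => (T n.+1 (clamp t) - T n (clamp t)) *m a t)
      (fun t => c0 * g n.+1 t) (fun t => c0 * (K * g n t))).
  - exact: t0.
  - by rewrite !T_0 subrr.
  - by rewrite mulr_ge0.
  - move=> s /andP[s0 st]; have s2 : 0 <= s <= 2 by rewrite s0 (le_trans st).
    by rewrite mulmxBl; apply: is_deriveB; exact: T_S.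
  - move=> s /andP[s0 st]; have s2 : 0 <= s <= 2 by rewrite s0 (le_trans st).
    by rewrite clamp_id// mulrCA; apply: mulK => //; exact: IH.
pose B := c0 * expR (2 * K * 2).
have B0 : 0 <= B by rewrite mulr_ge0// expR_ge0.
have limT (t : R) : exists l, 0 <= t <= 2 -> forall n, `|l - T n t| <= 2 * B * 2^-1 ^+ n.
  have [ht|nht] := boolP (0 <= t <= 2); last by exists 0.
  have [|l Hl] := @cvg_of_geometric _ _ (fun n => T n t) B B0; last by exists l.
  move=> n; apply: (le_trans (Tbound n t ht)); rewrite /g /B mulrCA mulrC.
  rewrite ler_wpM2r ?exprn_ge0// ler_wpM2l// ler_expR ler_wpM2l//.
    by rewrite mulr_ge0// ltW.
  by move/andP: ht => [].
pose S t := sval (cid (limT t)).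
have ST (t : R) : 0 <= t <= 2 -> forall n, `|S t - T n t| <= 2 * B * 2^-1 ^+ n.
  exact: svalP (cid (limT t)).
have z1 : `|2^-1 : R| < 1 by rewrite ger0_norm// invf_lt1// ltr1n.
have Sc : continuous (S \o clamp).
  move=> t; apply/cvgrPdist_le => e e0.
  have /cvgrPdist_le/(_ (e / 3)) := @cvg_geometric R (2 * B) _ z1.
  rewrite divr_gt0// => /(_ isT) [n _ /(_ n (leqnn n))]; rewrite /= sub0r normrN => ne.
  have nB : 2 * B * 2^-1 ^+ n <= e / 3 by apply: le_trans ne; rewrite ler_norm.
  have /cvgrPdist_le/(_ (e / 3)) := Tc n t; rewrite divr_gt0// => /(_ isT).
  apply: filterS => s /= Hs; have H1 := ST (clamp t) (clamp_range t) n.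
  have H2 := ST (clamp s) (clamp_range s) n.
  have -> : S (clamp t) - S (clamp s) = (S (clamp t) - T n (clamp t)) +
      (T n (clamp t) - T n (clamp s)) - (S (clamp s) - T n (clamp s)).
    by rewrite subrKA opprB addrA subrK.
  apply: (le_trans (ler_normB _ _)).
  have := ler_normD (S (clamp t) - T n (clamp t)) (T n (clamp t) - T n (clamp s)); lra.
(* The limit [S] is only known to be continuous. [Sol] integrates the equation from it, hence is
   differentiable, and both stay within geometric distance of the iterates, so they agree. *)
pose Sol (t : R) := 1%:M + P (S \o clamp) t.
have [PS0 dPS] := PP _ Sc.
have dSol (t : R) : -1 < t -> is_derive t 1 Sol (S (clamp t) *m a t).
  move=> t1; rewrite -[X in is_derive _ _ _ X]add0r.
  exact: (is_deriveD (is_derive_cst _ _ _) (dPS t t1)).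
have SolS (t : R) : 0 <= t <= 2 -> Sol t = S t.
  move=> /[dup] ht /andP[t0 t2]; apply/eqP; rewrite -subr_eq0 -normr_le0.
  apply: (@le0_geometric _ (K * (2 * B) * 2 + B)) => n.
  have H1 := ST t ht n.+1; rewrite exprS in H1.
  have H2 : `|Sol t - T n.+1 t| <= K * (2 * B * 2^-1 ^+ n) * t.
    have F0 : Sol 0 - T n.+1 0 = 0 by rewrite T_0 /Sol PS0 addr0 subrr.
    have G0 : 0 <= K * (2 * B * 2^-1 ^+ n) * 0 by rewrite mulr0.
    have le2 (s : R) : 0 <= s <= t -> 0 <= s <= 2.
      by move=> /andP[-> st]; exact: le_trans st t2.
    have dF (s : R) : 0 <= s <= t -> is_derive s 1 (fun t => Sol t - T n.+1 t)
        ((S (clamp s) - T n (clamp s)) *m a s).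
      move=> /le2 s2; rewrite mulmxBl; have s1 : -1 < s by move/andP: s2 => [+ _]; lra.
      exact: (is_deriveB (dSol s s1) (T_S n s s2)).
    have dG (s : R) : 0 <= s <= t -> is_derive s 1 (fun t => K * (2 * B * 2^-1 ^+ n) * t)
        (K * (2 * B * 2^-1 ^+ n)).
      move=> _; have d0 : is_derive s 1 (id : R -> R) 1 by exact: is_derive_id.
      by have := is_deriveZ (K * (2 * B * 2^-1 ^+ n)) d0; rewrite /GRing.scale/= mulr1.
    have FG (s : R) : 0 <= s <= t ->
        `|(S (clamp s) - T n (clamp s)) *m a s| <= K * (2 * B * 2^-1 ^+ n).
      by move=> /le2 s2; rewrite clamp_id//; apply: mulK => //; exact: ST.
    exact: (mx_bound_of_derive t0 F0 G0 dF dG FG).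
  have -> : Sol t - S t = Sol t - T n.+1 t - (S t - T n.+1 t).
    by rewrite opprB addrA subrK.
  apply: (le_trans (ler_normB _ _)); apply: (le_trans (lerD H2 H1)).
  have x0 : 0 <= 2^-1 ^+ n :> R by rewrite exprn_ge0.
  have : K * (2 * B * 2^-1 ^+ n) * t <= K * (2 * B * 2^-1 ^+ n) * 2.
    by rewrite ler_wpM2l// !mulr_ge0// ltW.
  by move: (_ ^+ n) => x; lra.
exists Sol; split; first by rewrite /Sol PS0 addr0.
move=> t ht; have t1 : -1 < t by move/andP: ht => [+ _]; lra.
by move: (dSol t t1); rewrite (SolS t ht) (clamp_id ht).
Qed.

End LinearODE.

(** * Gronwall's estimate and uniqueness *)

Section Gronwall.
Context {R : realType}.

(** Let [M] be the maximum of [|Z t| / expR (2 * K * t)], attained at [s]. Integrating the equation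
    up to [s] gives [M <= M / 2 + g], hence [M <= 2 * g]. *)
Lemma gronwall p N (Z c : R -> 'M[R]_(p, N)) (a : R -> 'M[R]_N) (K g : R) :
  0 <= K -> 0 <= g -> Z 0 = 0 ->
  (forall t : R, 0 <= t <= 1 -> is_derive t 1 Z (Z t *m a t + c t)) ->
  (forall t : R, 0 <= t <= 1 -> N%:R * `|a t| <= K) ->
  (forall t : R, 0 <= t <= 1 -> `|c t| <= g) ->
  forall t : R, 0 <= t <= 1 -> `|Z t| <= 2 * g * expR (2 * K).
Proof.
move=> K0 g0 Z0 dZ aK cg.
have Zc (t : R) : 0 <= t <= 1 -> {for t, continuous Z}.
  by move=> /dZ[dZt _]; exact/differentiable_continuous/derivable1_diffP.
pose h (t : R) := `|Z t| / expR (2 * K * t).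
have [|s] := @EVT_max R h 0 1 ler01.
  apply: continuous_in_subspaceT => t; rewrite inE/= in_itv/= => ht.
  rewrite /continuous_at /h; apply: cvgM; first by apply: cvg_norm; exact: Zc.
  apply: cvgV; first by rewrite gt_eqF// expR_gt0.
  apply: (@continuous_comp _ _ _ (fun t : R => 2 * K * t) expR); last exact: continuous_expR.
  by rewrite /continuous_at; apply: cvgM; [exact: cvg_cst|exact: cvg_id].
rewrite in_itv/= => s01 smax; set M := h s in smax.
have ZM (t : R) : 0 <= t <= 1 -> `|Z t| <= M * expR (2 * K * t).
  move=> ht; have := smax t; rewrite in_itv/= => /(_ ht); rewrite {1}/h.
  by rewrite ler_pdivrMr ?expR_gt0.
have M0 : 0 <= M by rewrite /M /h divr_ge0// expR_ge0.
have [s0 s1] := andP s01.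
have le1 (t : R) : 0 <= t <= s -> 0 <= t <= 1.
  by move=> /andP[-> ts]; exact: le_trans ts s1.
pose G (t : R) := M / 2 * expR (2 * K * t) + g * t.
have dG (t : R) : is_derive t 1 G (M / 2 * (2 * K) * expR (2 * K * t) + g).
  have d1 := is_derive_expRM (2 * K) (M / 2) t.
  have d2 : is_derive t 1 (fun t : R => g * t) g.
    have d0 : is_derive t 1 (id : R -> R) 1 by exact: is_derive_id.
    by have := is_deriveZ g d0; rewrite /GRing.scale/= mulr1.
  exact: (is_deriveD d1 d2).
have G0 : 0 <= G 0 by rewrite /G !mulr0 addr0 mulr_ge0 ?expR_ge0// divr_ge0.
have ZG : `|Z s| <= G s.
  apply: (mx_bound_of_derive s0 Z0 G0 (fun t ht => dZ t (le1 t ht)) (fun t _ => dG t)).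
  move=> t /le1 ht; apply: (le_trans (ler_normD _ _)); apply: lerD; last exact: cg.
  apply: (le_trans (mulmx_norm _ _)).
  have n0 : 0 <= N%:R * `|a t| by rewrite mulr_ge0.
  have H := ler_pM n0 (normr_ge0 (Z t)) (aK t ht) (ZM t ht).
  by rewrite mulrAC; apply: (le_trans H); move: (expR _) => x; lra.
have e1 : 1 <= expR (2 * K * s) by rewrite -expR0 ler_expR !mulr_ge0.
have M2g : M <= 2 * g.
  have : M * expR (2 * K * s) <= G s by rewrite /M /h divfK// gt_eqF// expR_gt0.
  have gs : g * s <= g * expR (2 * K * s).
    by rewrite ler_wpM2l// (le_trans s1).
  rewrite /G => H; have : M * expR (2 * K * s) <= (M / 2 + g) * expR (2 * K * s) by lra.
  by rewrite ler_pM2r ?expR_gt0//; lra.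
move=> t /[dup] ht /andP[t0 t1]; apply: (le_trans (ZM t ht)).
apply: ler_pM => //.
by rewrite ler_expR -[leRHS]mulr1 ler_wpM2l// mulr_ge0.
Qed.

Lemma linear_ode_unique p N (Z : R -> 'M[R]_(p, N)) (a : R -> 'M[R]_N) :
  (forall t : R, 0 <= t <= 1 -> {for t, continuous a}) -> Z 0 = 0 ->
  (forall t : R, 0 <= t <= 1 -> is_derive t 1 Z (Z t *m a t)) ->
  forall t : R, 0 <= t <= 1 -> Z t = 0.
Proof.
move=> ac Z0 dZ t ht; have [C C0 aC] := continuous_bound ler01 ac.
apply/eqP; rewrite -normr_le0.
have dZ0 (s : R) : 0 <= s <= 1 -> is_derive s 1 Z (Z s *m a s + 0).
  by rewrite addr0; exact: dZ.
have K0 : 0 <= N%:R * C by rewrite mulr_ge0// ltW.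
have aK (s : R) : 0 <= s <= 1 -> N%:R * `|a s| <= N%:R * C.
  by move=> /aC sC; rewrite ler_wpM2l.
have c0 (s : R) : 0 <= s <= 1 -> `|0 : 'M[R]_(p, N)| <= 0 by rewrite normr0.
by have := gronwall K0 (lexx 0) Z0 dZ0 aK c0 ht; rewrite mulr0 mul0r.
Qed.

End Gronwall.

(** * Smooth dependence on parameters *)

Section ParametricODE.
Context {R : realType} {V : normedModType R} (U : set V).
Hypotheses (fV : finite_frame V) (oU : open U).

(** An open time interval around [[0, 2]], so that joint smoothness in time and parameter is a
    statement on an open set. *)
Definition ode_domain : set (R * V) := [set p | -1 < p.1 < 3 /\ U p.2].

Lemma ode_domain_open : open ode_domain.
Proof.
rewrite (_ : ode_domain = (fst @^-1` `]-1, 3[%classic) `&` (snd @^-1` U)).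
  apply: openI; (apply: open_comp; last by [exact: itv_open|exact: oU]).
    by move=> p _; exact: cvg_fst.
  by move=> p _; exact: cvg_snd.
by apply/seteqP; split=> -[t y] /=; rewrite in_itv.
Qed.

Lemma ode_domainI t y : 0 <= t <= 2 -> U y -> ode_domain (t, y).
Proof. by move=> /andP[t0 t2] Uy; split=> //=; apply/andP; split; lra. Qed.

Definition solves N (a : R * V -> 'M[R]_N) (sol : V -> R -> 'M[R]_N) :=
  forall y, U y -> linear_solution (fun t => a (t, y)) (sol y).

Lemma slice_continuous N (a : R * V -> 'M[R]_N) (f : R -> R) y t :
  {for (f t, y), continuous a} -> {for t, continuous f} ->
  {for t, continuous (fun t => a (f t, y))}.
Proof.
move=> ac fc; have ca : a (p.1, p.2) @[p --> (f t, y)] --> a (f t, y).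
  by rewrite (_ : (fun p => a (p.1, p.2)) = a) //; apply/funext => -[].
exact: (cvg_comp2 (h := fun s z => a (s, z)) fc (cvg_cst y) ca).
Qed.

Lemma solves_exists N (a : R * V -> 'M[R]_N) : smooth_on ode_domain a ->
  exists sol, solves a sol.
Proof.
move=> sa.
have H y : exists S, U y -> linear_solution (fun t => a (t, y)) S.
  have [Uy|nUy] := pselect (U y); last by exists (fun=> 0).
  have [|S [S0 dS]] := @linear_ode_exists R N (fun t => a (clamp t, y)).
    move=> t; apply: (slice_continuous (f := clamp)); last exact: clamp_continuous.
    apply: differentiable_continuous; apply: smooth_on_diff sa _.
    by apply: ode_domainI => //; exact: clamp_range.
  exists S => _; split=> // t ht; move: (dS t ht); by rewrite clamp_id.
exists (fun y => sval (cid (H y))) => y; exact: svalP (cid (H y)).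
Qed.

Lemma norm_pair0 (h : V) : `|((0 : R), h)| = `|h|.
Proof. by rewrite prod_normE/= normr0; apply/max_idPr. Qed.

(** Compactness of [[0, 1]] makes the strict differentiability of the coefficient uniform in
    time. *)
Lemma uniform_increment N (a : R * V -> 'M[R]_N) y e : smooth_on ode_domain a ->
  U y -> 0 < e ->
  \forall h \near (0 : V), forall t : R, 0 <= t <= 1 ->
    `|a (t, h + y) - a (t, y)| <= e /\
    `|a (t, h + y) - a (t, y) - 'D_((0 : R), h) a (t, y)| <= e * `|h|.
Proof.
move=> sa Uy e0; have e20 : 0 < e / 2 by rewrite divr_gt0.
have fRV : finite_frame (R * V)%type by apply: finite_frame_pair => //; exact: finite_frame_R.
have := (@compact_near_coveringP _ _).1 (@segment_compact R 0 1) V (nbhs (0 : V))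
  (fun h t => `|a (t, h + y) - a (t, y)| <= e /\
    `|a (t, h + y) - a (t, y) - 'D_((0 : R), h) a (t, y)| <= e * `|h|) _.
move=> H; have : \forall h \near (0 : V), `[0, 1]%classic `<=` (fun t =>
   `|a (t, h + y) - a (t, y)| <= e /\
    `|a (t, h + y) - a (t, y) - 'D_((0 : R), h) a (t, y)| <= e * `|h|).
  apply: H => t0; rewrite /= in_itv/= => /andP[t00 t01].
  have Dt : ode_domain (t0, y) by apply: ode_domainI => //; rewrite t00; lra.
  have [r r0 [rD Hr]] := strict_differentiability fRV ode_domain_open sa Dt e0.
  have ac : {for (t0, y), continuous a}.
    by apply: differentiable_continuous; exact: smooth_on_diff sa Dt.
  have /cvgrPdist_le/(_ _ e20)/nbhs_ballP[r' /= r'0 Hr'] := ac.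
  exists (ball t0 (Num.min r r'), ball (0 : V) (Num.min r r')).
    by split; apply: nbhsx_ballx; rewrite lt_min r0.
  move=> [t h] [/= tr hr].
  have b1 : ball (t0, y) (Num.min r r') (t, h + y).
    split=> //=; move: hr; rewrite -!ball_normE /ball_/= sub0r opprD addrCA subrr addr0.
    by [].
  have b2 : ball (t0, y) (Num.min r r') (t, y).
    by split=> //=; apply: ballxx; rewrite lt_min r0.
  have br1 := @le_ball _ _ _ (Num.min r r') r _ _ b1; have br2 := @le_ball _ _ _ (Num.min r r') r _ _ b2.
  have br1' := @le_ball _ _ _ (Num.min r r') r' _ _ b1; have br2' := @le_ball _ _ _ (Num.min r r') r' _ _ b2.
  rewrite !ge_min !lexx ?orbT in br1 br2 br1' br2'.
  have pE : ((t, h + y) - (t, y) : R * V) = (0, h).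
    by rewrite /GRing.opp/= /GRing.add/=; congr (_, _); rewrite ?subrr ?addrK.
  split.
    have H1 := Hr' _ (br1' isT); have H2 := Hr' _ (br2' isT).
    rewrite -(subrKA (a (t0, y))) [e]splitr; apply: (le_trans (ler_normD _ _)).
    by apply: lerD => //; rewrite distrC.
  by have := Hr _ _ _ (br1 isT) (br2 isT) (br2 isT); rewrite pE norm_pair0.
by apply: filterS => h Hh t t01; apply: Hh; rewrite /= in_itv.
Qed.

Lemma is_derive_linmx (W : normedModType R) m n (F : R -> 'M[R]_(m, n)) (L : {linear 'M[R]_(m, n) -> W})
    (t : R) D : is_derive t 1 F D -> is_derive t 1 (fun s => L (F s)) (L D).
Proof.
move=> [dF <-]; have dF' : differentiable F t by exact/derivable1_diffP.
apply: DeriveDef; first exact/derivable1_diffP/differentiable_linmx.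
exact: derive_linmx.
Qed.

Definition ulsub_linear N : {linear 'M[R]_(N + N) -> 'M[R]_N} :=
  (@lsubmx R N N N \o @usubmx R N N (N + N)).

Definition ursub_linear N : {linear 'M[R]_(N + N) -> 'M[R]_N} :=
  (@rsubmx R N N N \o @usubmx R N N (N + N)).

(** The variational equation in block form: the upper right block of its solution is the derivative
    of the original solution in the direction [v]. It is again linear, of doubled size, so it can
    itself be differentiated. *)
Definition derived_coef N (a : R * V -> 'M[R]_N) (v : V) (p : R * V) : 'M[R]_(N + N) :=
  block_mx (a p) ('D_((0 : R), v) a p) 0 (a p).

Lemma derived_coef_smooth N (a : R * V -> 'M[R]_N) v :
  smooth_on ode_domain a -> smooth_on ode_domain (derived_coef a v).
Proof.
move=> sa; apply/(smooth_on_mxP _ ode_domain_open) => i j.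
have sij (b : R * V -> 'M[R]_N) i' j' : smooth_on ode_domain b -> smooth_on ode_domain (fun p => b p i' j').
  by move/(smooth_on_mxP _ ode_domain_open); exact.
have sd := smooth_on_derive ((0 : R), v) sa.
rewrite /derived_coef.
have sE (k : 'I_(N + N)) : exists s, k = unsplit s by exists (fintype.split k); rewrite splitK.
have [[i'|i'] ->] := sE i; have [[j'|j'] ->] := sE j => /=.
- by under eq_fun do rewrite block_mxEul; exact: sij.
- by under eq_fun do rewrite block_mxEur; exact: sij.
- by under eq_fun do rewrite block_mxEdl mxE; exact: smooth_on_cst.
- by under eq_fun do rewrite block_mxEdr; exact: sij.
Qed.

Section Derivative.
Variables (N : nat) (a : R * V -> 'M[R]_N) (sol : V -> R -> 'M[R]_N).
Hypotheses (sa : smooth_on ode_domain a) (asol : solves a sol).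
Variable sold : V -> V -> R -> 'M[R]_(N + N).
Hypothesis dsol : forall v, solves (derived_coef a v) (sold v).

Lemma coef_continuous y : U y -> forall t : R, 0 <= t <= 1 ->
  {for t, continuous (fun t => a (t, y))}.
Proof.
move=> Uy t /andP[t0 t1].
apply: (slice_continuous (f := id)); last exact: cvg_id.
apply: differentiable_continuous; apply: smooth_on_diff sa _.
by apply: ode_domainI => //; rewrite t0; lra.
Qed.

Lemma itv01_sub02 (t : R) : 0 <= t <= 1 -> 0 <= t <= 2.
Proof. by move=> /andP[-> t1]; lra. Qed.

Lemma sold_ul v y : U y -> forall t : R, 0 <= t <= 1 -> ulsubmx (sold v y t) = sol y t.
Proof.
move=> Uy t ht; have [s0 ds] := dsol v Uy; have [S0 dS] := asol Uy.
apply/eqP; rewrite -subr_eq0; apply/eqP.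
apply: (linear_ode_unique (Z := fun t => ulsubmx (sold v y t) - sol y t)
  (coef_continuous Uy)) => // [|r hr].
  by rewrite s0 S0 scalar_mx_block block_mxKul subrr.
have d1 := @is_derive_linmx 'M[R]_N _ _ _ (ulsub_linear N) _ _ (ds r (itv01_sub02 hr)).
have -> : (ulsubmx (sold v y r) - sol y r) *m a (r, y) =
    ulsubmx (sold v y r *m derived_coef a v (r, y)) - sol y r *m a (r, y).
  rewrite mulmxBl -[in RHS](submxK (sold v y r)) mulmx_block block_mxKul.
  by rewrite mulmx0 addr0.
exact: (is_deriveB d1 (dS r (itv01_sub02 hr))).
Qed.

Lemma sold_ur v y : U y ->
  ursubmx (sold v y 0) = 0 /\ forall t : R, 0 <= t <= 1 ->
  is_derive t 1 (fun t => ursubmx (sold v y t))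
    (ursubmx (sold v y t) *m a (t, y) + sol y t *m 'D_((0 : R), v) a (t, y)).
Proof.
move=> Uy; have [s0 ds] := dsol v Uy; split=> [|t ht].
  by rewrite s0 scalar_mx_block block_mxKur.
have d1 := @is_derive_linmx 'M[R]_N _ _ _ (ursub_linear N) _ _ (ds t (itv01_sub02 ht)).
suff -> : ursubmx (sold v y t) *m a (t, y) + sol y t *m 'D_((0 : R), v) a (t, y)
   = ursubmx (sold v y t *m derived_coef a v (t, y)) by [].
rewrite -(sold_ul v Uy ht) -[in RHS](submxK (sold v y t)) mulmx_block block_mxKur.
by rewrite addrC.
Qed.

(** The remainder [Q] of the first-order expansion solves the same linear equation with a forcing
    term small compared with [h]; Gronwall's estimate bounds it. *)
Lemma sol_differentiable y : U y -> differentiable (fun z => sol z 1) y /\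
  forall v, 'D_v (fun z => sol z 1) y = ursubmx (sold v y 1).
Proof.
move=> Uy; have [d [b [l [lc le]]]] := fV.
have i01 : 0 <= (1 : R) <= 1 by rewrite ler01 lexx.
(* The candidate differential, assembled from frame directions so that it is visibly linear in [h];
   it is identified with the variational solution in the direction [v] by uniqueness. *)
pose W h t := \sum_(i < d) l i h *: ursubmx (sold (b i) y t).
have W0 h : W h 0 = 0.
  by rewrite /W big1// => i _; rewrite (sold_ur (b i) Uy).1 scaler0.
have da (t : R) : 0 <= t <= 1 -> differentiable a (t, y).
  by move=> ht; apply: smooth_on_diff sa _; apply: ode_domainI => //; exact: itv01_sub02.
have dW h (t : R) : 0 <= t <= 1 -> is_derive t 1 (W h)
    (W h t *m a (t, y) + sol y t *m 'D_((0 : R), h) a (t, y)).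
  move=> ht.
  have -> : W h t *m a (t, y) + sol y t *m 'D_((0 : R), h) a (t, y) =
    \sum_(i < d) l i h *: (ursubmx (sold (b i) y t) *m a (t, y) + sol y t *m 'D_((0 : R), b i) a (t, y)).
    have -> : 'D_((0 : R), h) a (t, y) = \sum_(i < d) l i h *: 'D_((0 : R), b i) a (t, y).
      have dat := da t ht; have hE : ((0 : R), h) = \sum_(i < d) l i h *: ((0 : R), b i).
        have pE (q : R * V) : q = (q.1, q.2) by case: q.
        rewrite [RHS]pE; congr (_, _).
          by rewrite (raddf_sum fst)/= big1// => i _ /=; rewrite scaler0.
        by rewrite (raddf_sum snd)/=; exact: le.
      rewrite deriveE// hE linear_sum; apply: eq_bigr => i _.
      by rewrite linearZ/= deriveE.
    rewrite /W mulmx_suml mulmx_sumr -big_split/=; apply: eq_bigr => i _.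
    by rewrite -scalemxAl -scalemxAr scalerDr.
  rewrite (_ : W h = \sum_(i < d) (fun t => l i h *: ursubmx (sold (b i) y t))); last first.
    by apply/funext => s; rewrite fct_sumE.
  have dl i := is_deriveZ (l i h) ((sold_ur (b i) Uy).2 t ht).
  exact: (is_derive_sum dl).
have [C C0 WC] : exists2 C : R, 0 < C & forall h (t : R), 0 <= t <= 1 -> `|W h t| <= C * `|h|.
  have H i : exists C : R, 0 <= C /\ forall h (t : R), 0 <= t <= 1 ->
      `|l i h *: ursubmx (sold (b i) y t)| <= C * `|h|.
    have [k k0 kl] := linear_lipschitz (lc i).
    have [|k' k'0 k'l] := @continuous_bound R _ _ (fun t => ursubmx (sold (b i) y t)) 1 ler01.
      move=> t /(sold_ur (b i) Uy).2[dt _].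
      exact/differentiable_continuous/derivable1_diffP.
    exists (k * k'); split=> [|h t ht]; first by rewrite mulr_ge0// ltW.
    by rewrite normrZ mulrAC ler_pM// k'l.
  pose c i := sval (cid (H i)).
  have cP i : 0 <= c i /\ forall h (t : R), 0 <= t <= 1 ->
      `|l i h *: ursubmx (sold (b i) y t)| <= c i * `|h| by exact: svalP (cid (H i)).
  exists (1 + \sum_i c i) => [|h t ht].
    by rewrite ltr_wpDr// sumr_ge0// => i _; exact: (cP i).1.
  apply: (le_trans (ler_norm_sum _ _ _)); rewrite mulrDl mul1r mulr_suml.
  rewrite ler_wpDl//; apply: ler_sum => i _; exact: (cP i).2.
have [A A0 aA] := continuous_bound ler01 (coef_continuous Uy).
have [S0 dS] := asol Uy.
have [S S_gt0 solS] : exists2 C : R, 0 < C & forall t : R, 0 <= t <= 1 -> `|sol y t| <= C.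
  apply: continuous_bound => // t /itv01_sub02 /dS[dt _].
  exact/differentiable_continuous/derivable1_diffP.
pose K := N%:R * (A + 1).
have K0 : 0 <= K by rewrite mulr_ge0// addr_ge0// ltW.
(* The constant delivered by [gronwall], where [C] bounds the candidate differential and [S] the
   solution. *)
pose B := 1 + 2 * (N%:R * C + N%:R * S) * expR (2 * K).
have B0 : 0 < B by rewrite ltr_wpDr// !mulr_ge0// ?expR_ge0// addr_ge0// mulr_ge0// ltW.
have Wlin : linear (W ^~ 1).
  move=> r u v; rewrite /W scaler_sumr -big_split/=; apply: eq_bigr => i _.
  by rewrite linearP scalerDl scalerA.
pose dLM := GRing.isLinear.Build _ _ _ _ _ Wlin.
pose dL : {linear V -> 'M[R]_N} := HB.pack (W ^~ 1) dLM.
have dLc : continuous dL.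
  move=> h; apply/differentiable_continuous.
  rewrite (_ : (dL : V -> _) = \sum_(i < d) (fun h => l i h *: ursubmx (sold (b i) y 1))); last first.
    by apply/funext => s; rewrite fct_sumE.
  apply: differentiable_sum => i; apply: differentiableZl.
  exact: linear_differentiable.
have [|ds dsE] := differentiable_eps (f := fun z => sol z 1) (a := y) dLc; last first.
  split=> // v; rewrite deriveE// dsE/=.
  apply/eqP; rewrite -subr_eq0; apply/eqP.
  apply: (linear_ode_unique (Z := fun t => W v t - ursubmx (sold v y t)) (coef_continuous Uy)) => // [|t ht].
    by rewrite W0 (sold_ur v Uy).1 subrr.
  have dB := is_deriveB (dW v t ht) ((sold_ur v Uy).2 t ht).
  rewrite mulmxBl; suff -> : W v t *m a (t, y) - ursubmx (sold v y t) *m a (t, y) =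
    W v t *m a (t, y) + sol y t *m 'D_((0 : R), v) a (t, y) -
    (ursubmx (sold v y t) *m a (t, y) + sol y t *m 'D_((0 : R), v) a (t, y)) by exact: dB.
  by rewrite opprD addrACA subrr addr0.
(* The bound by [1] keeps the perturbed coefficient below [A + 1]; the bound by [e / B] yields the
   required estimate. *)
move=> e e0; pose e' := Num.min 1 (e / B).
have e'0 : 0 < e' by rewrite lt_min ltr01 divr_gt0.
have incr := uniform_increment sa Uy e'0.
have nU : \forall h \near (0 : V), U (h + y).
  have /nbhs_ballP[r /= r0 rU] : nbhs y U by exact: open_nbhs_nbhs.
  apply/nbhs_ballP; exists r => //= h hr; apply: rU; move: hr.
  by rewrite -!ball_normE /ball_/= sub0r opprD addrCA subrr addr0.
near=> h.
have Uh : U (h + y) by exact: (near nU h).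
have inch : forall t : R, 0 <= t <= 1 -> `|a (t, h + y) - a (t, y)| <= e' /\
    `|a (t, h + y) - a (t, y) - 'D_((0 : R), h) a (t, y)| <= e' * `|h|.
  exact: (near incr h).
have [Sh0 dSh] := asol Uh.
pose Q t := sol (h + y) t - sol y t - W h t.
pose c t := W h t *m (a (t, h + y) - a (t, y)) +
  sol y t *m (a (t, h + y) - a (t, y) - 'D_((0 : R), h) a (t, y)).
have Q0 : Q 0 = 0 by rewrite /Q Sh0 S0 W0 !subrr.
have dQ (t : R) : 0 <= t <= 1 -> is_derive t 1 Q (Q t *m a (t, h + y) + c t).
  move=> ht; have d1 := is_deriveB (is_deriveB (dSh t (itv01_sub02 ht)) (dS t (itv01_sub02 ht))) (dW h t ht).
  suff -> : Q t *m a (t, h + y) + c t = sol (h + y) t *m a (t, h + y) - sol y t *m a (t, y) -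
    (W h t *m a (t, y) + sol y t *m 'D_((0 : R), h) a (t, y)) by exact: d1.
  rewrite /Q /c !mulmxBl !mulmxBr.
  move: (_ *m _) (_ *m _) (_ *m _) (_ *m _) (_ *m _) (_ *m _) => p1 p2 p3 p4 p5 p6.
  by apply/matrixP => i j; rewrite !mxE; ring.
have aK (t : R) : 0 <= t <= 1 -> N%:R * `|a (t, h + y)| <= K.
  move=> ht; rewrite /K ler_wpM2l//.
  have [H1 _] := inch t ht; have H2 := aA t ht.
  have H3 := ler_normD (a (t, y)) (a (t, h + y) - a (t, y)); rewrite addrC subrK in H3.
  have : e' <= 1 by rewrite ge_min lexx.
  lra.
have cb (t : R) : 0 <= t <= 1 -> `|c t| <= (N%:R * C + N%:R * S) * e' * `|h|.
  move=> ht; have [H1 H2] := inch t ht.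
  apply: (le_trans (ler_normD _ _)); rewrite -mulrA mulrDl; apply: lerD.
    apply: (le_trans (mulmx_norm _ _)).
    apply: (@le_trans _ _ (N%:R * (C * `|h|) * e')); last by rewrite le_eqVlt; apply/orP; left; apply/eqP; ring.
    by rewrite ler_pM// ?mulr_ge0// ler_wpM2l// WC.
  apply: (le_trans (mulmx_norm _ _)).
  by rewrite ler_pM// ?mulr_ge0// ler_wpM2l// solS.
have g0 : 0 <= (N%:R * C + N%:R * S) * e' * `|h|.
  apply: mulr_ge0 => //; apply: mulr_ge0; last exact: ltW.
  by apply: addr_ge0; apply: mulr_ge0 => //; exact: ltW.
have := gronwall K0 g0 Q0 dQ aK cb i01.
rewrite {1}/Q => H; apply: (le_trans H).
have Be : B * e' <= e.
  have : e' <= e / B by rewrite ge_min lexx orbT.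
  by rewrite ler_pdivlMr// mulrC.
rewrite /B in Be; apply: (@le_trans _ _ (B * e' * `|h|)); last by rewrite ler_wpM2r.
rewrite /B; have eh : 0 <= e' * `|h| by rewrite mulr_ge0// ltW.
move: eh; rewrite !mulrA; move: (N%:R * C + N%:R * S) (expR _) `|h| => x z w eh; nra.
Unshelve. all: by end_near. Qed.

End Derivative.

(** Derivatives of solutions are blocks of solutions of derived systems, so the induction on the
    order must quantify over the matrix size. *)
Theorem linear_ode_smooth N (a : R * V -> 'M[R]_N) (sol : V -> R -> 'M[R]_N) :
  smooth_on ode_domain a -> solves a sol -> smooth_on U (fun y => sol y 1).
Proof.
move=> sa asol; apply/smooth_uptoP => k; elim: k N a sol sa asol => [|k IH] N a sol sa asol;
  pose sold v := sval (cid (solves_exists (derived_coef_smooth v sa)));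
  have dsol v : solves (derived_coef a v) (sold v) by
    exact: svalP (cid (solves_exists (derived_coef_smooth v sa))).
  by apply/smooth_upto0 => y /(sol_differentiable sa asol dsol)[].
apply/smooth_uptoS; split=> [y /(sol_differentiable sa asol dsol)[]//|v].
have sk := IH _ _ _ (derived_coef_smooth v sa) (dsol v).
apply: (smooth_upto_ext oU _ (@smooth_upto_linear R _ _ _ k U _ (ursub_linear N) oU _ sk)).
  by move=> y /(sol_differentiable sa asol dsol)[_ ->].
exact: linear_mx_continuous.
Qed.

End ParametricODE.

(** * The matrix exponential *)

Section MatrixExponential.
Context {R : realType} {k : nat} (A : 'M[R]_k).

Definition exp_term (t : R) (i : nat) : 'M[R]_k := (i`!%:R)^-1 *: (t *: A) ^+ i.

Lemma exp_termE t i : exp_term t i = (t ^+ i / i`!%:R) *: A ^+ i.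
Proof.
rewrite /exp_term mulrC -scalerA; congr (_ *: _).
elim: i => [|i IH]; first by rewrite !expr0 scale1r.
by rewrite !exprS IH -!mulmxE -scalemxAl -scalemxAr scalerA.
Qed.

Lemma exp_term_norm t i :
  `|exp_term t i| <= `|1%:M : 'M[R]_k| * exp_coeff (`|t| * (k%:R * `|A|)) i.
Proof.
rewrite exp_termE normrZ /exp_coeff/= normrM normrX exprMn normfV normr_nat.
have fi : 0 <= (i`!%:R)^-1 :> R by rewrite invr_ge0.
have H : `|A ^+ i| <= `|1%:M : 'M[R]_k| * (k%:R * `|A|) ^+ i.
  elim: i {fi} => [|i IH]; first by rewrite !expr0 mulr1.
  rewrite exprS; apply: (le_trans (mulmx_norm _ _)).
  by rewrite exprS mulrCA ler_wpM2l// mulr_ge0.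
apply: (le_trans (ler_wpM2l _ H)); first by rewrite mulr_ge0// exprn_ge0.
by rewrite le_eqVlt; apply/orP; left; apply/eqP; ring.
Qed.

Lemma exp_series_cvg t : cvgn (series (exp_term t)).
Proof.
apply: normed_cvg; apply: (@series_le_cvg _ _ (fun i => `|1%:M : 'M[R]_k| * exp_coeff (`|t| * (k%:R * `|A|)) i)) => [n|n|n|].
- exact: normr_ge0.
- by rewrite mulr_ge0// /exp_coeff/= mulr_ge0 ?invr_ge0// exprn_ge0// !mulr_ge0.
- exact: exp_term_norm.
- rewrite (_ : series _ = `|1%:M : 'M[R]_k| \*: series (exp_coeff (`|t| * (k%:R * `|A|)))).
    by apply: is_cvgZl_tmp; exact: is_cvg_series_exp_coeff.
  by apply/funext => n; rewrite /series/= -mulr_sumr.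
Qed.

(** A linear functional turns the matrix series into a scalar power series, for which termwise
    differentiation is available. *)
Lemma linear_expmx (L : {linear 'M[R]_k -> R}) t :
  pseries (fun i => L (A ^+ i) / i`!%:R) t @ \oo --> L (expmx (t *: A)).
Proof.
have -> : pseries (fun i => L (A ^+ i) / i`!%:R) t = L \o series (exp_term t).
  apply/funext => n; rewrite /pseries /series/= linear_sum; apply: eq_bigr => i _.
  rewrite exp_termE linearZ/= /GRing.scale/=.
  by move: (_^-1) (_ ^+ i) (L _) => x y z; ring.
by apply: continuous_cvg; [exact: linear_mx_continuous|exact: exp_series_cvg].
Qed.

Lemma is_derive_expmx (t : R) : is_derive t 1 (fun s : R => expmx (s *: A)) (A *m expmx (t *: A)).
Proof.
apply: is_derive_mx => i j.
(* Termwise differentiation of the power series attached to [L n] gives the one attached to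
   [L n.+1]. *)
pose L (n : nat) : {linear 'M[R]_k -> R} := @coord_mx R k k i j \o mulmx (A ^+ n).
have cE n : pseries_diffs (fun m => L n (A ^+ m) / m`!%:R) = (fun m => L n.+1 (A ^+ m) / m`!%:R).
  apply/funext => m; rewrite /pseries_diffs /L/= /coord_mx.
  have -> : A ^+ n *m A ^+ m.+1 = A ^+ n.+1 *m A ^+ m.
    by rewrite !mulmxE -!exprD addSnnS.
  by rewrite factS natrM invfM mulrCA mulVKf.
pose M : R := `|t| + 1.
have cv n x : cvgn (pseries (fun m => L n (A ^+ m) / m`!%:R) x).
  by apply/cvg_ex; exists (L n (expmx (x *: A))); exact: linear_expmx.
have := @pseries_snd_diffs R (fun m => L 0%N (A ^+ m) / m`!%:R) M t.
rewrite !cE => /(_ (cv _ _) (cv _ _) (cv _ _)).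
have M0 : 0 <= M by rewrite addr_ge0.
rewrite (ger0_norm M0) ltrDl ltr01 => /(_ isT).
have lE n x : limn (pseries (fun m => L n (A ^+ m) / m`!%:R) x) = L n (expmx (x *: A)).
  by apply: cvg_lim => //; exact: linear_expmx.
rewrite lE (_ : (fun x => _) = (fun x => expmx (x *: A) i j)).
  by rewrite /L/= /coord_mx expr1.
by apply/funext => x; rewrite lE /L/= /coord_mx expr0 mul1mx.
Qed.

Lemma expmx0 : expmx (0 *: A) = 1%:M.
Proof.
apply/matrixP => i j; have := linear_expmx (L := @coord_mx R k k i j) (t := 0).
move=> /(cvg_lim (@Rhausdorff R)) H; rewrite -[LHS]/(coord_mx i j _) -H.
apply: lim_near_cst => //; exists 1%N => //= n /= n1.
rewrite /pseries /series/= -(prednK n1) big_nat_recl//= expr0 fact0 divr1 mulr1.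
by rewrite big1 ?addr0// => m _; rewrite expr0n/= mulr0.
Qed.

Lemma expmx_comm t : A *m expmx (t *: A) = expmx (t *: A) *m A.
Proof.
apply/matrixP => i j.
pose L1 : {linear 'M[R]_k -> R} := @coord_mx R k k i j \o mulmx A.
pose L2 : {linear 'M[R]_k -> R} := @coord_mx R k k i j \o mulmxr A.
have H1 := linear_expmx (L := L1) (t := t); have H2 := linear_expmx (L := L2) (t := t).
have E : (fun n => L1 (A ^+ n) / n`!%:R) = (fun n => L2 (A ^+ n) / n`!%:R).
  apply/funext => n; rewrite /L1 /L2/=; congr (coord_mx _ _ _ / _).
  by rewrite !mulmxE -exprS -exprSr.
by rewrite E in H1; exact: (cvg_unique (@Rhausdorff R) H1 H2).
Qed.

Lemma differentiable_expmx (t : R) : differentiable (fun s : R => expmx (s *: A)) t.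
Proof. by have [d _] := is_derive_expmx t; exact/derivable1_diffP. Qed.

Lemma derive_expmx (t v : R) : 'D_v (fun s : R => expmx (s *: A)) t = v *: (A *m expmx (t *: A)).
Proof.
rewrite deriveE; last exact: differentiable_expmx.
rewrite -[v in LHS]mulr1 -[_ * 1]/(v *: (1 : R)) linearZ -deriveE; last exact: differentiable_expmx.
by have [_ ->] := is_derive_expmx t.
Qed.

Lemma smooth_expmx : smooth_on setT (fun s : R => expmx (s *: A)).
Proof.
apply/smooth_uptoP; elim=> [|n IH].
  by apply/smooth_upto0 => x _; exact: differentiable_expmx.
apply/smooth_uptoS; split=> [x _|v]; first exact: differentiable_expmx.
pose L : {linear 'M[R]_k -> 'M[R]_k} := v \*: (mulmx A : {linear 'M[R]_k -> 'M[R]_k}).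
have oT : open [set: R] by exact: openT.
apply: (smooth_upto_ext oT _ (@smooth_upto_linear R _ _ _ n _ _ L oT _ IH)).
  by move=> x _; rewrite derive_expmx.
exact: linear_mx_continuous.
Qed.

Lemma derivative_zero_cst m n (F : R -> 'M[R]_(m, n)) :
  (forall t : R, is_derive t 1 F 0) -> forall t, F t = F 0.
Proof.
move=> dF t; apply/matrixP => i j.
have dFij (s : R) : is_derive s 1 (fun r => F r i j) 0.
  by have := is_derive_entry i j (dF s); rewrite mxE.
exact: (is_derive_0_is_cst t 0 dFij).
Qed.

Lemma is_derive_mulmx m n p (F : R -> 'M[R]_(m, n)) (G : R -> 'M[R]_(n, p)) (t : R) dF dG :
  is_derive t 1 F dF -> is_derive t 1 G dG ->
  is_derive t 1 (fun s => F s *m G s) (dF *m G t + F t *m dG).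
Proof.
move=> [eF <-] [eG <-].
have d1 : differentiable F t by exact/derivable1_diffP.
have d2 : differentiable G t by exact/derivable1_diffP.
apply: DeriveDef; first exact/derivable1_diffP/differentiable_mulmx.
exact: derive_mulmx.
Qed.

Lemma is_derive_expmxN (t : R) :
  is_derive t 1 (fun s : R => expmx (- s *: A)) (- (A *m expmx (- t *: A))).
Proof.
have dN : differentiable (fun s : R => - s) t by exact: differentiableN.
have dE := differentiable_expmx (- t).
apply: DeriveDef.
  by apply/derivable1_diffP; exact: (@differentiable_comp _ _ _ _ (fun s : R => - s) (fun s => expmx (s *: A))).
rewrite (@derive_comp _ _ _ _ (fun s : R => - s) (fun s => expmx (s *: A)))//.
rewrite derive_expmx.
have dNid : is_derive t 1 (fun s : R => - s) (- 1).
  by apply: is_deriveN; exact: is_derive_id.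
by have [_ ->] := dNid; rewrite scaleN1r.
Qed.

Lemma expmxV t : expmx (t *: A) *m expmx (- t *: A) = 1%:M.
Proof.
pose F (s : R) := expmx (s *: A) *m expmx (- s *: A).
have dF (s : R) : is_derive s 1 F 0.
  have := is_derive_mulmx (is_derive_expmx s) (is_derive_expmxN s).
  rewrite mulmxN expmx_comm -!mulmxA expmx_comm.
  by rewrite subrr.
have := derivative_zero_cst dF t; rewrite /F => ->.
by rewrite oppr0 expmx0 mulmx1.
Qed.

(** The derivative of [E^T J E] is [E^T (A^T J + J A) E], which vanishes; its value at time [0] is
    [J]. *)
Lemma expmx_symplectic (J : 'M[R]_k) : A^T *m J + J *m A = 0 ->
  forall t, (expmx (t *: A))^T *m J *m expmx (t *: A) = J.
Proof.
move=> AJ t; pose E (s : R) := expmx (s *: A).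
have dET (s : R) : is_derive s 1 (fun s => (E s)^T) ((A *m E s)^T).
  have [d dE] := is_derive_expmx s.
  have dd : differentiable E s by exact/derivable1_diffP.
  apply: DeriveDef; first exact/derivable1_diffP/(@differentiable_linmx _ _ _ _ _ E (@trmx R k k)).
  by rewrite (@derive_linmx _ _ _ _ _ E (@trmx R k k) _ _ dd)/= dE.
have dF (s : R) : is_derive s 1 (fun s => (E s)^T *m (J *m E s)) 0.
  have dJ : is_derive s 1 (fun s => J *m E s) (J *m (A *m E s)).
    have dc : is_derive s 1 (fun=> J : 'M[R]_k) 0 by exact: is_derive_cst.
    by have := is_derive_mulmx dc (is_derive_expmx s); rewrite mul0mx add0r.
  have := is_derive_mulmx (dET s) dJ.
  suff -> : (A *m E s)^T *m (J *m E s) + (E s)^T *m (J *m (A *m E s)) = 0 by [].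
  by rewrite trmx_mul -mulmxA -mulmxDr !mulmxA -mulmxDl AJ mul0mx mulmx0.
have := derivative_zero_cst dF t; rewrite /E mulmxA => ->.
by rewrite expmx0 trmx1 mul1mx mulmx1.
Qed.

End MatrixExponential.

(** * Linear algebra of the standard symplectic form *)

Section OmegaAlgebra.
Context {R : realType} {n : nat}.
Local Notation E' := 'cV[R]_(2 + (n + n)).
Local Notation S := (OmegaMx R n).
Implicit Types (u v w : E') (A : 'M[R]_(2 + (n + n))).

Lemma stdJ_tr k : (stdJ R k)^T = - stdJ R k.
Proof.
by rewrite /stdJ tr_block_mx !trmx0 linearN/= trmx1 opp_block_mx oppr0 opprK.
Qed.

Lemma stdJ_sq k : stdJ R k *m stdJ R k = - 1%:M.
Proof.
rewrite /stdJ mulmx_block !mul0mx !mulmx0 !mulmxN !mulNmx !mulmx1 !add0r !addr0.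
by rewrite scalar_mx_block opp_block_mx oppr0.
Qed.

Lemma OmegaMx_tr : S^T = - S.
Proof.
have J1 : (stdJ R 1 : 'M[R]_2)^T = - (stdJ R 1 : 'M[R]_2) by exact: (stdJ_tr 1).
by rewrite /OmegaMx tr_block_mx !trmx0 J1 stdJ_tr [RHS]opp_block_mx !oppr0.
Qed.

Lemma OmegaMx_sq : S *m S = - 1%:M.
Proof.
have J1 : (stdJ R 1 : 'M[R]_2) *m (stdJ R 1 : 'M[R]_2) = - 1%:M by exact: (stdJ_sq 1).
rewrite /OmegaMx mulmx_block !mul0mx !mulmx0 !addr0 !add0r J1 stdJ_sq.
have -> : (1%:M : 'M[R]_(2 + (n + n))) = block_mx 1%:M 0 0 1%:M by exact: scalar_mx_block.
by rewrite [RHS]opp_block_mx !oppr0.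
Qed.

Lemma OmegaDl u v w : Omega' (u + v) w = Omega' u w + Omega' v w.
Proof. by rewrite /Omega' linearD/= !mulmxDl mxE. Qed.

Lemma OmegaDr u v w : Omega' w (u + v) = Omega' w u + Omega' w v.
Proof. by rewrite /Omega' mulmxDr mxE. Qed.

Lemma OmegaZl a u w : Omega' (a *: u) w = a * Omega' u w.
Proof. by rewrite /Omega' linearZ/= -!scalemxAl mxE. Qed.

Lemma OmegaZr a u w : Omega' w (a *: u) = a * Omega' w u.
Proof. by rewrite /Omega' -scalemxAr mxE. Qed.

Lemma OmegaNl u w : Omega' (- u) w = - Omega' u w.
Proof. by rewrite -scaleN1r OmegaZl mulN1r. Qed.

Lemma Omega_antisym u v : Omega' u v = - Omega' v u.
Proof.
rewrite /Omega' -[in LHS](trmxK (u^T *m S *m v)) mxE !trmx_mul trmxK OmegaMx_tr.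
by rewrite mulNmx mulmxN mxE mulmxA.
Qed.

Lemma Omega_self u : Omega' u u = 0.
Proof. by have := Omega_antisym u u; lra. Qed.

Lemma Omega_nondeg u : (forall v, Omega' v u = 0) -> u = 0.
Proof.
move=> H; have Su : S *m u = 0.
  apply/matrixP => i j; rewrite ord1 [RHS]mxE.
  have := H (delta_mx i 0); rewrite /Omega' -mulmxA trmx_delta -rowE.
  by rewrite mxE.
by rewrite -[u]opprK -[in LHS](mul1mx u) -mulNmx -OmegaMx_sq -mulmxA Su mulmx0 oppr0.
Qed.

Lemma mx_delta_entry k (M : 'M[R]_k) i j :
  ((delta_mx i 0 : 'cV[R]_k)^T *m M *m (delta_mx j 0 : 'cV[R]_k)) 0 0 = M i j.
Proof. by rewrite trmx_delta -rowE -colE !mxE. Qed.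

Lemma in_spP A : in_sp A <-> A^T *m S + S *m A = 0.
Proof.
have E u v : Omega' (A *m u) v + Omega' u (A *m v) = (u^T *m (A^T *m S + S *m A) *m v) 0 0.
  by rewrite /Omega' trmx_mul mulmxDr mulmxDl [RHS]mxE !mulmxA.
split=> [sA|AS u v]; last by rewrite E AS mulmx0 mul0mx mxE.
by apply/matrixP => i j; rewrite -mx_delta_entry -E sA mxE.
Qed.

Lemma in_sp_sym A u v : in_sp A -> Omega' u (A *m v) = Omega' v (A *m u).
Proof.
by move=> sA; have /eqP := sA u v; rewrite addrC addr_eq0 => /eqP ->; rewrite -Omega_antisym.
Qed.

Lemma Omega_expmx A t u v : in_sp A ->
  Omega' (expmx (t *: A) *m u) (expmx (t *: A) *m v) = Omega' u v.
Proof.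
move=> /in_spP AS; rewrite /Omega' trmx_mul.
set E := expmx _; have -> : u^T *m E^T *m S *m (E *m v) = u^T *m (E^T *m S *m E) *m v.
  by rewrite !mulmxA.
by rewrite (expmx_symplectic AS).
Qed.

Lemma Omega_col (a b : 'cV[R]_2) (y z : 'cV[R]_(n + n)) :
  Omega' (col_mx a y) (col_mx b z) =
  (a^T *m stdJ R 1 *m b) 0 0 + (y^T *m stdJ R n *m z) 0 0.
Proof.
by rewrite /Omega' /OmegaMx tr_col_mx mul_row_block !mulmx0 addr0 add0r mul_row_col mxE.
Qed.

Lemma stdJ1_col (a1 a2 b1 b2 : 'cV[R]_1) :
  ((col_mx a1 a2)^T *m stdJ R 1 *m col_mx b1 b2) 0 0 = a1 0 0 * b2 0 0 - a2 0 0 * b1 0 0.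
Proof.
rewrite /stdJ tr_col_mx mul_row_block mul_row_col.
rewrite !mulmx0 add0r addr0 mulmx1 mulmxN mulmx1 mulNmx.
by rewrite [LHS]mxE addrC !mxE !big_ord1 !mxE.
Qed.

Lemma stdJ1E (a b : 'cV[R]_2) : (a^T *m stdJ R 1 *m b) 0 0 = a 0 0 * b 1 0 - a 1 0 * b 0 0.
Proof.
pose a' : 'cV[R]_(1 + 1) := a; pose b' : 'cV[R]_(1 + 1) := b.
have := stdJ1_col (usubmx a') (dsubmx a') (usubmx b') (dsubmx b').
rewrite !vsubmxK => ->; rewrite !mxE.
have e0E : lshift 1 (0 : 'I_1) = (0 : 'I_2) by exact: val_inj.
have e1E : rshift 1 (0 : 'I_1) = (1 : 'I_2) by exact: val_inj.
by rewrite e0E e1E.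
Qed.

End OmegaAlgebra.

(** * Existence of local reductions *)

Section OmegaCalculus.
Context {R : realType} {n : nat} {V : normedModType R}.
Local Notation E' := 'cV[R]_(2 + (n + n)).

Lemma smooth_on_Omega (U : set V) (f g : V -> E') : open U ->
  smooth_on U f -> smooth_on U g -> smooth_on U (fun x => Omega' (f x) (g x)).
Proof.
move=> oU sf sg; rewrite /Omega'.
apply: (smooth_on_linmx (@coord_mx R 1 1 0 0) oU (f := fun x => (f x)^T *m OmegaMx R n *m g x)).
apply: smooth_on_mulmx => //; apply: smooth_on_mulmx => //; last exact: smooth_on_cst.
exact: (smooth_on_linmx (@trmx R _ _)).
Qed.

Lemma differentiable_Omega (f g : V -> E') x : differentiable f x -> differentiable g x ->
  differentiable (fun x => Omega' (f x) (g x)) x /\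
  forall h, 'D_h (fun x => Omega' (f x) (g x)) x = Omega' ('D_h f x) (g x) + Omega' (f x) ('D_h g x).
Proof.
move=> df dg; pose F x := (f x)^T *m (OmegaMx R n *m g x).
have dSg : differentiable (fun x => OmegaMx R n *m g x) x.
  exact: (differentiable_linmx (mulmx (OmegaMx R n)) dg).
have dfT : differentiable (fun x => (f x)^T) x by exact: (differentiable_linmx (@trmx R _ _) df).
have dF : differentiable F x by exact: differentiable_mulmx.
have E : (fun x => Omega' (f x) (g x)) = (fun x => coord_mx 0 0 (F x)).
  by apply/funext => y; rewrite /Omega' /F mulmxA.
rewrite E; split=> [|h]; first exact: (differentiable_linmx (@coord_mx R 1 1 0 0) dF).
rewrite (derive_linmx (@coord_mx R 1 1 0 0) h dF) /F derive_mulmx//.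
rewrite (derive_linmx (@trmx R _ _) h df) (derive_linmx (mulmx (OmegaMx R n)) h dg).
by rewrite /= /coord_mx mxE /Omega' !mulmxA.
Qed.

Lemma derive_Omega (f g : V -> E') x h : differentiable f x -> differentiable g x ->
  'D_h (fun x => Omega' (f x) (g x)) x = Omega' ('D_h f x) (g x) + Omega' (f x) ('D_h g x).
Proof. by move=> df dg; have [_] := differentiable_Omega df dg. Qed.

End OmegaCalculus.

Section LocalReductionExists.
Variables (R : realType) (n : nat) (A : 'M[R]_(2 + (n + n))).
Local Notation E' := 'cV[R]_(2 + (n + n)).
Local Notation E := 'cV[R]_(n + n).
Local Notation o0 := (e0 R n).
Hypotheses (sA : in_sp A) (eA : Sigma A o0).

Definition ix0 : 'I_(2 + (n + n)) := lshift (n + n) (0 : 'I_2).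
Definition ix1 : 'I_(2 + (n + n)) := lshift (n + n) (1 : 'I_2).

Lemma ord2_cases (k : 'I_2) : k = 0 \/ k = 1.
Proof. by case: k => [[|[|]]]// p; [left|right]; exact: val_inj. Qed.

Definition vertical (y : E) : E' := col_mx 0 y.

(** A vector of [R^(2n)] corrected by a multiple of [o0] so as to be orthogonal to both [o0] and
    [A *m o0], that is, horizontal at [o0]. *)
Definition slice_vec (z : E') : E' :=
  vertical (dsubmx z) + Omega' (A *m o0) (vertical (dsubmx z)) *: o0.

Definition slice_q (z : E') : R := Omega' (slice_vec z) (A *m slice_vec z).

(* Stereographic parametrization of the quadric Omega'(x, Ax) = 1, which
   avoids square roots: ((1 - q) / (1 + q))^2 + 4 q / (1 + q)^2 = 1. *)
Definition slice (z : E') : E' :=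
  (1 + slice_q z)^-1 *: ((1 - slice_q z) *: o0 + 2 *: slice_vec z).

(** Coordinates of the ambient space near [o0]: the first scales across the quadrics
    [Omega' x (A x) = const], the second is the flow time, the others run through a slice. Source
    and target have equal dimension, as the inverse function theorem requires. *)
Definition flow_slice (z : E') : E' :=
  z ix0 0 *: (expmx (- z ix1 0 *: A) *m slice z).

Definition slice_dom : set E' := [set z | 1 + slice_q z != 0].

Lemma Omega_o0_vertical y : Omega' o0 (vertical y) = 0.
Proof.
rewrite /e0 /vertical.
have -> : delta_mx (lshift (n + n) 0) 0 = col_mx (delta_mx 0 0) 0 :> E'.
  apply/matrixP => i j; rewrite !mxE; case: splitP => k ik; rewrite !mxE.
    by rewrite -(inj_eq val_inj)/= ik.
  by rewrite -(inj_eq val_inj)/= ik.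
by rewrite Omega_col mulmx0 trmx0 !mul0mx !mxE addr0.
Qed.

Lemma slice_vec_o0 z : Omega' (slice_vec z) o0 = 0.
Proof.
by rewrite /slice_vec OmegaDl OmegaZl Omega_self mulr0 addr0 Omega_antisym Omega_o0_vertical oppr0.
Qed.

Lemma slice_vec_Ao0 z : Omega' (slice_vec z) (A *m o0) = 0.
Proof.
rewrite /slice_vec OmegaDl OmegaZl; have -> : Omega' o0 (A *m o0) = 1 by exact: eA.
by rewrite mulr1 Omega_antisym addNr.
Qed.

Lemma slice_in_Sigma z : slice_dom z -> Omega' (slice z) (A *m slice z) = 1.
Proof.
move=> q1; rewrite /slice -scalemxAr OmegaZl OmegaZr mulmxDr -!scalemxAr.
rewrite !OmegaDl !OmegaDr !OmegaZl !OmegaZr.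
rewrite slice_vec_Ao0 (in_sp_sym o0 (slice_vec z) sA) slice_vec_Ao0 -/(slice_q z).
have -> : Omega' o0 (A *m o0) = 1 by exact: eA.
by field; exact: q1.
Qed.

Lemma flow_slice_Sigma z : slice_dom z ->
  Omega' (flow_slice z) (A *m flow_slice z) = z ix0 0 ^+ 2.
Proof.
move=> q1; rewrite /flow_slice -(scalemxAr (z ix0 0) A) OmegaZl OmegaZr mulmxA expmx_comm -mulmxA.
by rewrite Omega_expmx// slice_in_Sigma// mulr1 expr2.
Qed.

Lemma smooth_slice_vec (U : set E') : open U -> smooth_on U slice_vec.
Proof.
move=> oU; have sv : smooth_on U (fun z : E' => vertical (dsubmx z)).
  have -> : (fun z : E' => vertical (dsubmx z)) = mulmx (block_mx 0 0 0 1%:M).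
    apply/funext => z; rewrite -[in RHS](vsubmxK z) mul_block_col.
    by rewrite !mul0mx !add0r mul1mx.
  exact: (smooth_on_linmx (mulmx _) oU (smooth_on_id oU)).
apply: smooth_onD => //; apply: smooth_on_scale => //; last exact: smooth_on_cst.
apply: smooth_on_Omega => //; exact: smooth_on_cst.
Qed.

Lemma smooth_slice_q (U : set E') : open U -> smooth_on U slice_q.
Proof.
move=> oU; have sv := smooth_slice_vec oU; apply: smooth_on_Omega => //.
exact: (smooth_on_linmx (mulmx A)).
Qed.

Lemma slice_dom_open : open slice_dom.
Proof.
rewrite (_ : slice_dom = (fun z => 1 + slice_q z) @^-1` [set x | x != 0]) //.
apply: open_comp; last exact: open_neq.
move=> z _; apply: continuousD; first exact: cst_continuous.
apply: differentiable_continuous; exact: (smooth_on_diff (smooth_slice_q openT)).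
Qed.

Lemma smooth_slice : smooth_on slice_dom slice.
Proof.
have oU := slice_dom_open; have sv := smooth_slice_vec oU; have sq := smooth_slice_q oU.
apply: smooth_on_scale => //.
  apply: smooth_on_inv => //; apply: smooth_onD => //; exact: smooth_on_cst.
apply: smooth_onD => //; apply: smooth_on_scale => //; try exact: smooth_on_cst.
by apply: smooth_onB => //; exact: smooth_on_cst.
Qed.

Lemma smooth_flow_slice : smooth_on slice_dom flow_slice.
Proof.
have oU := slice_dom_open.
have sc i : smooth_on slice_dom (fun z : E' => z i 0).
  exact: (smooth_on_linmx (@coord_mx R _ _ i 0) oU (smooth_on_id oU)).
apply: smooth_on_scale => //; apply: smooth_on_mulmx => //; last exact: smooth_slice.
apply: (smooth_on_comp (U' := setT) finite_frame_R oU _ _ (smooth_expmx A)) => //.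
exact: smooth_onN.
Qed.

Lemma dsubmx_o0 : dsubmx o0 = 0.
Proof. by apply/matrixP => i j; rewrite !mxE. Qed.

Lemma o0_ix0 : o0 ix0 0 = 1.
Proof. by rewrite mxE !eqxx. Qed.

Lemma o0_ix1 : o0 ix1 0 = 0.
Proof. by rewrite mxE. Qed.

Lemma vertical0 : vertical 0 = 0.
Proof. by rewrite /vertical col_mx0. Qed.

Lemma slice_vec_at_o0 : slice_vec o0 = 0.
Proof.
rewrite /slice_vec dsubmx_o0 vertical0 add0r Omega_antisym.
by rewrite -[0](scale0r o0) OmegaZl mul0r oppr0 scale0r.
Qed.

Lemma slice_vec_linear : linear slice_vec.
Proof.
move=> r u v; rewrite /slice_vec.
have -> : vertical (dsubmx (r *: u + v)) = r *: vertical (dsubmx u) + vertical (dsubmx v).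
  by rewrite linearP/= /vertical scale_col_mx add_col_mx scaler0 addr0.
by rewrite OmegaDr OmegaZr scalerDl -scalerA scalerDr addrACA.
Qed.

Lemma derive_slice_vec z h : 'D_h slice_vec z = slice_vec h.
Proof.
pose dLM := GRing.isLinear.Build _ _ _ _ _ slice_vec_linear.
pose L : {linear E' -> E'} := HB.pack slice_vec dLM.
have di : differentiable (id : E' -> E') z by [].
have := derive_linmx L h di; rewrite derive_id.
by [].
Qed.

Lemma differentiable_slice_vec z : differentiable slice_vec z.
Proof. exact: (smooth_on_diff (smooth_slice_vec openT)). Qed.

Lemma slice_q_at_o0 : slice_q o0 = 0.
Proof. by rewrite /slice_q slice_vec_at_o0 -[0](scale0r o0) OmegaZl mul0r. Qed.

Lemma derive_slice_q h : 'D_h slice_q o0 = 0.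
Proof.
have dv := differentiable_slice_vec o0.
have dAv : differentiable (fun z => A *m slice_vec z) o0.
  exact: (differentiable_linmx (mulmx A) dv).
rewrite derive_Omega// (derive_linmx (mulmx A) h dv)/= slice_vec_at_o0 mulmx0.
by rewrite -[0](scale0r o0) OmegaZl OmegaZr !mul0r addr0.
Qed.

Lemma slice_dom_o0 : slice_dom o0.
Proof. by rewrite /slice_dom/= slice_q_at_o0 addr0 oner_eq0. Qed.

Lemma slice_at_o0 : slice o0 = o0.
Proof.
by rewrite /slice slice_q_at_o0 slice_vec_at_o0 addr0 subr0 invr1 !scale1r scaler0 addr0.
Qed.

Lemma derive_slice h : 'D_h slice o0 = 2 *: slice_vec h.
Proof.
have dv := differentiable_slice_vec o0.
have dq : differentiable slice_q o0 by exact: (smooth_on_diff (smooth_slice_q openT)).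
have dc (c : R) : differentiable (fun=> c : R) o0 by exact: differentiable_cst.
have dce (c : E') : differentiable (fun=> c : E') o0 by exact: differentiable_cst.
have d1 : differentiable (fun z => 1 + slice_q z) o0 by exact: differentiableD.
have D1 : 'D_h (fun z => 1 + slice_q z) o0 = 0.
  rewrite deriveD ?derive_cst ?derive_slice_q ?addr0//; exact: diff_derivable.
have d2 : differentiable (fun z => 1 - slice_q z) o0 by exact: differentiableB.
have D2 : 'D_h (fun z => 1 - slice_q z) o0 = 0.
  rewrite deriveB ?derive_cst ?derive_slice_q ?subr0//; exact: diff_derivable.
have n1 : 1 + slice_q o0 != 0 by exact: slice_dom_o0.
have [di Di] := derive_inv h n1 d1.
have da : differentiable (fun z => (1 - slice_q z) *: o0) o0.
  by have [] := is_diff_bilin (@scale_fun_continuous R E') d2 (dce o0).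
have db : differentiable (fun z => (2 : R) *: slice_vec z) o0.
  by have [] := is_diff_bilin (@scale_fun_continuous R E') (dc 2) dv.
rewrite /slice (derive_scale (k := fun z => (1 + slice_q z)^-1)
  (f := fun z => (1 - slice_q z) *: o0 + 2 *: slice_vec z)) //; last exact: differentiableD.
rewrite Di D1 mulr0 oppr0 scale0r add0r slice_q_at_o0 addr0 invr1 scale1r.
rewrite (deriveD (f := fun z => (1 - slice_q z) *: o0) (g := fun z => 2 *: slice_vec z)); last 2 first.
- exact: diff_derivable.
- exact: diff_derivable.
rewrite (derive_scale h d2 (dce o0)) (derive_scale h (dc 2) dv).
by rewrite D2 scale0r derive_cst scaler0 !add0r derive_cst scale0r add0r derive_slice_vec.
Qed.

Lemma derive_flow_slice h :
  'D_h flow_slice o0 = h ix0 0 *: o0 - h ix1 0 *: (A *m o0) + 2 *: slice_vec h.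
Proof.
have di : differentiable (id : E' -> E') o0 by [].
have dco i : differentiable (fun z : E' => z i 0) o0 by exact: differentiable_coord.
have Dco i : 'D_h (fun z : E' => z i 0) o0 = h i 0.
  by rewrite (derive_linmx (@coord_mx R _ _ i 0) h di) derive_id.
have dn : differentiable (fun z : E' => - z ix1 0) o0.
  exact: (@differentiableN _ _ _ (fun z : E' => z ix1 0)).
have Dn : 'D_h (fun z : E' => - z ix1 0) o0 = - h ix1 0.
  by rewrite (deriveN (f := fun z : E' => z ix1 0)) ?Dco//; exact: diff_derivable.
have dx : differentiable (fun z : E' => expmx (- z ix1 0 *: A)) o0.
  by apply: (@differentiable_comp _ _ _ _ (fun z : E' => - z ix1 0) (fun s => expmx (s *: A))) => //; exact: differentiable_expmx.
have ds : differentiable slice o0 by exact: smooth_on_diff smooth_slice slice_dom_o0.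
have dm : differentiable (fun z : E' => expmx (- z ix1 0 *: A) *m slice z) o0 by exact: differentiable_mulmx.
rewrite /flow_slice (derive_scale h (dco ix0) dm) Dco (derive_mulmx h dx ds).
rewrite (@derive_comp _ _ _ _ (fun z : E' => - z ix1 0) (fun s => expmx (s *: A)) _ _ dn (differentiable_expmx _ _)).
rewrite Dn derive_expmx o0_ix1 oppr0 expmx0 mulmx1 !mul1mx slice_at_o0 o0_ix0 scale1r.
by rewrite derive_slice -scalemxAl scaleNr addrA.
Qed.

(** Pairing the differential with [A *m o0] and with [o0] isolates the first two coordinates; the
    rest is [2 *: slice_vec h], whose last block is that of [h]. *)
Lemma flow_slice_immersion h : 'D_h flow_slice o0 = 0 -> h = 0.
Proof.
rewrite derive_flow_slice => H.
have eA1 : Omega' o0 (A *m o0) = 1 by exact: eA.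
have H0 : h ix0 0 = 0.
  have := congr1 (fun x => Omega' x (A *m o0)) H; rewrite !OmegaDl OmegaNl !OmegaZl.
  rewrite eA1 Omega_self slice_vec_Ao0 !mulr0 subr0 addr0 mulr1 => ->.
  by rewrite -[0](scale0r o0) OmegaZl mul0r.
have H1 : h ix1 0 = 0.
  have := congr1 (fun x => Omega' x o0) H; rewrite !OmegaDl OmegaNl !OmegaZl.
  rewrite Omega_self slice_vec_o0 (Omega_antisym (A *m o0) o0) eA1 !mulr0 add0r addr0 mulrN1 opprK => ->.
  by rewrite -[0](scale0r o0) OmegaZl mul0r.
move: H; rewrite H0 H1 !scale0r subr0 add0r => /eqP; rewrite scaler_eq0 pnatr_eq0/= => /eqP H.
have dv : dsubmx h = 0.
  have := congr1 dsubmx H; rewrite /slice_vec linearD/= linearZ/= dsubmx_o0 scaler0 addr0.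
  by rewrite /vertical col_mxKd linear0.
apply/matrixP => i j; rewrite ord1 [RHS]mxE; case: (splitP i) => k ik.
  have [k0|k1] := ord2_cases k.
    by rewrite (_ : i = ix0) //; apply: val_inj; rewrite /= ik k0.
  by rewrite (_ : i = ix1) //; apply: val_inj; rewrite /= ik k1.
rewrite (_ : i = rshift 2 k); last exact: val_inj.
by move/matrixP/(_ k 0) : dv; rewrite !mxE.
Qed.

Definition flow_coord (r t : R) (y : E) : E' :=
  col_mx (\col_(i < 2) (if i == 0 then r else t)) y.

Lemma flow_coordK0 r t y : flow_coord r t y ix0 0 = r.
Proof. by rewrite /flow_coord col_mxEu mxE. Qed.

Lemma flow_coordK1 r t y : flow_coord r t y ix1 0 = t.
Proof. by rewrite /flow_coord col_mxEu mxE. Qed.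

Lemma flow_coordKd r t y : dsubmx (flow_coord r t y) = y.
Proof. by rewrite /flow_coord col_mxKd. Qed.

Lemma flow_coord_surj (z : E') : flow_coord (z ix0 0) (z ix1 0) (dsubmx z) = z.
Proof.
rewrite /flow_coord -[RHS](vsubmxK z); congr col_mx; apply/matrixP => i j; rewrite ord1 !mxE.
by have [->|->] := ord2_cases i.
Qed.

Lemma smooth_flow_coord (U : set (E * R)) : open U ->
  smooth_on U (fun p => flow_coord 1 p.2 p.1).
Proof.
move=> oU; apply/(smooth_on_mxP _ oU) => i j; rewrite ord1 /flow_coord.
have s1 : smooth_on U (fun p : E * R => p.1).
  by apply: (@smooth_on_linear _ _ _ _ U _ fst) => //; [move=> p; exact: cvg_fst|exact: smooth_on_id].
have s2 : smooth_on U (fun p : E * R => p.2).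
  by apply: (@smooth_on_linear _ _ _ _ U _ snd) => //; [move=> p; exact: cvg_snd|exact: smooth_on_id].
case: (splitP i) => k ik.
  have -> : i = lshift (n + n) k by exact: val_inj.
  under eq_fun do rewrite col_mxEu mxE.
  by case: eqP => _ //; exact: smooth_on_cst.
have -> : i = rshift 2 k by exact: val_inj.
under eq_fun do rewrite col_mxEd.
exact: (smooth_on_linmx (@coord_mx R _ _ k 0)).
Qed.

Lemma eball_open (r : R) : open (@eball R (n + n) r).
Proof.
rewrite (_ : @eball R (n + n) r = (fun y : E => \sum_i y i 0 ^+ 2) @^-1` [set t | t < r ^+ 2]) //.
apply: open_comp; last exact: open_lt.
move=> y _; apply: differentiable_continuous.
have s : smooth_on setT (fun y : E => \sum_i y i 0 * y i 0).
  apply: smooth_on_sum => [|i _]; first exact: openT.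
  have si : smooth_on setT (fun y : E => y i 0).
    exact: (smooth_on_linmx (@coord_mx R _ _ i 0) openT (smooth_on_id openT)).
  by apply: smooth_onM => //; exact: openT.
by under eq_fun do under eq_bigr do rewrite expr2; exact: (smooth_on_diff s).
Qed.

Lemma eball_coord (r : R) (y : E) i : 0 < r -> eball r y -> `|y i 0| < r.
Proof.
move=> r0 yr; rewrite -(@ltr_pXn2r _ 2)// ?nnegrE// ?ltW// real_normK ?num_real//.
apply: le_lt_trans yr; rewrite (bigD1 i)//= lerDl; apply: sumr_ge0 => j _; exact: sqr_ge0.
Qed.

Lemma cylinder_open (r e : R) : open (@cylinder R (n + n) r e).
Proof.
rewrite (_ : cylinder r e = (fst @^-1` @eball R (n + n) r) `&` (snd @^-1` `]- e, e[%classic)).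
  apply: openI; (apply: open_comp; last by [exact: eball_open|exact: itv_open]).
    by move=> p _; exact: cvg_fst.
  by move=> p _; exact: cvg_snd.
by apply/seteqP; split=> -[y t] /=; rewrite in_itv.
Qed.

Lemma eball0 (r : R) : 0 < r -> @eball R (n + n) r 0.
Proof.
by move=> r0; rewrite /eball/= big1 ?exprn_gt0// => i _; rewrite mxE expr0n.
Qed.

(** [chi] is [flow_slice] restricted to first coordinate [1], and [chi_inv] forgets that coordinate
    in the local inverse of [flow_slice]. *)
Theorem local_reduction_exists : inhabited (local_reduction A o0).
Proof.
have [Ob [g [oO Oo0 OU fopen [sg gK]]]] :=
  inverse_function slice_dom_open smooth_flow_slice slice_dom_o0 flow_slice_immersion.
have /nbhs_ballP[d' /= d'0 dO] : nbhs o0 Ob by exact: open_nbhs_nbhs.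
(* Halving gives both [d < d'] and [d < 1]; the second keeps the first coordinate away from [-1],
   the other root of the equation of [Sigma A]. *)
pose d := Num.min d' 1 / 2.
have d0 : 0 < d by rewrite divr_gt0// lt_min d'0 ltr01.
have q0 : 0 < Num.min d' 1 by rewrite lt_min d'0 ltr01.
have dd' : d < d'.
  apply: (@lt_le_trans _ _ (Num.min d' 1)); last by rewrite ge_min lexx.
  by rewrite /d ltr_pdivrMr// ltr_pMr// ltr1n.
have d1 : d < 1.
  apply: (@lt_le_trans _ _ (Num.min d' 1)); last by rewrite ge_min lexx orbT.
  by rewrite /d ltr_pdivrMr// ltr_pMr// ltr1n.
pose box : set E' := [set z : E' | `|z ix0 0 - 1| < d /\ cylinder d d (dsubmx z, z ix1 0)].
have boxO : box `<=` Ob.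
  move=> z [z0 [/= zy /andP[t1 t2]]]; apply: dO; rewrite -ball_normE /ball_/=.
  apply: le_lt_trans dd'; apply: mx_norm_le => [|i j]; first exact: ltW.
  rewrite ord1 !mxE; case: (splitP i) => k ik.
    have [k0|k1] := ord2_cases k.
      have -> : i = ix0 by apply: val_inj; rewrite /= ik k0.
      by rewrite !eqxx distrC ltW.
    have -> : i = ix1 by apply: val_inj; rewrite /= ik k1.
    by rewrite /= sub0r normrN ler_norml; apply/andP; split; exact: ltW.
  have iE : i = rshift 2 k by exact: val_inj.
  rewrite iE /= sub0r normrN ltW//; have := eball_coord k d0 zy; by rewrite mxE.
have obox : open box.
  have cc i : continuous (fun z : E' => z i 0) by exact: coord_continuous.
  rewrite (_ : box = ((fun z : E' => `|z ix0 0 - 1|) @^-1` [set t | t < d]) `&`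
     ((fun z : E' => (dsubmx z, z ix1 0)) @^-1` cylinder d d)) //.
  apply: openI; apply: open_comp.
  - move=> z _; apply: (@continuous_comp _ _ _ (fun z : E' => z ix0 0 - 1)); last exact: norm_continuous.
    by apply: continuousB; [exact: cc|exact: cst_continuous].
  - exact: open_lt.
  - move=> z _; apply: differentiable_continuous; apply: differentiable_pair.
      have di : differentiable (id : E' -> E') z by [].
      exact: (differentiable_linmx (@dsubmx R 2 (n + n) 1) di).
    exact: differentiable_coord.
  - exact: cylinder_open.
pose chi (p : E * R) := flow_slice (flow_coord 1 p.2 p.1).
pose chi_inv (x : E') : E * R := (dsubmx (g x), g x ix1 0).
have boxc p : cylinder d d p -> box (flow_coord 1 p.2 p.1).
  by case: p => y t c; rewrite /box/= flow_coordK0 flow_coordK1 flow_coordKd subrr normr0.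
pose NA := flow_slice @` box.
have oNA : open NA by exact: fopen.
have NAO : NA `<=` flow_slice @` Ob by move=> _ [z bz <-]; exists z => //; exact: boxO.
have o_cyl : open (@cylinder R (n + n) d d) by exact: cylinder_open.
constructor; refine (@LocalReduction R n A o0 d d NA chi chi_inv d0 d0 oNA _ _ _ _ _ _).
- apply: (smooth_on_comp (U' := slice_dom) (finite_frame_mx _ _) o_cyl _ _ smooth_flow_slice).
    by move=> p /boxc /boxO /OU.
  exact: smooth_flow_coord.
- have sgN := smooth_on_sub NAO sg.
  apply: smooth_on_pair => //; first exact: (smooth_on_linmx (@dsubmx R 2 (n + n) 1) oNA sgN).
  exact: (smooth_on_linmx (@coord_mx R _ _ ix1 0) oNA sgN).
- apply/seteqP; split.
    move=> _ [p cp <-]; have bp := boxc p cp; split; first by exists (flow_coord 1 p.2 p.1).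
    rewrite /Sigma/= flow_slice_Sigma ?flow_coordK0 ?expr1n//.
    exact/OU/boxO.
  move=> _ [[z bz <-]]; rewrite /Sigma/= flow_slice_Sigma; last exact/OU/boxO.
  move=> /eqP; rewrite sqrf_eq1 => z1.
  have {}z1 : z ix0 0 = 1.
    move/orP: z1 => [/eqP//|/eqP zN]; move: bz => [+ _]; rewrite zN.
    by rewrite -opprD normrN ger0_norm//; lra.
  exists (dsubmx z, z ix1 0); first by case: bz.
  by rewrite /chi/= -z1 flow_coord_surj.
- move=> [y t] c; rewrite /chi_inv /chi gK; last exact/boxO/boxc.
  by rewrite /= flow_coordK1 flow_coordKd.
- rewrite /chi/= (_ : flow_coord 1 0 0 = o0).
    by rewrite /flow_slice o0_ix0 o0_ix1 oppr0 expmx0 mul1mx slice_at_o0 scale1r.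
  by rewrite -[RHS]flow_coord_surj o0_ix0 o0_ix1 dsubmx_o0.
- move=> y t _; rewrite /chi/= /flow_slice !flow_coordK0 !flow_coordK1 !scale1r.
  rewrite oppr0 expmx0 mul1mx; congr (_ *m _).
  by rewrite /slice /slice_q /slice_vec !flow_coordKd.
Qed.

End LocalReductionExists.

(** * Curvature identities of Ricci-type connections *)

Section Contraction.
Context {R : realType} {m : nat} (W : 'M[R]_m).
Hypotheses (WT : W^T = - W) (Wu : W \in unitmx).
Local Notation E := 'cV[R]_m.

Definition bform (a b : E) : R := (a^T *m W *m b) 0 0.
Local Notation om := bform.

Lemma bformDl a b d : om (a + b) d = om a d + om b d.
Proof. by rewrite /bform linearD/= !mulmxDl mxE. Qed.
Lemma bformDr a b d : om d (a + b) = om d a + om d b.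
Proof. by rewrite /bform mulmxDr mxE. Qed.
Lemma bformZl r a b : om (r *: a) b = r * om a b.
Proof. by rewrite /bform linearZ/= -!scalemxAl mxE. Qed.
Lemma bformZr r a b : om a (r *: b) = r * om a b.
Proof. by rewrite /bform -scalemxAr mxE. Qed.
Lemma bformNl a b : om (- a) b = - om a b.
Proof. by rewrite -scaleN1r bformZl mulN1r. Qed.
Lemma bform0l a : om 0 a = 0.
Proof. by rewrite -[0](scale0r 0) bformZl mul0r. Qed.
Lemma bform0r a : om a 0 = 0.
Proof. by rewrite -[X in om a X](scale0r (0 : E)) bformZr mul0r. Qed.

Lemma bform_antisym a b : om a b = - om b a.
Proof.
rewrite /bform -[in LHS](trmxK (a^T *m W *m b)) mxE !trmx_mul trmxK WT.
by rewrite mulNmx mulmxN mxE mulmxA.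
Qed.

Lemma bform_nondeg a : (forall b, om b a = 0) -> a = 0.
Proof.
move=> H; have Wa : W *m a = 0.
  apply/matrixP => i j; rewrite ord1 [RHS]mxE.
  have := H (delta_mx i 0); rewrite /bform -mulmxA trmx_delta -rowE.
  by rewrite mxE.
by rewrite -(mulKmx Wu a) Wa mulmx0.
Qed.

Lemma bform_inj a b : (forall d, om a d = om b d) -> a = b.
Proof.
move=> H; apply/eqP; rewrite -subr_eq0; apply/eqP; apply: bform_nondeg => d.
by rewrite bform_antisym bformDl bformNl H subrr oppr0.
Qed.

Lemma bform_delta i j : om (delta_mx i 0) (delta_mx j 0) = W i j.
Proof. by rewrite /bform trmx_delta -rowE -colE !mxE. Qed.

Lemma bform_deltal i a : om (delta_mx i 0) a = (W *m a) i 0.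
Proof. by rewrite /bform -mulmxA trmx_delta -rowE mxE. Qed.

(** Contraction with the Poisson tensor [W^-1]. In this index order the form itself contracts to
    [- m], and a factor [om z X] substitutes [X] for [y]. *)
Definition contr (F : E -> E -> R) : R :=
  \sum_i \sum_j invmx W i j * F (delta_mx i 0) (delta_mx j 0).

Lemma contrD F G : contr (fun y z => F y z + G y z) = contr F + contr G.
Proof.
rewrite /contr -big_split/=; apply: eq_bigr => i _; rewrite -big_split/=.
by apply: eq_bigr => j _; rewrite mulrDr.
Qed.

Lemma contrZ r F : contr (fun y z => r * F y z) = r * contr F.
Proof.
rewrite /contr mulr_sumr; apply: eq_bigr => i _; rewrite mulr_sumr.
by apply: eq_bigr => j _; rewrite mulrCA.
Qed.

Lemma eq_contr F G : (forall y z, F y z = G y z) -> contr F = contr G.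
Proof. by move=> FG; apply: eq_bigr => i _; apply: eq_bigr => j _; rewrite FG. Qed.

Lemma contr0 : contr (fun _ _ => 0) = 0.
Proof. by rewrite /contr big1// => i _; rewrite big1// => j _; rewrite mulr0. Qed.

Lemma invmx_antisym : (invmx W)^T = - invmx W.
Proof.
have Nu : - W \in unitmx by rewrite -WT unitmx_tr.
rewrite trmx_inv WT -[LHS]mulmx1 -(mulmxV Wu) mulmxA.
by rewrite -[X in _ *m X *m _]opprK mulmxN mulVmx// mulNmx mul1mx.
Qed.

Lemma contr_swap F : contr (fun y z => F z y) = - contr F.
Proof.
rewrite /contr exchange_big -sumrN; apply: eq_bigr => i _; rewrite -sumrN.
apply: eq_bigr => j _; rewrite -mulNr; congr (_ * _).
by move/matrixP/(_ i j) : invmx_antisym; rewrite !mxE.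
Qed.

Lemma contr_form : contr om = - m%:R.
Proof.
rewrite -[m%:R](mxtrace1 R m) -(mulVmx Wu) /mxtrace -sumrN; apply: eq_bigr => i _.
rewrite mxE -sumrN; apply: eq_bigr => j _; rewrite bform_delta -mulrN; congr (_ * _).
by move/matrixP/(_ j i) : WT; rewrite !mxE.
Qed.

Definition lin1 (f : E -> R) := forall r u v, f (r *: u + v) = r * f u + f v.

Lemma lin1_sum f a : lin1 f -> f a = \sum_i a i 0 * f (delta_mx i 0).
Proof.
move=> fl; have f0 : f 0 = 0.
  by have := fl (-1) 0 0; rewrite scaler0 addr0 mulN1r addNr.
rewrite [in LHS](matrix_sum_delta a).
have -> : \sum_i \sum_(j < 1) a i j *: delta_mx i j = \sum_i a i 0 *: (delta_mx i 0 : E).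
  by apply: eq_bigr => i _; rewrite big_ord1.
have fD u v : f (u + v) = f u + f v by rewrite -[u in LHS]scale1r fl mul1r.
have fZ r u : f (r *: u) = r * f u by rewrite -[X in f X]addr0 fl f0 addr0.
by rewrite (big_morph f fD f0); apply: eq_bigr => i _; rewrite fZ.
Qed.

Lemma contr_formr X f : lin1 f -> contr (fun y z => om z X * f y) = f X.
Proof.
move=> fl; rewrite [RHS](lin1_sum X fl); apply: eq_bigr => i _.
have -> : X i 0 = \sum_j invmx W i j * om (delta_mx j 0) X.
  rewrite -[in LHS](mulKmx Wu X) mxE; apply: eq_bigr => j _.
  by rewrite bform_deltal.
by rewrite mulr_suml; apply: eq_bigr => j _; rewrite mulrA.
Qed.

Lemma contr_forml X f : lin1 f -> contr (fun y z => om y X * f z) = - f X.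
Proof. by move=> fl; rewrite (contr_swap (fun y z => om z X * f y)) contr_formr. Qed.

(** Contracting over [y] and [z] expresses [m c x h t] through the two other cyclic permutations and
    the contraction [ka]. Adding the three versions leaves [m - 2] times the cyclic sum, which
    therefore vanishes; substituting back turns [m] into [m + 1]. *)
Lemma bianchi_solution (c : E -> E -> E -> R) :
  (2 < m)%N ->
  (forall a b, lin1 (fun x => c x a b)) -> (forall a b, lin1 (fun x => c a x b)) ->
  (forall x a b, c x a b = c x b a) ->
  (forall x y z h t,
    - 2 * om y z * c x h t + om x h * (c y z t - c z y t) + (c y z h - c z y h) * om x t
    + (- 2 * om z x * c y h t + om y h * (c z x t - c x z t) + (c z x h - c x z h) * om y t)
    + (- 2 * om x y * c z h t + om z h * (c x y t - c y x t) + (c x y h - c y x h) * om z t) = 0) ->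
  forall x h t, c x h t =
    - (m%:R + 1)^-1 * (om x h * contr (fun y z => c y z t) + om x t * contr (fun y z => c y z h)).
Proof.
move=> m2 cl1 cl2 csym bianchi.
pose ka t := contr (fun y z => c y z t).
have E1 x h t : m%:R * c x h t = c h x t + c t x h - om x h * ka t - om x t * ka h.
  have H : contr (fun y z =>
    - 2 * om y z * c x h t + om x h * (c y z t - c z y t) + (c y z h - c z y h) * om x t
    + (- 2 * om z x * c y h t + om y h * (c z x t - c x z t) + (c z x h - c x z h) * om y t)
    + (- 2 * om x y * c z h t + om z h * (c x y t - c y x t) + (c x y h - c y x h) * om z t)) = 0.
    by rewrite -contr0; apply: eq_contr => y z; exact: bianchi.
  have E : contr (fun y z => (- 2 * c x h t) * om y z + om x h * c y z t + (- om x h) * c z y t +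
     om x t * c y z h + (- om x t) * c z y h + (- 2) * (om z x * c y h t) +
     om y h * c z x t + (- 1) * (om y h * c x z t) + om y t * c z x h + (- 1) * (om y t * c x z h) +
     2 * (om y x * c z h t) + om z h * c x y t + (- 1) * (om z h * c y x t) +
     om z t * c x y h + (- 1) * (om z t * c y x h)) = 0.
    rewrite -[RHS]H; apply: eq_contr => y z; rewrite (bform_antisym x y); ring.
  move: E; rewrite !contrD !contrZ contr_form.
  rewrite !(contr_swap (fun y z => c y z _)).
  rewrite !(contr_formr _ (cl1 _ _)) !(contr_formr _ (cl2 _ _)).
  rewrite !(contr_forml _ (cl1 _ _)) !(contr_forml _ (cl2 _ _)).
  rewrite -/(ka t) -/(ka h) (csym x t h); lra.
move=> x h t; rewrite -/(ka t) -/(ka h).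
have m2' : (2 : R) < m%:R by rewrite ltr_nat.
have s0 : c x h t + c h x t + c t x h = 0.
  have A1 := E1 x h t; have A2 := E1 h t x; have A3 := E1 t x h.
  rewrite (csym h t x) (csym x t h) (csym t h x) in A2 A3 A1.
  rewrite (bform_antisym h x) (bform_antisym t x) (bform_antisym t h) in A1 A2 A3.
  have : (m%:R - 2) * (c x h t + c h x t + c t x h) = 0 by lra.
  by move=> /eqP; rewrite mulf_eq0 subr_eq0 gt_eqF//= => /eqP.
have m1 : m%:R + 1 != 0 :> R by rewrite gt_eqF//; lra.
have A := E1 x h t.
apply: (mulfI m1); rewrite mulrA mulrN mulfV// mulN1r.
rewrite mulrDl mul1r A; lra.
Qed.

(** Contraction over [x] and [b]: the two mixed terms cancel, leaving [m nu y a] against [contr nu]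
    times the form. *)
Lemma curvature_commutator_solution (nu : E -> E -> R) : (0 < m)%N ->
  (forall a, lin1 (fun x => nu x a)) -> (forall a, lin1 (nu a)) ->
  (forall x y a b, nu y a * om x b + nu y b * om x a - nu x a * om y b - nu x b * om y a = 0) ->
  forall y a, nu y a = - (contr nu / m%:R) * om y a.
Proof.
move=> m0 l1 l2 H y a.
have E : contr (fun x b => nu y a * om x b + om x a * nu y b + om b y * nu x a + (- om y a) * nu x b) = 0.
  rewrite -contr0; apply: eq_contr => x b; rewrite (bform_antisym b y) -[RHS](H x y a b); ring.
move: E; rewrite !contrD !contrZ contr_form (contr_forml _ (l2 _)) (contr_formr _ (l1 _)) => E.
have m0' : m%:R != 0 :> R by rewrite pnatr_eq0 -lt0n.
apply: (mulfI m0'); have -> : m%:R * (- (contr nu / m%:R) * om y a) = - contr nu * om y a.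
  by field; exact: m0'.
lra.
Qed.

(** Contraction over [y] and [a] gives [(1 - m) psi x = 0]. *)
Lemma proportional_forms_zero (psi : E -> R) : (1 < m)%N -> lin1 psi ->
  (forall x y a, psi x * om y a = psi y * om x a) -> forall x, psi x = 0.
Proof.
move=> m1 l H x.
have E : contr (fun y a => psi x * om y a + om a x * psi y) = 0.
  by rewrite -contr0; apply: eq_contr => y a; rewrite H (bform_antisym a x); ring.
move: E; rewrite !contrD !contrZ contr_form (contr_formr _ l) => E.
have m1' : 1 - m%:R != 0 :> R by rewrite subr_eq0 lt_eqF// ltr1n.
apply: (mulfI m1'); rewrite mulr0; lra.
Qed.

End Contraction.

(** * Directional derivatives together with their values *)

Section HasDerivative.
Context {R : realType} {V : normedModType R}.

(** Differentiability is bundled with the value of one directional derivative, so that sum, product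
    and chain rules compose as terms without side conditions. *)
Definition has_der (W : normedModType R) (f : V -> W) (x v : V) (d : W) :=
  differentiable f x /\ 'D_v f x = d.

Lemma has_der_cst (W : normedModType R) (c : W) x v : has_der (fun=> c) x v 0.
Proof. by split; [exact: differentiable_cst|exact: derive_cst]. Qed.

Lemma has_derD (W : normedModType R) (f g : V -> W) x v a b :
  has_der f x v a -> has_der g x v b -> has_der (fun y => f y + g y) x v (a + b).
Proof.
move=> [df <-] [dg <-]; split; first exact: differentiableD.
by rewrite deriveD//; exact: diff_derivable.
Qed.

Lemma has_derN (W : normedModType R) (f : V -> W) x v a :
  has_der f x v a -> has_der (fun y => - f y) x v (- a).
Proof.
move=> [df <-]; split; first exact: differentiableN.
by rewrite deriveN//; exact: diff_derivable.
Qed.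

Lemma has_derB (W : normedModType R) (f g : V -> W) x v a b :
  has_der f x v a -> has_der g x v b -> has_der (fun y => f y - g y) x v (a - b).
Proof. by move=> hf hg; apply: has_derD => //; exact: has_derN. Qed.

Lemma has_der_mul (f g : V -> R) x v a b :
  has_der f x v a -> has_der g x v b ->
  has_der (fun y => f y * g y) x v (a * g x + f x * b).
Proof.
move=> [df <-] [dg <-].
by have [d /(_ v)] := is_diff_bilin mulr_continuous2 df dg.
Qed.

Lemma has_der_scale (W : normedModType R) (f : V -> R) (g : V -> W) x v a b :
  has_der f x v a -> has_der g x v b ->
  has_der (fun y => f y *: g y) x v (a *: g x + f x *: b).
Proof.
move=> [df <-] [dg <-].
by have [d /(_ v)] := is_diff_bilin (@scale_fun_continuous R W) df dg.
Qed.

Lemma has_der_mulmx m n p (f : V -> 'M[R]_(m, n)) (g : V -> 'M[R]_(n, p)) x v a b :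
  has_der f x v a -> has_der g x v b ->
  has_der (fun y => f y *m g y) x v (a *m g x + f x *m b).
Proof.
move=> [df <-] [dg <-].
by have [d /(_ v)] := is_diff_bilin (@mulmx_continuous2 R m n p) df dg.
Qed.

Lemma has_der_linmx (W : normedModType R) m n (f : V -> 'M[R]_(m, n))
    (L : {linear 'M[R]_(m, n) -> W}) x v a :
  has_der f x v a -> has_der (fun y => L (f y)) x v (L a).
Proof.
by move=> [df <-]; split; [exact: differentiable_linmx|exact: derive_linmx].
Qed.

Lemma has_der_smooth (W : normedModType R) (U : set V) (f : V -> W) x v :
  smooth_on U f -> U x -> has_der f x v ('D_v f x).
Proof. by move=> sf Ux; split=> //; exact: smooth_on_diff Ux. Qed.

Lemma has_der_eq (W : normedModType R) (f : V -> W) x v a b :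
  has_der f x v a -> a = b -> has_der f x v b.
Proof. by move=> [df <-] <-. Qed.

Lemma has_der_near (W : normedModType R) (U : set V) (f g : V -> W) x v a :
  open U -> U x -> (forall y, U y -> f y = g y) -> has_der f x v a -> has_der g x v a.
Proof.
move=> oU Ux fg [df <-].
have nfg : {near x, f =1 g} by apply: filterS fg _; exact: open_nbhs_nbhs.
split; first exact: (near_eq_differentiable nfg).
by apply/esym; exact: near_eq_derive.
Qed.

Lemma has_der_unique (W : normedModType R) (f : V -> W) x v a b :
  has_der f x v a -> has_der f x v b -> a = b.
Proof. by move=> [_ <-] [_ <-]. Qed.

End HasDerivative.

(** The algebra behind the second Bianchi identity: [a], [b], [c] are Christoffel matrices, [ab] the
    derivative of [b] in the direction of [a], and [p], [q], [r] second derivatives, primed when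
    taken in the other order. *)
Lemma bianchi_identity (R : realType) m (a b c ab ac ba bc ca cb p q r p' q' r' : 'M[R]_m) :
  p' = p -> q' = q -> r' = r ->
  (p - q + (ab *m c + b *m ac - (ac *m b + c *m ab)))
  + a *m (bc - cb + (b *m c - c *m b)) - (bc - cb + (b *m c - c *m b)) *m a
  + ((r - p' + (bc *m a + c *m ba - (ba *m c + a *m bc)))
  + b *m (ca - ac + (c *m a - a *m c)) - (ca - ac + (c *m a - a *m c)) *m b)
  + ((q' - r' + (ca *m b + a *m cb - (cb *m a + b *m ca)))
  + c *m (ab - ba + (a *m b - b *m a)) - (ab - ba + (a *m b - b *m a)) *m c) = 0.
Proof.
move=> -> -> ->; rewrite !(mulmxDl, mulmxDr, mulmxN, mulNmx) !mulmxA.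
do ?[match goal with |- context [@mulmx ?K ?k ?l ?n ?x ?y] =>
  move: (@mulmx K k l n x y) => ? end].
by apply/matrixP => i j; rewrite !mxE; ring.
Qed.

(** * The second Bianchi identity in a chart *)

Section RicciTypeGeometry.
Context {R : realType} {m : nat} (V : set 'cV[R]_m).
Local Notation E := 'cV[R]_m.
Variables (Gm : E -> E -> 'M[R]_m) (W B : E -> 'M[R]_m).

Definition om x := bform (W x).
Definition bet x (a b : E) := om x (B x *m a) b.
Definition curv (u v x : E) : 'M[R]_m :=
  'D_u (Gm v) x - 'D_v (Gm u) x + (Gm u x *m Gm v x - Gm v x *m Gm u x).
(** The Ricci-type curvature lowered by [om]; the factor [1/(2n+2)] and a sign are absorbed into
    [B]. *)
Definition kform x (y z h t : E) : R :=
  - 2 * om x y z * bet x h t - om x y h * bet x z t + om x z h * bet x y t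
  + bet x y h * om x z t - bet x z h * om x y t.

(** The local geometry in matrix form: [Gm u] holds the Christoffel symbols in the direction [u],
    [W] is the Gram matrix of the form, [B] the rescaled Ricci endomorphism. The potentials and the
    tractor connection are derived from these fields. *)
Record ricci_type_data : Prop := RicciTypeData {
  rt_open : open V;
  rt_G : forall u, smooth_on V (Gm u);
  rt_Glin : forall x, V x -> forall r u v, Gm (r *: u + v) x = r *: Gm u x + Gm v x;
  rt_torsion : forall x, V x -> forall u v, Gm u x *m v = Gm v x *m u;
  rt_W : smooth_on V W;
  rt_Wanti : forall x, V x -> (W x)^T = - W x;
  rt_Wunit : forall x, V x -> W x \in unitmx;
  rt_DW : forall x, V x -> forall u, 'D_u W x = (Gm u x)^T *m W x + W x *m Gm u x;
  rt_B : smooth_on V B;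
  rt_Bsp : forall x, V x -> forall a b, om x (B x *m a) b = - om x a (B x *m b);
  rt_curv : forall x, V x -> forall u v h t, om x (curv u v x *m h) t = kform x u v h t }.

Hypothesis D : ricci_type_data.
Hypothesis m2 : (2 < m)%N.

(** As the form is parallel, differentiating it amounts to differentiating its arguments
    covariantly. *)
Lemma has_der_om (a b : E -> E) x v da db : V x ->
  has_der a x v da -> has_der b x v db ->
  has_der (fun z => om z (a z) (b z)) x v
    (om x (da + Gm v x *m a x) (b x) + om x (a x) (db + Gm v x *m b x)).
Proof.
move=> Vx ha hb; have hW := has_der_smooth v (rt_W D) Vx; rewrite (rt_DW D Vx) in hW.
have haT : has_der (fun y => (a y)^T) x v da^T := has_der_linmx (@trmx R m 1) ha.
have := has_der_linmx (@coord_mx R 1 1 0 0) (has_der_mulmx haT (has_der_mulmx hW hb)).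
move=> /has_der_eq H; apply: (has_der_near openT I _ (H _ _)) => [y _|].
  by rewrite /coord_mx /om /bform mulmxA.
rewrite /= /coord_mx /om /bform.
have -> : (da + Gm v x *m a x)^T = da^T + (a x)^T *m (Gm v x)^T.
  by rewrite linearD/= trmx_mul.
rewrite !(mulmxDl, mulmxDr) !mulmxA.
have E (p q r s : 'M[R]_1) : (p + (q + r + s)) 0 0 = (p + q) 0 0 + (s + r) 0 0.
  by rewrite !mxE; ring.
exact: E.
Qed.

Lemma omDl x a b c : om x (a + b) c = om x a c + om x b c. Proof. exact: bformDl. Qed.
Lemma omDr x a b c : om x c (a + b) = om x c a + om x c b. Proof. exact: bformDr. Qed.
Lemma omNl x a c : om x (- a) c = - om x a c. Proof. exact: bformNl. Qed.
Lemma omZl x r a c : om x (r *: a) c = r * om x a c. Proof. exact: bformZl. Qed.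
Lemma omZr x r a c : om x c (r *: a) = r * om x c a. Proof. exact: bformZr. Qed.
Lemma om0l x c : om x 0 c = 0. Proof. exact: bform0l. Qed.

Definition cvB X x := 'D_X B x + Gm X x *m B x - B x *m Gm X x.
Definition cB x X a b := om x (cvB X x *m a) b.

Lemma has_der_bet (a b : E -> E) x v da db : V x ->
  has_der a x v da -> has_der b x v db ->
  has_der (fun z => bet z (a z) (b z)) x v
    (cB x v (a x) (b x) + bet x (da + Gm v x *m a x) (b x) + bet x (a x) (db + Gm v x *m b x)).
Proof.
move=> Vx ha hb; have hB := has_der_smooth v (rt_B D) Vx.
apply: (has_der_eq (has_der_om Vx (has_der_mulmx hB ha) hb)).
rewrite /bet /cB; congr (_ + _); rewrite /om -bformDl; congr (bform _ _ _).
rewrite /cvB mulmxBl !mulmxDl mulmxDr !mulmxA.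
have E' (p q r s : E) : p + q + r = p + r - s + (q + s).
  by rewrite [q + s]addrC addrA subrK addrAC.
exact: E'.
Qed.

Lemma om_anti x a b : V x -> om x a b = - om x b a.
Proof. by move=> Vx; exact: (bform_antisym (rt_Wanti D Vx)). Qed.

Lemma bet_sym x a b : V x -> bet x a b = bet x b a.
Proof. by move=> Vx; rewrite /bet (rt_Bsp D Vx) -om_anti. Qed.

Lemma cB_sym x X a b : V x -> cB x X a b = cB x X b a.
Proof.
move=> Vx; have h1 := has_der_bet Vx (has_der_cst a x X) (has_der_cst b x X).
have h2 := has_der_bet Vx (has_der_cst b x X) (has_der_cst a x X).
have h3 := has_der_near (rt_open D) Vx (fun y Vy => bet_sym b a Vy) h2.
have := has_der_unique h1 h3; rewrite !add0r.
rewrite [bet x (_ *m b) a]bet_sym// [bet x b _]bet_sym//.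
lra.
Qed.

Lemma cvB_linear x r u v : V x -> cvB (r *: u + v) x = r *: cvB u x + cvB v x.
Proof.
move=> Vx; have dB := smooth_on_diff (rt_B D) Vx.
rewrite /cvB derive_linear// (rt_Glin D Vx) mulmxDl mulmxDr -scalemxAl -scalemxAr.
rewrite scalerBr scalerDr.
move: ('D_u _ x) ('D_v _ x) (_ *m _) (_ *m _) (_ *m _) (_ *m _) => p1 p2 p3 p4 p5 p6.
by apply/matrixP => i j; rewrite !mxE; ring.
Qed.

Lemma cB_lin1 x a b : V x -> lin1 (fun X => cB x X a b).
Proof.
move=> Vx r u v; rewrite /cB cvB_linear// mulmxDl -scalemxAl.
by rewrite /om bformDl bformZl.
Qed.

Lemma cB_lin2 x X b : lin1 (fun a => cB x X a b).
Proof.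
by move=> r u v; rewrite /cB mulmxDr -scalemxAr /om bformDl bformZl.
Qed.

(** Only the endomorphism part is differentiated covariantly, [y] and [z] being constant fields; the
    terms correcting these two arguments reappear in [om_cvcurv]. *)
Definition cvcurv x y z p := 'D_x (curv y z) p + Gm x p *m curv y z p - curv y z p *m Gm x p.

Lemma smooth_curv y z : smooth_on V (curv y z).
Proof.
have oV := rt_open D; have sG := rt_G D.
apply: smooth_onD => //; first by apply: smooth_onB => //; exact: smooth_on_derive.
by apply: smooth_onB => //; exact: smooth_on_mulmx.
Qed.

Lemma second_bianchi p x y z : V p -> cvcurv x y z p + cvcurv y z x p + cvcurv z x y p = 0.
Proof.
move=> Vp; have oV := rt_open D; have sG := rt_G D.
have DC a b c : 'D_a (curv b c) p = 'D_a ('D_b (Gm c)) p - 'D_a ('D_c (Gm b)) p +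
   (('D_a (Gm b) p *m Gm c p + Gm b p *m 'D_a (Gm c) p) -
    ('D_a (Gm c) p *m Gm b p + Gm c p *m 'D_a (Gm b) p)).
  have h c' := has_der_smooth a (sG c') Vp.
  have hh b' c' := has_der_smooth a (smooth_on_derive b' (sG c')) Vp.
  by have [_] := has_derD (has_derB (hh b c) (hh c b))
    (has_derB (has_der_mulmx (h b) (h c)) (has_der_mulmx (h c) (h b))).
have S1 := schwarz x y oV (sG z) Vp; have S2 := schwarz x z oV (sG y) Vp.
have S3 := schwarz y z oV (sG x) Vp.
rewrite /cvcurv (DC x y z) (DC y z x) (DC z x y).
exact: (bianchi_identity _ _ _ _ _ _ _ _ _ S1 S2 S3).
Qed.

Definition ckform p x y z h t := - 2 * om p y z * cB p x h t - om p y h * cB p x z t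
  + om p z h * cB p x y t + cB p x y h * om p z t - cB p x z h * om p y t.

Lemma has_der_kform p x y z h t : V p ->
  has_der (fun q => kform q y z h t) p x
    (ckform p x y z h t + kform p (Gm x p *m y) z h t + kform p y (Gm x p *m z) h t
     + kform p y z (Gm x p *m h) t + kform p y z h (Gm x p *m t)).
Proof.
move=> Vp; rewrite /kform.
have ho a b := has_der_om Vp (has_der_cst a p x) (has_der_cst b p x).
have hb a b := has_der_bet Vp (has_der_cst a p x) (has_der_cst b p x).
apply: (has_der_eq (has_derB (has_derD (has_derD (has_derB
  (has_der_mul (has_der_mul (has_der_cst (- 2 : R) p x) (ho y z)) (hb h t))
  (has_der_mul (ho y h) (hb z t))) (has_der_mul (ho z h) (hb y t)))
  (has_der_mul (hb y h) (ho z t))) (has_der_mul (hb z h) (ho y t)))).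
rewrite !add0r /ckform; ring.
Qed.

Lemma om_cvcurv p x y z h t : V p -> om p (cvcurv x y z p *m h) t =
  ckform p x y z h t + kform p (Gm x p *m y) z h t + kform p y (Gm x p *m z) h t.
Proof.
move=> Vp; have hK := has_der_smooth x (smooth_curv y z) Vp.
have h1 := has_der_om Vp (has_der_mulmx hK (has_der_cst h p x)) (has_der_cst t p x).
have h2 := has_der_near (rt_open D) Vp (fun q Vq => esym (rt_curv D Vq y z h t))
  (has_der_kform x y z h t Vp).
have := has_der_unique h1 h2; rewrite mulmx0 addr0 add0r (rt_curv D Vp) => E.
have -> : cvcurv x y z p *m h = ('D_x (curv y z) p *m h + Gm x p *m (curv y z p *m h))
    - curv y z p *m (Gm x p *m h) by rewrite /cvcurv mulmxBl mulmxDl -!mulmxA.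
rewrite omDl omNl (rt_curv D Vp).
by lra.
Qed.

Lemma kform_anti p y z h t : V p -> kform p z y h t = - kform p y z h t.
Proof. by move=> Vp; rewrite /kform (om_anti z y Vp); ring. Qed.

(** In the cyclic sum the surplus [kform] terms cancel in pairs, by the symmetry of the Christoffel
    symbols and the antisymmetry of the curvature in its first two arguments. *)
Lemma cB_bianchi p x y z h t : V p ->
  ckform p x y z h t + ckform p y z x h t + ckform p z x y h t = 0.
Proof.
move=> Vp.
have : om p ((cvcurv x y z p + cvcurv y z x p + cvcurv z x y p) *m h) t = 0.
  by rewrite second_bianchi// mul0mx om0l.
have -> : (cvcurv x y z p + cvcurv y z x p + cvcurv z x y p) *m h =
    cvcurv x y z p *m h + cvcurv y z x p *m h + cvcurv z x y p *m h.
  by move: (cvcurv _ _ _ _) (cvcurv _ _ _ _) (cvcurv _ _ _ _) => a b c; rewrite !mulmxDl.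
rewrite 2!omDl !om_cvcurv//.
rewrite (rt_torsion D Vp y x) (rt_torsion D Vp z x) (rt_torsion D Vp z y).
rewrite (kform_anti z (Gm x p *m y)%R h t Vp) (kform_anti x (Gm y p *m z) h t Vp).
rewrite (kform_anti y (Gm x p *m z) h t Vp).
lra.
Qed.

End RicciTypeGeometry.

(** * The potentials [uvec] and [phi] *)

Section RicciTypePotentials.
Context {R : realType} {m : nat} (V : set 'cV[R]_m).
Local Notation E := 'cV[R]_m.
Variables (Gm : E -> E -> 'M[R]_m) (W B : E -> 'M[R]_m).
Hypothesis D : ricci_type_data V Gm W B.
Hypothesis m2 : (2 < m)%N.

Local Notation omW := (om W).
Local Notation betW := (bet W B).
Local Notation cBW := (cB Gm W B).
Local Notation cvBW := (cvB Gm B).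
Local Notation curvW := (curv Gm).
Local Notation kformW := (kform W B).

(** The contraction of the covariant derivative of [B], normalised by the [m + 1] of
    [bianchi_solution], so that this derivative is recovered from [uvec] without further
    constants. *)
Definition uvec (x : E) : E := (m%:R + 1)^-1 *:
  \sum_i \sum_j invmx (W x) i j *: (cvBW (delta_mx i 0) x *m delta_mx j 0).

Definition ups x a := omW x a (uvec x).

Lemma smooth_cvB X : smooth_on V (cvBW X).
Proof.
have oV := rt_open D; have sB := rt_B D; have sG := rt_G D X.
apply: smooth_onB => //; last exact: smooth_on_mulmx.
by apply: smooth_onD => //; [exact: smooth_on_derive|exact: smooth_on_mulmx].
Qed.

Lemma smooth_invW i j : smooth_on V (fun x => invmx (W x) i j).
Proof.
have oV := rt_open D; have s := smooth_on_invmx oV (rt_Wunit D) (rt_W D).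
by move/(smooth_on_mxP _ oV): s; exact.
Qed.

Lemma smooth_uvec : smooth_on V uvec.
Proof.
have oV := rt_open D; apply: smooth_on_scale => //; first exact: smooth_on_cst.
apply: smooth_on_sum => // i _; apply: smooth_on_sum => // j _.
apply: smooth_on_scale => //; first exact: smooth_invW.
by apply: smooth_on_mulmx => //; [exact: smooth_cvB|exact: smooth_on_cst].
Qed.

Lemma smooth_om (a b : E -> E) : smooth_on V a -> smooth_on V b ->
  smooth_on V (fun x => omW x (a x) (b x)).
Proof.
have oV := rt_open D; move=> sa sb; rewrite /om /bform.
apply: (smooth_on_linmx (@coord_mx R 1 1 0 0) oV (f := fun x => (a x)^T *m W x *m b x)).
apply: smooth_on_mulmx => //; apply: smooth_on_mulmx => //; last exact: rt_W D.
exact: (smooth_on_linmx (@trmx R _ _)).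
Qed.

Lemma ups_contr x t : V x ->
  ups x t = - (m%:R + 1)^-1 * contr (W x) (fun y z => cBW x y z t).
Proof.
move=> Vx; rewrite /ups (om_anti D _ _ Vx) /uvec omZl mulNr; congr (- (_ * _)).
have oms (I : Type) (r : seq I) (F : I -> E) : omW x (\sum_(i <- r) F i) t = \sum_(i <- r) omW x (F i) t.
  exact: (big_morph (omW x ^~ t) (fun a b => omDl W x a b t) (om0l W x t)).
rewrite oms /contr; apply: eq_bigr => i _; rewrite oms; apply: eq_bigr => j _.
by rewrite omZl.
Qed.

Lemma cBE x X a b : V x -> cBW x X a b = ups x a * omW x X b + omW x X a * ups x b.
Proof.
move=> Vx.
have H : forall x0 y z h t,
    - 2 * bform (W x) y z * cBW x x0 h t + bform (W x) x0 h * (cBW x y z t - cBW x z y t) + (cBW x y z h - cBW x z y h) * bform (W x) x0 t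
    + (- 2 * bform (W x) z x0 * cBW x y h t + bform (W x) y h * (cBW x z x0 t - cBW x x0 z t) + (cBW x z x0 h - cBW x x0 z h) * bform (W x) y t)
    + (- 2 * bform (W x) x0 y * cBW x z h t + bform (W x) z h * (cBW x x0 y t - cBW x y x0 t) + (cBW x x0 y h - cBW x y x0 h) * bform (W x) z t) = 0.
  move=> x0 y z h t; have := cB_bianchi D x0 y z h t Vx.
  by rewrite /ckform /om => E0; rewrite -[RHS]E0; ring.
rewrite (bianchi_solution (rt_Wanti D Vx) (rt_Wunit D Vx) m2 (fun a b => cB_lin1 D a b Vx)
  (fun X b => @cB_lin2 _ _ Gm W B x X b) (fun X a b => cB_sym D X a b Vx) H).
by rewrite !ups_contr// /om; ring.
Qed.

(** The covariant derivative of [uvec]; [nu] lowers it, with the differentiated field in the second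
    slot of the form, and [gam] is the lowered [B^2] up to sign. *)
Definition nvec X x := 'D_X uvec x + Gm X x *m uvec x.
Definition nu x X a := omW x a (nvec X x).
Definition gam x a b := omW x (B x *m a) (B x *m b).

Lemma has_der_ups (a : E -> E) x v da : V x -> has_der a x v da ->
  has_der (fun z => ups z (a z)) x v (nu x v (a x) + ups x (da + Gm v x *m a x)).
Proof.
move=> Vx ha; have hu := has_der_smooth v smooth_uvec Vx.
by apply: (has_der_eq (has_der_om D Vx ha hu)); rewrite addrC.
Qed.

(** [curvature_commutator_solution] makes [nu - gam] a multiple of the form; this is the coefficient
    it prescribes. *)
Definition phi x := - (contr (W x) (fun y a => nu x y a - gam x y a) / m%:R).

Lemma omBr x a b : V x -> omW x a (B x *m b) = - betW x a b.
Proof. by move=> Vx; rewrite /bet (rt_Bsp D Vx) opprK. Qed.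

Lemma nvec_linear x r u v : V x -> nvec (r *: u + v) x = r *: nvec u x + nvec v x.
Proof.
move=> Vx; rewrite /nvec derive_linear; last exact: (smooth_on_diff smooth_uvec Vx).
rewrite (rt_Glin D Vx r u v) (mulmxDl (r *: Gm u x)) -(scalemxAl r (Gm u x)).
have E4 (p q c d : E) : r *: p + q + (r *: c + d) = r *: (p + c) + (q + d).
  by rewrite scalerDr addrACA.
exact: E4.
Qed.

(** [cBE] replaces the first derivative of [B] by [ups] before differentiating again, so second
    derivatives of [B] appear only through [nu]. *)
Lemma derive2_bet p x y a b : V p ->
  'D_y ('D_x (fun z => betW z a b)) p =
    (nu p y a + ups p (Gm y p *m a)) * omW p x b
  + ups p a * (omW p (Gm y p *m x) b + omW p x (Gm y p *m b))
  + ((omW p (Gm y p *m x) a + omW p x (Gm y p *m a)) * ups p b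
  + omW p x a * (nu p y b + ups p (Gm y p *m b)))
  + (cBW p y (Gm x p *m a) b + betW p ('D_y (Gm x) p *m a + Gm y p *m (Gm x p *m a)) b
     + betW p (Gm x p *m a) (Gm y p *m b))
  + (cBW p y a (Gm x p *m b) + betW p (Gm y p *m a) (Gm x p *m b)
     + betW p a ('D_y (Gm x) p *m b + Gm y p *m (Gm x p *m b))).
Proof.
move=> Vp; have cst c := has_der_cst (c : E) p y.
have hG := has_der_smooth y (rt_G D x) Vp.
have hGa (c : E) : has_der (fun z => Gm x z *m c) p y ('D_y (Gm x) p *m c).
  by have := has_der_mulmx hG (cst c); rewrite mulmx0 addr0.
have F := has_derD (has_derD (has_derD
  (has_der_mul (has_der_ups Vp (cst a)) (has_der_om D Vp (cst x) (cst b)))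
  (has_der_mul (has_der_om D Vp (cst x) (cst a)) (has_der_ups Vp (cst b))))
  (has_der_bet D Vp (hGa a) (cst b)))
  (has_der_bet D Vp (cst a) (hGa b)).
rewrite !add0r in F.
have E0 : forall z, V z -> ups z a * omW z x b + omW z x a * ups z b
    + betW z (Gm x z *m a) b + betW z a (Gm x z *m b) = 'D_x (fun z => betW z a b) z.
  move=> z Vz; have [_ ->] := has_der_bet D Vz (has_der_cst a z x) (has_der_cst b z x).
  by rewrite !add0r cBE.
by have [_ ->] := has_der_near (rt_open D) Vp E0 F.
Qed.

Lemma smooth_bet a b : smooth_on V (fun z => betW z a b).
Proof.
apply: smooth_om; last exact: smooth_on_cst.
apply: smooth_on_mulmx; [exact: rt_open D|exact: rt_B D|exact: smooth_on_cst].
Qed.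

Lemma betDl x a b c : betW x (a + b) c = betW x a c + betW x b c.
Proof. by rewrite /bet mulmxDr omDl. Qed.
Lemma betNl x a c : betW x (- a) c = - betW x a c.
Proof. by rewrite /bet mulmxN omNl. Qed.

Lemma curv_increments p x y (a : E) :
  curvW y x p *m a = ('D_y (Gm x) p *m a + Gm y p *m (Gm x p *m a))
    - ('D_x (Gm y) p *m a + Gm x p *m (Gm y p *m a)).
Proof.
rewrite /curv mulmxDl !mulmxBl -!mulmxA.
move: (_ *m _) (_ *m _) (_ *m _) (_ *m _) => b c d e.
by rewrite opprD addrACA.
Qed.

Lemma bet_curv p x y (a b : E) : V p ->
  betW p ('D_y (Gm x) p *m a + Gm y p *m (Gm x p *m a)) b
  - betW p ('D_x (Gm y) p *m a + Gm x p *m (Gm y p *m a)) b = - kformW p y x a (B p *m b).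
Proof.
move=> Vp; rewrite -betNl -betDl -curv_increments -(rt_curv D Vp) /bet.
by rewrite (rt_Bsp D Vp).
Qed.

(** The Ricci identity for [B]: equality of mixed derivatives of [bet] turns the derivatives of the
    Christoffel symbols into curvature. Being of Ricci type, it leaves only products of [gam] with
    the form. *)
Lemma potential_identity x z y (a b : E) : V x ->
  (nu x y a - gam x y a) * omW x z b + (nu x y b - gam x y b) * omW x z a
   - (nu x z a - gam x z a) * omW x y b - (nu x z b - gam x z b) * omW x y a = 0.
Proof.
move=> Vx.
have S := schwarzR z y (rt_open D) (smooth_bet a b) Vx.
rewrite (derive2_bet z y a b Vx) (derive2_bet y z a b Vx) in S.
have K1 := bet_curv z y a b Vx; have K2 := bet_curv z y b a Vx.
rewrite ![betW x a (_ + _)](bet_sym D a _ Vx) in S.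
rewrite (rt_torsion D Vx z y) !(cBE _ _ _ Vx) in S.
rewrite /kform !(omBr _ _ Vx) in K1 K2.
have g1 : betW x a (B x *m b) = gam x a b by [].
have g2 : betW x b (B x *m a) = - gam x a b by rewrite /bet (om_anti D _ _ Vx).
have g3 c d : betW x c (B x *m d) = gam x c d by [].
rewrite g2 !g3 in K1 K2.
lra.
Qed.

Lemma nuE x y (a : E) : V x -> nu x y a = gam x y a + phi x * omW x y a.
Proof.
move=> Vx.
have l1 a' : lin1 (fun y => nu x y a' - gam x y a').
  move=> r u v; rewrite /nu nvec_linear// (omDr W x (r *: nvec u x) (nvec v x)).
  rewrite (omZr W x r (nvec u x)) /gam mulmxDr -scalemxAr omDl omZl; ring.
have l2 y' : lin1 (fun a => nu x y' a - gam x y' a).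
  move=> r u v; have -> : gam x y' (r *: u + v) = r * gam x y' u + gam x y' v.
    by rewrite /gam mulmxDr -scalemxAr omDr omZr.
  by rewrite /nu omDl omZl; ring.
have m0 : (0 < m)%N by exact: leq_trans m2.
have := curvature_commutator_solution (rt_Wanti D Vx) (rt_Wunit D Vx) m0 l1 l2 _ y a.
rewrite -/(phi x) => H.
suff : nu x y a - gam x y a = phi x * omW x y a by move=> <-; rewrite addrC subrK.
have Hs z y' a' b : (nu x y' a' - gam x y' a') * omW x z b + (nu x y' b - gam x y' b) * omW x z a'
   - (nu x z a' - gam x z a') * omW x y' b - (nu x z b - gam x z b) * omW x y' a' = 0.
  exact: potential_identity.
exact: H Hs.
Qed.

Lemma smooth_nu y a : smooth_on V (fun x => nu x y a).
Proof.
have oV := rt_open D; apply: smooth_om; first exact: smooth_on_cst.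
apply: smooth_onD => //; first exact: (smooth_on_derive _ smooth_uvec).
by apply: smooth_on_mulmx => //; [exact: rt_G D y|exact: smooth_uvec].
Qed.

Lemma smooth_gam a b : smooth_on V (fun x => gam x a b).
Proof.
have oV := rt_open D; have sB := rt_B D.
by apply: smooth_om; apply: smooth_on_mulmx => //; exact: smooth_on_cst.
Qed.

Lemma smooth_phi : smooth_on V phi.
Proof.
have oV := rt_open D.
apply: smooth_onN => //; apply: smooth_onM => //; last exact: smooth_on_cst.
apply: smooth_on_sum => // i _; apply: smooth_on_sum => // j _.
apply: smooth_onM => //; first exact: smooth_invW.
by apply: smooth_onB => //; [exact: smooth_nu|exact: smooth_gam].
Qed.

Lemma smooth_ups a : smooth_on V (fun x => ups x a).
Proof. by apply: smooth_om; [exact: smooth_on_cst|exact: smooth_uvec]. Qed.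

Lemma has_der_gam p x (y a : E) : V p ->
  has_der (fun z => gam z y a) p x (cBW p x y (B p *m a) + gam p (Gm x p *m y) a
    - cBW p x a (B p *m y) + gam p y (Gm x p *m a)).
Proof.
move=> Vp; have hB := has_der_smooth x (rt_B D) Vp.
have hBc (c : E) := has_der_mulmx hB (has_der_cst c p x).
apply: (has_der_eq (has_der_om D Vp (hBc y) (hBc a))).
have E1 (c : E) : 'D_x B p *m c + B p *m 0 + Gm x p *m (B p *m c) =
    cvBW x p *m c + B p *m (Gm x p *m c).
  rewrite mulmx0 addr0 /cvB mulmxBl mulmxDl -!mulmxA.
  by move: (_ *m _) (_ *m _) (_ *m _) => b d e; rewrite subrK.
rewrite (E1 y) (E1 a) !omDl /cB /gam.
rewrite (omDr W p (cvBW x p *m a) (B p *m (Gm x p *m a)) (B p *m y)).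
by rewrite (om_anti D (B p *m y) (cvBW x p *m a) Vp); ring.
Qed.

Lemma eq_of_differences (a b c d e f : R) :
  a = b -> c = d -> e - f = (a - b) - (c - d) -> e = f.
Proof. by move=> -> ->; rewrite !subrr => /eqP; rewrite subr_eq0 => /eqP. Qed.

(** The Ricci identity for [uvec]: with [psi] the difference of the two sides, equality of mixed
    derivatives of [ups] and the curvature formula leave [psi x * om y a = psi y * om x a], which
    forces [psi = 0]. *)
Lemma derive_phi p v : V p -> 'D_v phi p = - 2 * ups p (B p *m v).
Proof.
move=> Vp.
have second x (y a : E) : 'D_x ('D_y (fun z => ups z a)) p =
  cBW p x y (B p *m a) + gam p (Gm x p *m y) a - cBW p x a (B p *m y) + gam p y (Gm x p *m a)
  + ('D_x phi p * omW p y a + phi p * (omW p (Gm x p *m y) a + omW p y (Gm x p *m a)))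
  + (nu p x (Gm y p *m a) + ups p ('D_x (Gm y) p *m a + Gm x p *m (Gm y p *m a))).
  have cst (c : E) := has_der_cst c p x.
  have hG := has_der_smooth x (rt_G D y) Vp.
  have hGa : has_der (fun z => Gm y z *m a) p x ('D_x (Gm y) p *m a).
    by have := has_der_mulmx hG (cst a); rewrite mulmx0 addr0.
  have F := has_derD (has_derD (has_der_gam x y a Vp)
    (has_der_mul (has_der_smooth x smooth_phi Vp) (has_der_om D Vp (cst y) (cst a))))
    (has_der_ups Vp hGa).
  rewrite !add0r in F.
  have E0 : forall z, V z -> gam z y a + phi z * omW z y a + ups z (Gm y z *m a)
     = 'D_y (fun z => ups z a) z.
    move=> z Vz; have [_ ->] := has_der_ups Vz (has_der_cst a z y).
    by rewrite add0r nuE.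
  by have [_ ->] := has_der_near (rt_open D) Vp E0 F.
have ups_curv x y (a : E) : ups p ('D_x (Gm y) p *m a + Gm x p *m (Gm y p *m a))
    - ups p ('D_y (Gm x) p *m a + Gm y p *m (Gm x p *m a)) = kformW p x y a (uvec p).
  have oB (b c d : E) : omW p (b - c) d = omW p b d - omW p c d by rewrite omDl omNl.
  by rewrite -(rt_curv D Vp) curv_increments oB.
pose psi x := 'D_x phi p + 2 * ups p (B p *m x).
suff psi0 : psi v = 0 by move: psi0; rewrite /psi; lra.
have dphi := smooth_on_diff smooth_phi Vp.
apply: (proportional_forms_zero (rt_Wanti D Vp) (rt_Wunit D Vp) (ltnW m2)).
  move=> r u w; rewrite /psi derive_linear// mulmxDr -scalemxAr /ups omDl omZl.
  have key (b c d e : R) : r * b + c + 2 * (r * d + e) = r * (b + 2 * d) + (c + 2 * e) by ring.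
  exact: key.
move=> x y a.
have S0 := schwarzR y x (rt_open D) (smooth_ups a) Vp.
have S := etrans (etrans (esym (second x y a)) S0) (second y x a).
have K := ups_curv x y a.
rewrite /kform in K.
have bu z : betW p z (uvec p) = ups p (B p *m z) by [].
have ou z : omW p z (uvec p) = ups p z by [].
rewrite !bu !ou in K.
rewrite (rt_torsion D Vp y x) !(cBE _ _ _ Vp) !(nuE _ _ Vp) !(omBr _ _ Vp) in S.
rewrite (bet_sym D y x Vp) (om_anti D y x Vp) in S.
rewrite /psi; change (bform (W p)) with (omW p); move: S K.
do ?[match goal with |- context [ups p ?b] => move: (ups p b) => ? end].
do ?[match goal with |- context [gam p ?b ?c] => move: (gam p b c) => ? end].
do ?[match goal with |- context [bet W B p ?b ?c] => move: (bet W B p b c) => ? end].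
do ?[match goal with |- context [om W p ?b ?c] => move: (om W p b c) => ? end].
move: ('D_x phi p) => dx.
move: ('D_y phi p) => dy.
move: (phi p) => ph.
move=> S K; apply: (eq_of_differences S K).
by ring.
Qed.

End RicciTypePotentials.

(** * The tractor connection and its frames *)

Section FlowCoordCalculus.
Context {R : realType} {n : nat}.
Local Notation E := 'cV[R]_(n + n).
Local Notation E' := 'cV[R]_(2 + (n + n)).
Context {V : normedModType R}.

Lemma flow_coord_ext (u v : E') : u (ix0 n) 0 = v (ix0 n) 0 -> u (ix1 n) 0 = v (ix1 n) 0 ->
  dsubmx u = dsubmx v -> u = v.
Proof. by move=> h0 h1 hd; rewrite -(flow_coord_surj u) h0 h1 hd flow_coord_surj. Qed.

Lemma flow_coord_sum (r t : R) (y : E) : flow_coord r t y =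
  r *: delta_mx (ix0 n) 0 + t *: delta_mx (ix1 n) 0 + col_mx 0 1%:M *m y.
Proof.
rewrite mul_col_mx mul0mx mul1mx.
have vk k : (col_mx 0 y : E') (lshift (n + n) k) 0 = 0 by rewrite col_mxEu mxE.
have vd : dsubmx (col_mx 0 y : E') = y by rewrite col_mxKd.
move: (col_mx 0 y) vk vd => z vk vd; apply: flow_coord_ext.
- by rewrite flow_coordK0 !mxE vk eqxx/= mulr0 mulr1 !addr0.
- by rewrite flow_coordK1 !mxE vk eqxx/= mulr0 mulr1 add0r addr0.
rewrite flow_coordKd !linearD/= !linearZ/= vd.
have d0 k : dsubmx (delta_mx (lshift (n + n) k) 0) = 0 :> E.
  by apply/matrixP => i j; rewrite !mxE eq_rlshift.
by rewrite !d0 !scaler0 !add0r.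
Qed.

Lemma flow_coordD (r t r' t' : R) (y y' : E) :
  flow_coord r t y + flow_coord r' t' y' = flow_coord (r + r') (t + t') (y + y').
Proof.
by rewrite /flow_coord add_col_mx; congr col_mx; apply/matrixP => i j; rewrite !mxE; case: ifP.
Qed.

Lemma flow_coordZ c (r t : R) (y : E) :
  c *: flow_coord r t y = flow_coord (c * r) (c * t) (c *: y).
Proof.
by rewrite /flow_coord scale_col_mx; congr col_mx; apply/matrixP => i j; rewrite !mxE; case: ifP.
Qed.

Lemma flow_coordN (r t : R) (y : E) : - flow_coord r t y = flow_coord (- r) (- t) (- y).
Proof. by rewrite -scaleN1r flow_coordZ !mulN1r scaleN1r. Qed.

Lemma has_der_flow_coord (r t : V -> R) (y : V -> E) x v dr dt dy :
  has_der r x v dr -> has_der t x v dt -> has_der y x v dy ->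
  has_der (fun z => flow_coord (r z) (t z) (y z)) x v (flow_coord dr dt dy).
Proof.
move=> hr ht hy.
have c0 := has_der_cst (delta_mx (ix0 n) 0 : E') x v.
have c1 := has_der_cst (delta_mx (ix1 n) 0 : E') x v.
have cd := has_der_cst (col_mx 0 1%:M : 'M[R]_(2 + (n + n), n + n)) x v.
have H := has_derD (has_derD (has_der_scale hr c0) (has_der_scale ht c1)) (has_der_mulmx cd hy).
apply: (has_der_near openT I _ (has_der_eq H _)) => [z _|]; first by rewrite -flow_coord_sum.
by rewrite !scaler0 !addr0 mul0mx add0r flow_coord_sum.
Qed.

Lemma smooth_on_flow_coord (U : set V) (r t : V -> R) (y : V -> E) : open U ->
  smooth_on U r -> smooth_on U t -> smooth_on U y ->
  smooth_on U (fun z => flow_coord (r z) (t z) (y z)).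
Proof.
move=> oU sr st sy; under eq_fun do rewrite flow_coord_sum.
apply: smooth_onD => //; first apply: smooth_onD => //; last first.
- by apply: smooth_on_mulmx => //; exact: smooth_on_cst.
- by apply: smooth_on_scale => //; exact: smooth_on_cst.
- by apply: smooth_on_scale => //; exact: smooth_on_cst.
Qed.

End FlowCoordCalculus.

Section ColumnMatrix.
Context {R : comNzRingType}.

Definition col_matrix p q (f : 'cV[R]_p -> 'cV[R]_q) : 'M[R]_(q, p) :=
  \matrix_(i, j) f (delta_mx j 0) i 0.

Lemma mul_col_matrix p q (f : 'cV[R]_p -> 'cV[R]_q) xi :
  (forall r u v, f (r *: u + v) = r *: f u + f v) -> col_matrix f *m xi = f xi.
Proof.
move=> flin; pose L : {linear 'cV[R]_p -> 'cV[R]_q} := HB.pack f (GRing.isLinear.Build _ _ _ _ f flin).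
rewrite -[f]/(L : _ -> _) [in RHS](matrix_sum_delta xi) linear_sum.
apply/matrixP => i j; rewrite !mxE ord1 summxE; apply: eq_bigr => k _.
by rewrite big_ord1 linearZ/= !mxE mulrC.
Qed.

Lemma eq_mulmx_col p q (M N : 'M[R]_(q, p)) :
  (forall xi : 'cV[R]_p, M *m xi = N *m xi) -> M = N.
Proof.
move=> H; apply/matrixP => i j; have := congr1 (fun v : 'cV[R]_q => v i 0) (H (delta_mx j 0)).
by rewrite -!colE !mxE.
Qed.

End ColumnMatrix.

(** * The connection on [R^2 + TM], its invariant form and its parallel endomorphism *)

Section Tractor.
Context {R : realType} {n : nat} (V : set 'cV[R]_(n + n)).
Local Notation E := 'cV[R]_(n + n).
Local Notation E' := 'cV[R]_(2 + (n + n)).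
Variables (Gm : E -> E -> 'M[R]_(n + n)) (W B : E -> 'M[R]_(n + n)).
Hypothesis D : ricci_type_data V Gm W B.
Hypothesis n2 : (2 < n + n)%N.
Local Notation omW := (om W).
Local Notation betW := (bet W B).
Local Notation upsW := (ups Gm W B).
Local Notation phiW := (phi Gm W B).
Local Notation uW := (uvec Gm W B).

Lemma curvE x (X Y h : E) : V x -> curv Gm X Y x *m h =
  (- 2 * omW x X Y) *: (B x *m h) - omW x X h *: (B x *m Y) + omW x Y h *: (B x *m X)
  + betW x X h *: Y - betW x Y h *: X.
Proof.
move=> Vx; apply: (bform_inj (rt_Wanti D Vx) (rt_Wunit D Vx)) => t.
change (omW x (curv Gm X Y x *m h) t = omW x ((- 2 * omW x X Y) *: (B x *m h) - omW x X h *: (B x *m Y) + omW x Y h *: (B x *m X)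
  + betW x X h *: Y - betW x Y h *: X) t).
rewrite (rt_curv D Vx) /kform; symmetry.
by rewrite !omDl !omNl !omZl.
Qed.

Lemma cvBE x (X h : E) : V x ->
  cvB Gm B X x *m h = upsW x h *: X - omW x X h *: uW x.
Proof.
move=> Vx; apply: (bform_inj (rt_Wanti D Vx) (rt_Wunit D Vx)) => b.
change (cB Gm W B x X h b = omW x (upsW x h *: X - omW x X h *: uW x) b).
rewrite (cBE D n2 _ _ _ Vx).
have -> : omW x (upsW x h *: X - omW x X h *: uW x) b = upsW x h * omW x X b - omW x X h * omW x (uW x) b.
  by move: (upsW x h) (omW x X h) (uW x) => r s w; rewrite omDl omNl !omZl.
rewrite (om_anti D (uW x) b Vx) -/(upsW x b); ring.
Qed.

Lemma nvecE x (X : E) : V x -> nvec Gm W B X x = B x *m (B x *m X) - phiW x *: X.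
Proof.
move=> Vx; apply: (bform_inj (rt_Wanti D Vx) (rt_Wunit D Vx)) => a.
change (omW x (nvec Gm W B X x) a = omW x (B x *m (B x *m X) - phiW x *: X) a).
rewrite (om_anti D _ a Vx) -/(nu Gm W B x X a) (nuE D n2 _ _ Vx).
have -> : omW x (B x *m (B x *m X) - phiW x *: X) a = omW x (B x *m (B x *m X)) a - phiW x * omW x X a.
  by move: (phiW x) => r; rewrite omDl omNl omZl.
by rewrite (rt_Bsp D Vx) /gam; ring.
Qed.

(** Coordinates [ix0], [ix1] and the last block are the components of [a s + b A s + H h]. The
    entries come from [D_X s = H X], [D_X (A s) = A H X] and the horizontal structure equation, each
    modulo the flow of [A]. *)
Definition tr_act (X x : E) (xi : E') : E' :=
  flow_coord (- upsW x X * xi (ix1 n) 0 + betW x X (dsubmx xi))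
    (- omW x X (dsubmx xi))
    (xi (ix0 n) 0 *: X + xi (ix1 n) 0 *: (B x *m X) + Gm X x *m dsubmx xi).

(** The matrix of [A] in the same frame: [s] goes to [A s], while the images of [A s] and [H h] are
    given by [phi], [uvec] and [B]. *)
Definition tr_end (x : E) (xi : E') : E' :=
  flow_coord (phiW x * xi (ix1 n) 0 - upsW x (dsubmx xi)) (xi (ix0 n) 0)
    (xi (ix1 n) 0 *: uW x + B x *m dsubmx xi).

Lemma tr_act_linear X x r xi eta : tr_act X x (r *: xi + eta) = r *: tr_act X x xi + tr_act X x eta.
Proof.
rewrite /tr_act flow_coordZ flow_coordD linearP/=.
have bD a b : betW x X (r *: a + b) = r * betW x X a + betW x X b by rewrite /bet omDr omZr.
have oD a b : omW x X (r *: a + b) = r * omW x X a + omW x X b by rewrite omDr omZr.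
rewrite bD oD; congr flow_coord.
- by rewrite !mxE; ring.
- by ring.
have E1 (a b a' b' : R) (c d e f : E) : (r * a + b) *: c + (r * a' + b') *: d + (r *: e + f) =
    r *: (a *: c + a' *: d + e) + (b *: c + b' *: d + f).
  by apply/matrixP => i j; rewrite !mxE; ring.
rewrite mulmxDr -scalemxAr -E1; congr (_ *: _ + _ *: _ + _); by rewrite !mxE.
Qed.

Lemma tr_end_linear x r xi eta : tr_end x (r *: xi + eta) = r *: tr_end x xi + tr_end x eta.
Proof.
rewrite /tr_end flow_coordZ flow_coordD linearP/=.
have uD a b : upsW x (r *: a + b) = r * upsW x a + upsW x b by rewrite /ups omDl omZl.
rewrite uD; congr flow_coord.
- by rewrite !mxE; ring.
- by rewrite !mxE.
have E1 (a b : R) (c d e : E) : (r * a + b) *: c + (r *: d + e) =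
    r *: (a *: c + d) + (b *: c + e).
  by apply/matrixP => i j; rewrite !mxE; ring.
by rewrite mulmxDr -scalemxAr -E1; congr (_ *: _ + _); rewrite !mxE.
Qed.

Definition tr_conn X x : 'M[R]_(2 + (n + n)) := col_matrix (tr_act X x).
Definition tr_endmx x : 'M[R]_(2 + (n + n)) := col_matrix (tr_end x).

Lemma tr_connE X x xi : tr_conn X x *m xi = tr_act X x xi.
Proof. by apply: mul_col_matrix => r u v; exact: tr_act_linear. Qed.

Lemma tr_endmxE x xi : tr_endmx x *m xi = tr_end x xi.
Proof. by apply: mul_col_matrix => r u v; exact: tr_end_linear. Qed.

Lemma tr_conn_linear x r X Y : V x -> tr_conn (r *: X + Y) x = r *: tr_conn X x + tr_conn Y x.
Proof.
move=> Vx; apply: eq_mulmx_col => xi; rewrite mulmxDl -scalemxAl !tr_connE /tr_act.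
rewrite flow_coordZ flow_coordD (rt_Glin D Vx); congr flow_coord.
- have uD : upsW x (r *: X + Y) = r * upsW x X + upsW x Y by rewrite /ups omDl omZl.
  have bD a : betW x (r *: X + Y) a = r * betW x X a + betW x Y a.
    by rewrite /bet mulmxDr -scalemxAr omDl omZl.
  by rewrite uD bD; ring.
- by rewrite omDl omZl; ring.
rewrite mulmxDr -scalemxAr mulmxDl -scalemxAl.
move: (xi _ _) (xi _ _) (_ *m _) (_ *m _) (_ *m _) (_ *m _) => a b c d e f.
by apply/matrixP => i j; rewrite !mxE; ring.
Qed.

Lemma smooth_col_matrix p q (f : E -> 'cV[R]_p -> 'cV[R]_q) :
  (forall xi, smooth_on V (fun x => f x xi)) -> smooth_on V (fun x => col_matrix (f x)).
Proof.
move=> sf; have oV := rt_open D; apply/(smooth_on_mxP _ oV) => i j.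
under eq_fun do rewrite mxE.
exact: (smooth_on_linmx (@coord_mx R _ _ i 0) oV (sf (delta_mx j 0))).
Qed.

Lemma smooth_tr_conn X : smooth_on V (tr_conn X).
Proof.
have oV := rt_open D; have sB := rt_B D; have sG := rt_G D X.
have c0 (F : normedModType R) (c : F) := @smooth_on_cst R E F V c.
apply: smooth_col_matrix => xi; apply: smooth_on_flow_coord => //.
- apply: smooth_onD => //; last exact: smooth_bet D _ _.
  by apply: smooth_onM => //; apply: smooth_onN => //; exact: smooth_ups D _.
- by apply: smooth_onN => //; exact: (smooth_om D).
apply: smooth_onD => //; last exact: smooth_on_mulmx.
apply: smooth_onD => //; apply: smooth_on_scale => //; exact: smooth_on_mulmx.
Qed.

Lemma smooth_tr_endmx : smooth_on V tr_endmx.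
Proof.
have oV := rt_open D; have sB := rt_B D.
have c0 (F : normedModType R) (c : F) := @smooth_on_cst R E F V c.
apply: smooth_col_matrix => xi; apply: smooth_on_flow_coord => //.
- apply: smooth_onB => //; last exact: smooth_ups D _.
  by apply: smooth_onM => //; exact: smooth_phi D.
apply: smooth_onD => //; last exact: smooth_on_mulmx.
apply: smooth_on_scale => //; exact: smooth_uvec D.
Qed.

Definition tr_form x : 'M[R]_(2 + (n + n)) := block_mx (stdJ R 1) 0 0 (W x).
Definition gform x (xi eta : E') : R := xi (ix0 n) 0 * eta (ix1 n) 0
  - xi (ix1 n) 0 * eta (ix0 n) 0 + omW x (dsubmx xi) (dsubmx eta).

Lemma tr_formE x xi eta : (xi^T *m tr_form x *m eta) 0 0 = gform x xi eta.
Proof.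
rewrite -{1}(vsubmxK xi) -{1}(vsubmxK eta) /tr_form tr_col_mx mul_row_block !mulmx0 addr0 add0r.
rewrite mul_row_col mxE (stdJ1E (usubmx xi) (usubmx eta)) -/(bform (W x) (dsubmx xi) (dsubmx eta)).
by rewrite /gform -/(om W x (dsubmx xi) (dsubmx eta)); congr (_ - _ + _); rewrite !mxE.
Qed.

Lemma tr_form_unit x : V x -> tr_form x \in unitmx.
Proof.
move=> Vx; rewrite unitmxE /tr_form (det_ublock (stdJ R 1 : 'M[R]_2)) unitrM -!unitmxE.
rewrite (rt_Wunit D Vx) andbT.
have : (stdJ R 1 : 'M[R]_2) *m - (stdJ R 1 : 'M[R]_2) = 1%:M.
  by rewrite mulmxN; have J := @stdJ_sq R 1; rewrite [X in - X]J opprK.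
by move=> /mulmx1_unit[].
Qed.

Lemma smooth_tr_form : smooth_on V tr_form.
Proof.
have oV := rt_open D; have sW := rt_W D.
have -> : tr_form = (fun x => block_mx (stdJ R 1) 0 0 0 +
    col_mx (0 : 'M[R]_(2, n + n)) 1%:M *m W x *m row_mx (0 : 'M[R]_(n + n, 2)) 1%:M).
  apply/funext => x; rewrite mul_col_mx mul0mx mul1mx mul_col_row !mul0mx mulmx0 mulmx1.
  by rewrite add_block_mx !addr0 !add0r.
apply: smooth_onD => //; first exact: smooth_on_cst.
apply: smooth_on_mulmx => //; last exact: smooth_on_cst.
by apply: smooth_on_mulmx => //; exact: smooth_on_cst.
Qed.

Lemma eq_mulmx_bilin p (M N : 'M[R]_p) :
  (forall xi eta : 'cV[R]_p, (xi^T *m M *m eta) 0 0 = (xi^T *m N *m eta) 0 0) -> M = N.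
Proof.
move=> H; apply/matrixP => i j; have := H (delta_mx i 0) (delta_mx j 0).
by rewrite !mx_delta_entry.
Qed.

Lemma tr_end_sp x : V x -> (tr_endmx x)^T *m tr_form x + tr_form x *m tr_endmx x = 0.
Proof.
move=> Vx; apply: eq_mulmx_bilin => xi eta.
rewrite mulmxDr mulmxDl mulmx0 mul0mx [RHS]mxE [LHS]mxE !mulmxA -trmx_mul.
rewrite -(mulmxA _ (tr_endmx x) eta) !tr_endmxE !tr_formE /gform /tr_end.
rewrite !flow_coordK0 !flow_coordK1 !flow_coordKd.
have uD b h h' : omW x (b *: uW x + B x *m h) h' = - b * upsW x h' + betW x h h'.
  by rewrite omDl omZl (om_anti D (uW x) h' Vx) -/(upsW x h') mulrN mulNr.
rewrite uD (om_anti D _ (_ + _) Vx) uD (bet_sym D _ (dsubmx xi) Vx); ring.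
Qed.

Lemma derive_tr_form X x : V x ->
  'D_X tr_form x = (tr_conn X x)^T *m tr_form x + tr_form x *m tr_conn X x.
Proof.
move=> Vx; apply: eq_mulmx_bilin => xi eta.
rewrite mulmxDr mulmxDl [RHS]mxE !mulmxA -trmx_mul -(mulmxA _ (tr_conn X x) eta) !tr_connE !tr_formE.
have hg := has_der_smooth X smooth_tr_form Vx.
have h1 := has_der_linmx (@coord_mx R 1 1 0 0) (has_der_mulmx (has_der_mulmx (has_der_cst xi^T x X) hg)
  (has_der_cst eta x X)).
have h2 : has_der (fun z => gform z xi eta) x X
   (omW x (Gm X x *m dsubmx xi) (dsubmx eta) + omW x (dsubmx xi) (Gm X x *m dsubmx eta)).
  have := has_der_om D Vx (has_der_cst (dsubmx xi) x X) (has_der_cst (dsubmx eta) x X).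
  rewrite !add0r => /(has_derD (has_der_cst (xi (ix0 n) 0 * eta (ix1 n) 0
    - xi (ix1 n) 0 * eta (ix0 n) 0) x X)); by rewrite add0r.
have h3 := has_der_near openT I (fun z _ => tr_formE z xi eta) h1.
have E : (0 *m tr_form x + xi^T *m 'D_X tr_form x) *m eta + xi^T *m tr_form x *m 0 = xi^T *m 'D_X tr_form x *m eta.
  by rewrite mulmx0 addr0 mul0mx add0r.
apply: etrans (etrans (congr1 (coord_mx 0 0) (esym E)) (has_der_unique h3 h2)) _.
rewrite /gform /tr_act !flow_coordK0 !flow_coordK1 !flow_coordKd !omDl !omZl.
have oR c c' h z : omW x h (c *: X + c' *: (B x *m X) + z) = - c * omW x X h - c' * betW x X h + omW x h z.
  by rewrite (om_anti D _ _ Vx) 2!omDl !omZl -/(betW x X h) (om_anti D z h Vx); ring.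
by rewrite oR -/(betW x X (dsubmx eta)); ring.
Qed.

Lemma derive_B X x h : V x -> 'D_X B x *m h =
  upsW x h *: X - omW x X h *: uW x - Gm X x *m (B x *m h) + B x *m (Gm X x *m h).
Proof.
move=> Vx; rewrite -(cvBE X h Vx) /cvB mulmxBl mulmxDl -!mulmxA.
by move: (_ *m h) (_ *m (_ *m h)) (_ *m (_ *m h)) => a b c; rewrite addrAC subrK addrK.
Qed.

Lemma derive_u X x : V x -> 'D_X uW x = B x *m (B x *m X) - phiW x *: X - Gm X x *m uW x.
Proof. by move=> Vx; rewrite -nvecE// /nvec addrK. Qed.

Lemma has_der_tr_end xi X x : V x -> has_der (fun z => tr_end z xi) x X
  (flow_coord (- 2 * upsW x (B x *m X) * xi (ix1 n) 0
     - (nu Gm W B x X (dsubmx xi) + upsW x (Gm X x *m dsubmx xi))) 0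
   (xi (ix1 n) 0 *: 'D_X uW x + 'D_X B x *m dsubmx xi)).
Proof.
move=> Vx; have cst (F : normedModType R) (c : F) := has_der_cst c x X.
have hB := has_der_smooth X (rt_B D) Vx; have hu := has_der_smooth X (smooth_uvec D) Vx.
have hph := has_der_smooth X (smooth_phi D) Vx; rewrite (derive_phi D n2 X Vx) in hph.
have := has_der_flow_coord (has_derB (has_der_mul hph (cst _ (xi (ix1 n) 0)))
  (has_der_ups D Vx (cst _ (dsubmx xi)))) (cst _ (xi (ix0 n) 0))
  (has_derD (has_der_scale (cst _ (xi (ix1 n) 0)) hu) (has_der_mulmx hB (cst _ (dsubmx xi)))).
by move=> /has_der_eq; apply; rewrite mulr0 addr0 scale0r !add0r mulmx0 addr0.
Qed.

(** The entries of the endomorphism are [phi], [uvec] and [B]; its being parallel combines the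
    differential equations of these three potentials. *)
Lemma derive_tr_endmx X x : V x ->
  'D_X tr_endmx x = tr_endmx x *m tr_conn X x - tr_conn X x *m tr_endmx x.
Proof.
move=> Vx; apply: eq_mulmx_col => xi.
have hA := has_der_mulmx (has_der_smooth X smooth_tr_endmx Vx) (has_der_cst xi x X).
have := has_der_unique (has_der_near openT I (fun z _ => tr_endmxE z xi) hA) (has_der_tr_end xi X Vx).
rewrite mulmx0 addr0 => ->.
rewrite mulmxBl -!mulmxA (tr_connE X x xi) tr_endmxE (tr_endmxE x xi) tr_connE.
rewrite derive_u// derive_B//.
rewrite /tr_end /tr_act -[X in _ = _ + X]scaleN1r flow_coordZ flow_coordD.
rewrite !flow_coordK0 !flow_coordK1 !flow_coordKd (nuE D n2 _ _ Vx).
have uE c c' z : upsW x (c *: X + c' *: (B x *m X) + z) = c * upsW x X + c' * upsW x (B x *m X) + upsW x z.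
  by rewrite /ups 2!omDl !omZl.
have bR b h : betW x X (b *: uW x + B x *m h) = b * upsW x (B x *m X) + gam W B x X h.
  by rewrite /bet omDr omZr.
have oR b h : omW x X (b *: uW x + B x *m h) = b * upsW x X - betW x X h.
  by rewrite omDr omZr (omBr D _ _ Vx).
rewrite uE bR oR -/(upsW x X); congr flow_coord; [by ring|by ring|].
have mR c c' z : B x *m (c *: X + c' *: (B x *m X) + z) = c *: (B x *m X) + c' *: (B x *m (B x *m X)) + B x *m z.
  by rewrite !mulmxDr -!scalemxAr.
have gR b h : Gm X x *m (b *: uW x + B x *m h) = b *: (Gm X x *m uW x) + Gm X x *m (B x *m h).
  by rewrite mulmxDr -scalemxAr.
rewrite mR gR.
move: (B x *m (B x *m X)) (Gm X x *m uW x) (Gm X x *m (B x *m _)) (B x *m (Gm X x *m _)) (B x *m X) (uW x) => v1 v2 v3 v4 v5 v6.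
by apply/matrixP => i j; rewrite !mxE; ring.
Qed.

Lemma has_der_tr_act xi Y X x : V x -> has_der (fun z => tr_act Y z xi) x X
  (flow_coord (- (nu Gm W B x X Y + upsW x (Gm X x *m Y)) * xi (ix1 n) 0
      + (cB Gm W B x X Y (dsubmx xi) + betW x (Gm X x *m Y) (dsubmx xi)
         + betW x Y (Gm X x *m dsubmx xi)))
    (- (omW x (Gm X x *m Y) (dsubmx xi) + omW x Y (Gm X x *m dsubmx xi)))
    (xi (ix1 n) 0 *: ('D_X B x *m Y) + 'D_X (Gm Y) x *m dsubmx xi)).
Proof.
move=> Vx; have cst (F : normedModType R) (c : F) := has_der_cst c x X.
have hB := has_der_smooth X (rt_B D) Vx; have hG := has_der_smooth X (rt_G D Y) Vx.
have := has_der_flow_coord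
  (has_derD (has_der_mul (has_derN (has_der_ups D Vx (cst _ Y))) (cst _ (xi (ix1 n) 0)))
    (has_der_bet D Vx (cst _ Y) (cst _ (dsubmx xi))))
  (has_derN (has_der_om D Vx (cst _ Y) (cst _ (dsubmx xi))))
  (has_derD (has_derD (cst _ (xi (ix0 n) 0 *: Y))
     (has_der_scale (cst _ (xi (ix1 n) 0)) (has_der_mulmx hB (cst _ Y))))
    (has_der_mulmx hG (cst _ (dsubmx xi)))).
by move=> /has_der_eq; apply; rewrite mulr0 addr0 scale0r !add0r !mulmx0 !addr0.
Qed.

(** The [TM] component uses the Ricci-type formula for the curvature and the derivative of [B]; in
    the other two the derivatives of [uvec] and [B] reproduce the rows of [tr_end] with the same
    factor. *)
Lemma tr_curv X Y x : V x ->
  'D_X (tr_conn Y) x - 'D_Y (tr_conn X) x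
    + (tr_conn X x *m tr_conn Y x - tr_conn Y x *m tr_conn X x) =
  (- 2 * omW x X Y) *: tr_endmx x.
Proof.
move=> Vx; apply: eq_mulmx_col => xi.
have hT P Q : 'D_P (tr_conn Q) x *m xi = flow_coord
    (- (nu Gm W B x P Q + upsW x (Gm P x *m Q)) * xi (ix1 n) 0
      + (cB Gm W B x P Q (dsubmx xi) + betW x (Gm P x *m Q) (dsubmx xi)
         + betW x Q (Gm P x *m dsubmx xi)))
    (- (omW x (Gm P x *m Q) (dsubmx xi) + omW x Q (Gm P x *m dsubmx xi)))
    (xi (ix1 n) 0 *: ('D_P B x *m Q) + 'D_P (Gm Q) x *m dsubmx xi).
  have hA := has_der_mulmx (has_der_smooth P (smooth_tr_conn Q) Vx) (has_der_cst xi x P).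
  have := has_der_unique (has_der_near openT I (fun z _ => tr_connE Q z xi) hA) (has_der_tr_act xi Q P Vx).
  by rewrite mulmx0 addr0.
have E1 (a b p q : 'M[R]_(2 + (n + n))) va vb vq vp wp wq : a *m xi = va -> b *m xi = vb ->
    q *m xi = vq -> p *m xi = vp -> p *m vq = wp -> q *m vp = wq ->
    (a - b + (p *m q - q *m p)) *m xi = va - vb + (wp - wq).
  by move=> <- <- <- <- <- <-; rewrite mulmxDl !mulmxBl !mulmxA.
apply: (etrans (E1 _ _ _ _ _ _ _ _ _ _ (hT X Y) (hT Y X) (tr_connE Y x xi) (tr_connE X x xi)
  (tr_connE X x (tr_act Y x xi)) (tr_connE Y x (tr_act X x xi)))).
rewrite -(scalemxAl (- 2 * omW x X Y)) tr_endmxE.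
rewrite /tr_end /tr_act !flow_coordN flow_coordZ !flow_coordD.
rewrite !flow_coordK0 !flow_coordK1 !flow_coordKd.
rewrite (derive_B X Y Vx) (derive_B Y X Vx) (rt_torsion D Vx Y X).
rewrite (nuE D n2 X Y Vx) (nuE D n2 Y X Vx) (cBE D n2 X Y _ Vx) (cBE D n2 Y X _ Vx).
have oL P a b Q z : omW x P (a *: Q + b *: (B x *m Q) + z) = a * omW x P Q - b * betW x P Q + omW x P z.
  by rewrite 2!omDr !omZr (omBr D _ _ Vx) mulrN.
have bL P a b Q z : betW x P (a *: Q + b *: (B x *m Q) + z) = a * betW x P Q + b * gam W B x P Q + betW x P z.
  by rewrite /bet 2!omDr !omZr.
rewrite !oL !bL (om_anti D Y X Vx) (bet_sym D Y X Vx).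
have gE : gam W B x Y X = - gam W B x X Y by rewrite /gam (om_anti D _ _ Vx).
rewrite gE; move: (gam W B x X Y) => g; congr flow_coord; [by ring|by ring|].
have C := curvE X Y (dsubmx xi) Vx; rewrite curv_increments in C.
have gR P Q a b z : Gm P x *m (a *: Q + b *: (B x *m Q) + z) = a *: (Gm P x *m Q) + b *: (Gm P x *m (B x *m Q)) + Gm P x *m z.
  by rewrite !mulmxDr -!scalemxAr.
rewrite !gR (rt_torsion D Vx Y X).
have {}C := etrans (esym (addrK _ _)) (congr1 (fun v => v + _) (etrans (esym (subrK _ _)) (congr1 (fun v => v + _) C))).
rewrite C; move: (upsW x X) (upsW x Y) (omW x X Y) => r1 r2 r3.
move: (omW x X _) (omW x Y _) (betW x X _) (betW x Y _) (xi _ _) (xi _ _) => r4 r5 r6 r7 r8 r9.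
move: ('D_Y (Gm X) x *m _) (Gm X x *m (Gm Y x *m _)) (Gm Y x *m (Gm X x *m _)) => v1 v2 v3.
do ?[match goal with |- context [@mulmx ?K ?k ?l ?n ?x ?y] => move: (@mulmx K k l n x y) => ? end].
move: (uW x) => v4.
by apply/matrixP => i j; rewrite !mxE; ring.
Qed.

End Tractor.

Lemma has_der_is_derive (R : realType) (W : normedModType R) (f : R -> W) (t : R) d :
  has_der f t 1 d -> is_derive t 1 f d.
Proof. by move=> [df <-]; apply: DeriveDef => //; exact: diff_derivable. Qed.

Lemma is_derive_has_der (R : realType) (W : normedModType R) (f : R -> W) (t : R) d :
  is_derive t 1 f d -> has_der f t 1 d.
Proof. by move=> [df <-]; split => //; exact/derivable1_diffP. Qed.

Lemma derive_scale_dir (R : realType) (V W : normedModType R) (f : V -> W) x (s : R) v :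
  differentiable f x -> 'D_(s *: v) f x = s *: 'D_v f x.
Proof. by move=> df; rewrite (deriveE (s *: v) df) (deriveE v df) linearZ. Qed.

Lemma derive_unit_dir (R : realType) (W : normedModType R) (f : R -> W) (t s : R) :
  differentiable f t -> 'D_s f t = s *: 'D_(1 : R) f t.
Proof. by move=> df; rewrite -(@derive_scale_dir R R)// -[X in _ = 'D_X _ _]/(s * 1) mulr1. Qed.

Lemma has_der_sum (R : realType) (V W : normedModType R) (I : Type) (s : seq I)
    (f : I -> V -> W) x v d : (forall i, has_der (f i) x v (d i)) ->
  has_der (fun z => \sum_(i <- s) f i z) x v (\sum_(i <- s) d i).
Proof.
move=> H; elim: s => [|i s IH].
  by rewrite big_nil; under eq_fun do rewrite big_nil; exact: has_der_cst.
by rewrite big_cons; under eq_fun do rewrite big_cons; exact: has_derD.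
Qed.

Lemma derive_sum_delta (R : realType) (W : normedModType R) m (f : 'cV[R]_m -> W) x v :
  differentiable f x -> 'D_v f x = \sum_i v i 0 *: 'D_(delta_mx i 0) f x.
Proof.
move=> df; rewrite deriveE// [in LHS](matrix_sum_delta v) linear_sum.
by apply: eq_bigr => i _; rewrite big_ord1 linearZ/= deriveE.
Qed.

(** * Radial transport when the curvature is a multiple of one parallel endomorphism *)

Section RadialFrame.
Context {R : realType} {m N : nat} (V : set 'cV[R]_m) (q0 : 'cV[R]_m).
Local Notation E := 'cV[R]_m.
Variables (th : E -> E -> 'M[R]_N) (c : E -> E -> E -> R) (Aa gm : E -> 'M[R]_N).
Variables (A F0 G : 'M[R]_N).
Hypotheses (oV : open V) (Vq0 : V q0).
Hypotheses (sth : forall v, smooth_on V (th v)).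
Hypothesis th_linear : forall x, V x -> forall r u v, th (r *: u + v) x = r *: th u x + th v x.
Hypotheses (sAa : smooth_on V Aa) (sgm : smooth_on V gm) (sc : forall u v, smooth_on V (c u v)).
Hypothesis c_scale : forall x s u v, c (s *: u) v x = s * c u v x.
Hypothesis gm_unit : forall x, V x -> gm x \in unitmx.
Hypothesis gm_parallel : forall x, V x -> forall v,
  'D_v gm x = (th v x)^T *m gm x + gm x *m th v x.
Hypothesis Aa_parallel : forall x, V x -> forall v,
  'D_v Aa x = Aa x *m th v x - th v x *m Aa x.
Hypothesis th_curv : forall x, V x -> forall u v,
  'D_u (th v) x - 'D_v (th u) x + (th u x *m th v x - th v x *m th u x) = c u v x *: Aa x.
(** The second equation is equivalent to [F0^T G F0 = gm q0]; in the form chosen, [F gm^-1 F^T] is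
    simply constant along rays. *)
Hypotheses (AF0 : A *m F0 = F0 *m Aa q0) (F0G : F0 *m invmx (gm q0) *m F0^T *m G = 1%:M).

Definition ray (y : E) (t : R) : E := t *: (y - q0) + q0.

Lemma has_der_ray (W : normedModType R) (f : E -> W) y t : smooth_on V f -> V (ray y t) ->
  has_der (fun s => f (ray y s)) t 1 ('D_(y - q0) f (ray y t)).
Proof.
by move=> sf Vt; apply: is_derive_has_der; apply: is_derive_line; exact: smooth_on_diff sf Vt.
Qed.

Lemma ray0 y : ray y 0 = q0. Proof. by rewrite /ray scale0r add0r. Qed.
Lemma ray1 y : ray y 1 = y. Proof. by rewrite /ray scale1r subrK. Qed.
Lemma ray_sub y t : ray y t - q0 = t *: (y - q0). Proof. by rewrite /ray addrK. Qed.
Lemma ray_ray y s t : ray (ray y s) t = ray y (t * s).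
Proof. by rewrite /ray addrK scalerA. Qed.

Variable r : R.
(** Rays are followed for times in []-1, 3[], the range of [ode_domain], hence the factor [3]. *)
Hypothesis rV : ball q0 (3 * r) `<=` V.
Local Notation U := (ball q0 r).

Lemma ray_V y t : U y -> -1 < t < 3 -> V (ray y t).
Proof.
move=> Uy /andP[t1 t3]; apply: rV; move: Uy; rewrite -ball_normE /ball_/= => Uy.
rewrite /ray opprD addrCA subrr addr0 normrN normrZ distrC.
apply: le_lt_trans (_ : 3 * `|q0 - y| < _); last by rewrite ltr_pM2l.
by apply: ler_wpM2r => //; rewrite ler_norml; apply/andP; split; lra.
Qed.

Lemma ray_U y t : U y -> 0 <= t <= 1 -> U (ray y t).
Proof.
move=> Uy /andP[t0 t1]; move: Uy; rewrite -ball_normE /ball_/= => Uy.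
rewrite /ray opprD addrCA subrr addr0 normrN normrZ distrC.
by apply: le_lt_trans Uy; rewrite ger0_norm// ler_piMl.
Qed.

Lemma U_sub : U `<=` V.
Proof. by move=> y Uy; rewrite -(ray1 y); apply: ray_V => //; apply/andP; split; lra. Qed.

(** This is [th (y - q0)] along the ray, expanded in the basis because smoothness of [th v] is given
    for constant [v] only. *)
Definition ray_coef (p : R * E) : 'M[R]_N :=
  \sum_i (p.2 - q0) i 0 *: th (delta_mx i 0) (ray p.2 p.1).

Lemma th_sum x v : V x -> th v x = \sum_i v i 0 *: th (delta_mx i 0) x.
Proof.
move=> Vx.
pose L : {linear E -> 'M[R]_N} := HB.pack (th^~ x) (GRing.isLinear.Build _ _ _ _ (th^~ x) (th_linear Vx)).
rewrite -[th v x]/(L v) {1}(matrix_sum_delta v) linear_sum; apply: eq_bigr => i _.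
by rewrite big_ord1 linearZ.
Qed.

Lemma th_scale x s v : V x -> th (s *: v) x = s *: th v x.
Proof.
move=> Vx; have th0 : th 0 x = 0.
  have := th_linear Vx 1 0 0; rewrite scaler0 addr0 scale1r => /esym/eqP.
  by rewrite -subr_eq0 addrK => /eqP.
by rewrite -[s *: v]addr0 th_linear// th0 addr0.
Qed.

Lemma ray_coefE y t : U y -> -1 < t < 3 -> ray_coef (t, y) = th (y - q0) (ray y t).
Proof. by move=> Uy ht; rewrite /ray_coef/= -th_sum//; exact: ray_V. Qed.

Lemma open_U : open U.
Proof. exact: ball_open. Qed.

Lemma smooth_ray_coef : smooth_on (ode_domain U) ray_coef.
Proof.
have oD := @ode_domain_open R E U open_U.
have s2 : smooth_on (ode_domain U) (fun p : R * E => p.2 - q0).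
  apply: smooth_onB => //; last exact: smooth_on_cst.
  by apply: (@smooth_on_linear _ _ _ _ _ _ snd) => //; [move=> p; exact: cvg_snd|exact: smooth_on_id].
have s1 : smooth_on (ode_domain U) (fun p : R * E => p.1).
  by apply: (@smooth_on_linear _ _ _ _ _ _ fst) => //; [move=> p; exact: cvg_fst|exact: smooth_on_id].
apply: smooth_on_sum => // i _; apply: smooth_on_scale => //.
  exact: (smooth_on_linmx (@coord_mx R _ _ i 0) oD s2).
apply: (smooth_on_comp (finite_frame_mx _ _) oD _ _ (sth (delta_mx i 0))).
  by move=> [t y] [/= ht Uy]; exact: ray_V.
apply: smooth_onD => //; last exact: smooth_on_cst.
exact: smooth_on_scale.
Qed.

Variable sol : E -> R -> 'M[R]_N.
Hypothesis sol_solves : solves U ray_coef sol.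

Definition frame y := F0 *m sol y 1.

Lemma smooth_frame : smooth_on U frame.
Proof.
apply: smooth_on_mulmx; [exact: open_U|exact: smooth_on_cst|].
exact: (linear_ode_smooth (finite_frame_mx _ _) open_U smooth_ray_coef sol_solves).
Qed.

Lemma itv02_sub13 (t : R) : 0 <= t <= 2 -> -1 < t < 3.
Proof. by move=> /andP[? ?]; apply/andP; split; lra. Qed.

Lemma has_der_sol y t : U y -> 0 <= t <= 2 ->
  has_der (sol y) t 1 (sol y t *m th (y - q0) (ray y t)).
Proof.
move=> Uy ht; have [_ /(_ t ht)] := sol_solves Uy.
by rewrite ray_coefE//; [exact: is_derive_has_der|exact: itv02_sub13].
Qed.

Lemma sol0 y : U y -> sol y 0 = 1%:M.
Proof. by move=> Uy; have [] := sol_solves Uy. Qed.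

Lemma ray_continuous (W : normedModType R) (f : E -> W) y t : U y -> 0 <= t <= 1 ->
  smooth_on V f -> {for t, continuous (fun s => f (ray y s))}.
Proof.
move=> Uy ht sf.
have Vt : V (ray y t) by apply: ray_V => //; exact/itv02_sub13/itv01_sub02.
by have [d _] := has_der_ray sf Vt; exact: differentiable_continuous.
Qed.

Lemma ray_unique p (Z : R -> 'M[R]_(p, N)) y : U y -> Z 0 = 0 ->
  (forall t : R, 0 <= t <= 1 -> has_der Z t 1 (Z t *m th (y - q0) (ray y t))) ->
  forall t : R, 0 <= t <= 1 -> Z t = 0.
Proof.
move=> Uy Z0 dZ.
have ac (t : R) : 0 <= t <= 1 -> {for t, continuous (fun s => th (y - q0) (ray y s))}.
  by move=> ht; exact: ray_continuous.
exact: (linear_ode_unique ac Z0 (fun t ht => has_der_is_derive (dZ t ht))).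
Qed.

Lemma constant_unique p q (Z : R -> 'M[R]_(p, q)) : Z 0 = 0 ->
  (forall t : R, 0 <= t <= 1 -> has_der Z t 1 0) -> forall t : R, 0 <= t <= 1 -> Z t = 0.
Proof.
move=> Z0 dZ.
have ac (t : R) : 0 <= t <= 1 -> {for t, continuous (fun=> 0 : 'M[R]_q)}.
  by move=> _; exact: cst_continuous.
have dZ0 (t : R) : 0 <= t <= 1 -> has_der Z t 1 (Z t *m (0 : 'M[R]_q)).
  by move=> ht; rewrite mulmx0; exact: dZ.
exact: (linear_ode_unique ac Z0 (fun t ht => has_der_is_derive (dZ0 t ht))).
Qed.

(** Both sides extend to solutions of the equation of the shorter ray, the right one after rescaling
    time; they agree by uniqueness. *)
Lemma sol_scale y s : U y -> 0 <= s <= 2 -> U (ray y s) -> sol (ray y s) 1 = sol y s.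
Proof.
move=> Uy hs Us; apply/eqP; rewrite -subr_eq0; apply/eqP.
have h01 : 0 <= (1 : R) <= 1 by rewrite ler01 lexx.
pose Z (t : R) := sol (ray y s) t - sol y (t * s).
suff H (t : R) : 0 <= t <= 1 -> has_der Z t 1 (Z t *m th (ray y s - q0) (ray (ray y s) t)).
  have Z0 : Z 0 = 0 by rewrite /Z mul0r !sol0// subrr.
  by have := ray_unique Us Z0 H h01; rewrite /Z mul1r.
move=> ht; have hts : 0 <= t * s <= 2.
  case/andP: ht => t0 t1; case/andP: hs => s0 s2; rewrite mulr_ge0//=.
  by apply: le_trans (_ : 1 * s <= _); [exact: ler_wpM2r|rewrite mul1r].
have h1 := has_der_sol Us (itv01_sub02 ht).
have [d2 e2] := has_der_sol Uy hts.
have [dm em] := has_der_mul (is_derive_has_der (is_derive_id t 1)) (has_der_cst s t 1).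
have h2 : has_der (fun t : R => sol y (t * s)) t 1 (sol y (t * s) *m th (ray y s - q0) (ray (ray y s) t)).
  split; first exact: (@differentiable_comp _ _ _ _ (fun t : R => t * s) (sol y)).
  rewrite (@derive_comp _ _ _ _ (fun t : R => t * s) (sol y))// em mul1r mulr0 addr0.
  rewrite (derive_unit_dir s d2).
  rewrite e2 ray_ray ray_sub scalemxAr; congr (_ *m _).
  have Vts : V (ray y (t * s)) by apply: ray_V => //; exact: itv02_sub13.
  by rewrite th_scale.
by apply: (has_der_eq (has_derB h1 h2)); rewrite mulmxBl.
Qed.

Lemma radial_frame y : U y -> 'D_(y - q0) frame y = frame y *m th (y - q0) y.
Proof.
move=> Uy; have Uy1 : U (ray y 1) by rewrite ray1.
have h1 : has_der (fun t : R => frame (ray y t)) 1 1 ('D_(y - q0) frame y).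
  have := @is_derive_line R E _ frame q0 (y - q0) 1.
  rewrite -/(ray y 1) ray1 => /(_ (smooth_on_diff smooth_frame Uy)).
  exact: is_derive_has_der.
have hs : has_der (fun t : R => F0 *m sol y t) 1 1 (F0 *m (sol y 1 *m th (y - q0) y)).
  have := has_der_sol Uy (_ : 0 <= (1 : R) <= 2); rewrite ray1 => /(_ _) H.
  have /H h : 0 <= (1 : R) <= 2 by apply/andP; split; lra.
  by apply: (has_der_eq (has_der_mulmx (has_der_cst F0 _ _) h)); rewrite mul0mx add0r.
rewrite /frame -mulmxA; apply: (has_der_unique h1).
(* An open set of times around [1], available because solutions continue past [1]; on it the frame
   along the ray is the solution itself. *)
pose S := [set t : R | 0 < t < 2 /\ U (ray y t)].
have oS : open S.
  rewrite (_ : S = `]0, 2[%classic `&` (ray y @^-1` U)); last first.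
    by apply/seteqP; split=> t /=; rewrite in_itv.
  apply: openI; first exact: itv_open.
  apply: open_comp; last exact: open_U.
  move=> t _; apply: differentiable_continuous.
  by apply: differentiableD; [exact: differentiableZl|exact: differentiable_cst].
apply: (has_der_near oS _ _ hs); first by split=> //; apply/andP; split; lra.
move=> t [/andP[t0 t2] Ut]; rewrite /frame sol_scale//.
by apply/andP; split; exact: ltW.
Qed.

Lemma frame_ray y t : U y -> 0 <= t <= 1 -> frame (ray y t) = F0 *m sol y t.
Proof. by move=> Uy ht; rewrite /frame sol_scale//; [exact: itv01_sub02|exact: ray_U]. Qed.

Lemma has_der_frame_ray y t : U y -> 0 <= t <= 1 ->
  has_der (fun t => F0 *m sol y t) t 1 (F0 *m sol y t *m th (y - q0) (ray y t)).
Proof.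
move=> Uy ht; have h := has_der_sol Uy (itv01_sub02 ht).
by apply: (has_der_eq (has_der_mulmx (has_der_cst F0 _ _) h)); rewrite mul0mx add0r mulmxA.
Qed.

Lemma ray_VU y t : U y -> 0 <= t <= 1 -> V (ray y t).
Proof. by move=> Uy ht; apply: U_sub; exact: ray_U. Qed.

(** As [Aa] is parallel, [F Aa - A F] satisfies the radial equation, and it vanishes at [q0]. *)
Lemma frame_end y : U y -> A *m frame y = frame y *m Aa y.
Proof.
move=> Uy; have h01 : 0 <= (1 : R) <= 1 by rewrite ler01 lexx.
pose Z (t : R) := F0 *m sol y t *m Aa (ray y t) - A *m (F0 *m sol y t).
suff H (t : R) : 0 <= t <= 1 -> has_der Z t 1 (Z t *m th (y - q0) (ray y t)).
  have Z0 : Z 0 = 0 by rewrite /Z sol0// !mulmx1 ray0 AF0 subrr.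
  have /eqP := ray_unique Uy Z0 H h01; rewrite subr_eq0 ray1 => /eqP.
  by rewrite /frame => ->.
move=> ht; have hP := has_der_frame_ray Uy ht; have Vt := ray_VU Uy ht.
have hA := has_der_ray sAa Vt; rewrite (Aa_parallel Vt) in hA.
apply: (has_der_eq (has_derB (has_der_mulmx hP hA) (has_der_mulmx (has_der_cst A _ _) hP))).
rewrite /Z mul0mx add0r mulmxBl mulmxBr !mulmxA.
do ?[match goal with |- context [@mulmx ?K ?k ?l ?n ?x ?y] => move: (@mulmx K k l n x y) => ? end].
by apply/matrixP => i j; rewrite !mxE; ring.
Qed.

Lemma has_der_invmx_ray y t : U y -> 0 <= t <= 1 ->
  has_der (fun t => invmx (gm (ray y t))) t 1
   (- (invmx (gm (ray y t)) *m (th (y - q0) (ray y t))^T + th (y - q0) (ray y t) *m invmx (gm (ray y t)))).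
Proof.
move=> Uy ht; have Vt := ray_VU Uy ht.
have sY := smooth_on_invmx oV gm_unit sgm.
have hY := has_der_ray sY Vt; have hg := has_der_ray sgm Vt; rewrite (gm_parallel Vt) in hg.
apply: (has_der_eq hY); move: hY; move: ('D_ _ (fun _ => invmx _) _) => dY hY.
have gY x : V x -> invmx (gm x) *m gm x = 1%:M by move=> Vx; rewrite mulVmx// gm_unit.
have Yg x : V x -> gm x *m invmx (gm x) = 1%:M by move=> Vx; rewrite mulmxV// gm_unit.
have hp : has_der (fun s => invmx (gm (ray y s)) *m gm (ray y s)) t 1 0.
  pose S := [set s : R | V (ray y s)].
  have oS : open S.
    apply: open_comp => // s _; apply: differentiable_continuous.
    by apply: differentiableD; [exact: differentiableZl|exact: differentiable_cst].
  exact: (has_der_near oS Vt (fun s (Vs : S s) => esym (gY _ Vs)) (has_der_cst 1%:M t 1)).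
have := has_der_unique (has_der_mulmx hY hg) hp.
move=> /(congr1 (mulmx^~ (invmx (gm (ray y t))))); rewrite mul0mx mulmxDl -!mulmxA (Yg _ Vt) mulmx1.
rewrite mulmxDl !mulmxDr -!mulmxA (Yg _ Vt) mulmx1 [X in _ + (_ + X)]mulmxA (gY _ Vt) mul1mx.
by move=> /eqP; rewrite addr_eq0 => /eqP.
Qed.

(** As [gm] is parallel, the derivatives of the three factors of [F gm^-1 F^T] cancel along each
    ray. *)
Lemma frame_form y : U y -> frame y *m invmx (gm y) *m (frame y)^T *m G = 1%:M.
Proof.
move=> Uy; have h01 : 0 <= (1 : R) <= 1 by rewrite ler01 lexx.
pose P (t : R) := F0 *m sol y t *m invmx (gm (ray y t)) *m (F0 *m sol y t)^T.
pose Z (t : R) := P t - F0 *m invmx (gm q0) *m F0^T.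
suff H (t : R) : 0 <= t <= 1 -> has_der Z t 1 0.
  have Z0 : Z 0 = 0 by rewrite /Z /P sol0// !mulmx1 ray0 subrr.
  have /eqP := constant_unique Z0 H h01; rewrite subr_eq0 => /eqP P1.
  by rewrite -F0G -P1 /P ray1.
move=> ht; have hP := has_der_frame_ray Uy ht; have hY := has_der_invmx_ray Uy ht.
have hT := has_der_linmx (@trmx R N N) hP.
apply: (has_der_eq (has_derB (has_der_mulmx (has_der_mulmx hP hY) hT) (has_der_cst _ t 1))).
rewrite /= subr0; move: (F0 *m sol y t) => Q; rewrite trmx_mul mulmxN mulmxDr !(mulmxBl, mulmxDl, mulNmx) !mulmxA.
do ?[match goal with |- context [@mulmx ?K ?k ?l ?n ?x ?y] => move: (@mulmx K k l n x y) => ? end].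
by apply/matrixP => i j; rewrite !mxE; ring.
Qed.

Lemma radial_derivative y v : U y ->
  'D_v frame y + 'D_(y - q0) ('D_v frame) y =
  frame y *m th v y + ('D_v frame y *m th (y - q0) y + frame y *m 'D_v (th (y - q0)) y).
Proof.
move=> Uy; have Vy := U_sub Uy; have sF := smooth_frame.
have hc i : has_der (fun x : E => (x - q0) i 0) y v (v i 0).
  have hid : has_der (fun x : E => x) y v v by split; [|exact: derive_id].
  have := has_der_linmx (@coord_mx R _ _ i 0) (has_derB hid (has_der_cst q0 y v)).
  by rewrite subr0.
have L := has_der_sum (index_enum 'I_m) (fun i => has_der_scale (hc i)
  (has_der_smooth v (smooth_on_derive (delta_mx i 0) sF) Uy)).
have T := has_der_sum (index_enum 'I_m) (fun i => has_der_scale (hc i)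
  (has_der_smooth v (sth (delta_mx i 0)) Vy)).
have Rr := has_der_mulmx (has_der_smooth v sF Uy) T.
have LR : forall x, U x -> \sum_i (x - q0) i 0 *: 'D_(delta_mx i 0) frame x =
    frame x *m \sum_i (x - q0) i 0 *: th (delta_mx i 0) x.
  move=> x Ux; rewrite -derive_sum_delta; last exact: smooth_on_diff sF Ux.
  by rewrite radial_frame// -th_sum//; exact: U_sub.
have d1 := smooth_on_diff sF Uy; have d2 := smooth_on_diff (smooth_on_derive v sF) Uy.
have S2 i : (y - q0) i 0 *: 'D_v ('D_(delta_mx i 0) frame) y = (y - q0) i 0 *: 'D_(delta_mx i 0) ('D_v frame) y.
  exact: (congr1 (fun z => (y - q0) i 0 *: z) (schwarz (delta_mx i 0) v open_U sF Uy)).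
have EL := congr2 +%R (derive_sum_delta v d1)
  (etrans (derive_sum_delta (y - q0) d2) (esym (eq_bigr _ (fun i _ => S2 i)))).
apply: (etrans EL); rewrite -big_split.
apply: (etrans (has_der_unique (has_der_near open_U Uy LR L) Rr)).
rewrite -th_sum// big_split/= -th_sum//.
have -> : \sum_i (y - q0) i 0 *: 'D_v (th (delta_mx i 0)) y = 'D_v (th (y - q0)) y.
  have T' := has_der_sum (index_enum 'I_m) (fun i => has_der_scale (has_der_cst ((y - q0) i 0) y v)
    (has_der_smooth v (sth (delta_mx i 0)) Vy)).
  have [_ ->] := has_der_near oV Vy (fun x Vx => esym (th_sum (y - q0) Vx)) T'.
  by apply: eq_bigr => i _; rewrite scale0r add0r.
by rewrite mulmxDr addrCA.
Qed.

Definition frame_defect v x := frame x *m th v x - 'D_v frame x.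

(** The curvature acts on the frame as [c F Aa = c A F], a known forcing term. The final
    [- frame_defect] is the Euler term from differentiating [x - q0]; multiplying the defect by time
    removes it. *)
Lemma has_der_frame_defect y v : U y -> has_der (frame_defect v) y (y - q0)
  (frame_defect v y *m th (y - q0) y + c (y - q0) v y *: (A *m frame y) - frame_defect v y).
Proof.
move=> Uy; have Vy := U_sub Uy; have sF := smooth_frame.
have hF := has_der_smooth (y - q0) sF Uy; rewrite (radial_frame Uy) in hF.
apply: (has_der_eq (has_derB (has_der_mulmx hF (has_der_smooth (y - q0) (sth v) Vy))
  (has_der_smooth (y - q0) (smooth_on_derive v sF) Uy))).
have Rd := radial_derivative v Uy.
have -> : 'D_(y - q0) ('D_v frame) y = frame y *m th v y +
  ('D_v frame y *m th (y - q0) y + frame y *m 'D_v (th (y - q0)) y) - 'D_v frame y.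
  by rewrite -Rd addrAC subrr add0r.
rewrite frame_end// scalemxAr -th_curv// /frame_defect.
move: ('D_v frame y) (frame y) ('D_v _ y) ('D_ _ (th v) y) (th v y) (th (y - q0) y) => dF F dt dt' t t'.
rewrite !(mulmxDr, mulmxBl, mulmxN) !mulmxA.
do ?[match goal with |- context [@mulmx ?K ?k ?l ?n ?x ?y] => move: (@mulmx K k l n x y) => ? end].
by apply/matrixP => i j; rewrite !mxE; ring.
Qed.

Lemma frame_conn y : U y -> exists lam : E -> R, forall v,
  'D_v frame y = frame y *m th v y - lam v *: (A *m frame y).
Proof.
move=> Uy.
(* With mu' = t c, the matrix t K_v - mu A F along the ray solves the same linear
   equation as F and vanishes at t = 0. *)
suff H v : exists l : R, frame_defect v y = l *: (A *m frame y).
  exists (fun v => sval (cid (H v))) => v.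
  by case: (cid _) => l /= <-; rewrite /frame_defect opprB addrC subrK.
have [|mu [mu0 dmu]] := @antiderivative R (fun t => clamp t * c (y - q0) v (ray y (clamp t))).
  move=> t; have h2 := itv02_sub13 (clamp_range t).
  have dc : differentiable (fun s => c (y - q0) v (ray y s)) (clamp t).
    by have [] := has_der_ray (sc (y - q0) v) (ray_V Uy h2).
  have cc : {for t, continuous (fun s => c (y - q0) v (ray y (clamp s)))}.
    apply: (@continuous_comp _ _ _ clamp (fun s => c (y - q0) v (ray y s))).
      exact: clamp_continuous.
    exact: differentiable_continuous.
  by apply: cvgM; [exact: clamp_continuous|exact: cc].
have h01 : 0 <= (1 : R) <= 1 by rewrite ler01 lexx.
exists (mu 1).
pose Z (t : R) := t *: frame_defect v (ray y t) - mu t *: (A *m (F0 *m sol y t)).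
suff H (t : R) : 0 <= t <= 1 -> has_der Z t 1 (Z t *m th (y - q0) (ray y t)).
  have Z0 : Z 0 = 0 by rewrite /Z mu0 !scale0r subrr.
  have /eqP := ray_unique Uy Z0 H h01; rewrite subr_eq0 ray1 scale1r => /eqP.
  by rewrite /frame.
move=> ht; have [t0 t1] := andP ht.
have hP := has_der_frame_ray Uy ht; have Ut := ray_U Uy ht; have Vt := ray_VU Uy ht.
have hmu : has_der mu t 1 (t * c (y - q0) v (ray y t)).
  apply: is_derive_has_der; have := dmu t; rewrite (clamp_id (itv01_sub02 ht)); apply.
  by apply: lt_le_trans t0; rewrite oppr_lt0 ltr01.
have sK : smooth_on U (frame_defect v).
  apply: smooth_onB; [exact: open_U| |exact: (smooth_on_derive v smooth_frame)].
  apply: smooth_on_mulmx; [exact: open_U|exact: smooth_frame|].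
  exact: (smooth_on_sub U_sub (sth v)).
have hK : has_der (fun s => frame_defect v (ray y s)) t 1 ('D_(y - q0) (frame_defect v) (ray y t)).
  by apply: is_derive_has_der; apply: is_derive_line; exact: smooth_on_diff sK Ut.
have hid : has_der (fun s : R => s) t 1 1 := is_derive_has_der (is_derive_id t 1).
have hA := has_der_mulmx (has_der_cst A t 1) hP.
apply: (has_der_eq (has_derB (has_der_scale hid hK) (has_der_scale hmu hA))).
have [_ dK] := has_der_frame_defect v Ut.
rewrite ray_sub (derive_scale_dir _ _ (smooth_on_diff sK Ut)) (th_scale _ _ Vt) in dK.
rewrite scale1r dK mul0mx add0r /Z (frame_ray Uy ht).
rewrite c_scale; move: (frame_defect v _) (th _ _) (c _ _ _) => K a cw.
rewrite mulmxBl -!scalemxAl -scalemxAr !mulmxA.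
do ?[match goal with |- context [@mulmx ?K ?k ?l ?n ?x ?y] => move: (@mulmx K k l n x y) => ? end].
by apply/matrixP => i j; rewrite !mxE; ring.
Qed.

End RadialFrame.

Theorem radial_frame_exists (R : realType) m N (V : set 'cV[R]_m) (q0 : 'cV[R]_m)
    (th : 'cV[R]_m -> 'cV[R]_m -> 'M[R]_N) (c : 'cV[R]_m -> 'cV[R]_m -> 'cV[R]_m -> R)
    (Aa gm : 'cV[R]_m -> 'M[R]_N) (A F0 G : 'M[R]_N) :
  open V -> V q0 -> (forall v, smooth_on V (th v)) ->
  (forall x, V x -> forall r u v, th (r *: u + v) x = r *: th u x + th v x) ->
  smooth_on V Aa -> smooth_on V gm -> (forall u v, smooth_on V (c u v)) ->
  (forall x s u v, c (s *: u) v x = s * c u v x) ->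
  (forall x, V x -> gm x \in unitmx) ->
  (forall x, V x -> forall v, 'D_v gm x = (th v x)^T *m gm x + gm x *m th v x) ->
  (forall x, V x -> forall v, 'D_v Aa x = Aa x *m th v x - th v x *m Aa x) ->
  (forall x, V x -> forall u v,
    'D_u (th v) x - 'D_v (th u) x + (th u x *m th v x - th v x *m th u x) = c u v x *: Aa x) ->
  A *m F0 = F0 *m Aa q0 -> F0 *m invmx (gm q0) *m F0^T *m G = 1%:M ->
  exists (U : set 'cV[R]_m) (F : 'cV[R]_m -> 'M[R]_N),
    [/\ open U, U q0, U `<=` V, smooth_on U F & F q0 = F0] /\
    forall y, U y -> [/\ A *m F y = F y *m Aa y, F y *m invmx (gm y) *m (F y)^T *m G = 1%:M &
      exists lam : 'cV[R]_m -> R, forall v,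
        'D_v F y = F y *m th v y - lam v *: (A *m F y)].
Proof.
move=> oV Vq0 sth thl sAa sgm sc cs gu gp Ap tc AF0 F0G.
have [e /= e0 eV] := (nbhs_ballP _ _).1 (open_nbhs_nbhs (conj oV Vq0)).
have r0 : 0 < e / 3 by rewrite divr_gt0.
have rV : ball q0 (3 * (e / 3)) `<=` V by rewrite mulrC divfK.
have sr := smooth_ray_coef sth rV.
have [sol ssol] := solves_exists sr.
exists (ball q0 (e / 3)), (frame F0 sol); split.
  have Uq : ball q0 (e / 3) q0 by exact: ballxx.
  split; [exact: ball_open|exact: Uq|exact: U_sub rV| |].
    exact: (smooth_frame F0 sth rV ssol).
  have rq : ray q0 q0 0 = q0 := ray0 q0 q0.
  have := sol_scale sth thl rV ssol (s := 0) Uq; rewrite rq (sol0 ssol Uq) /frame.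
  by move=> ->//; [rewrite mulmx1|rewrite lexx ler0n].
move=> y Uy; split.
- by apply: (frame_end sth thl sAa Ap AF0 rV ssol).
- by apply: (frame_form oV thl sgm gu gp F0G rV ssol).
- exact: (frame_conn oV sth thl sAa sc cs Ap tc AF0 rV ssol Uy).
Qed.

(** * Connections in a chart *)

Section ConnectionMatrices.
Context {R : realType} {m : nat} (V : set 'cV[R]_m) (w : form2 R m) (nabla : covderiv R m).
Local Notation E := 'cV[R]_m.
Hypotheses (oV : open V) (sw : symplectic_form V w) (cn : linear_connection V nabla).
Hypotheses (tf : torsion_free V nabla) (pf : parallel_form V nabla w).

Lemma smooth_near_cst (W : normedModType R) (c : W) (x : E) : smooth_near x (cst c).
Proof. by exists setT; split=> //; [exact: openT|exact: smooth_on_cst]. Qed.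

Lemma smooth_on_near (F : normedModType R) (U : set E) (f : E -> F) :
  (forall x, U x -> smooth_near x f) -> smooth_on U f.
Proof. by move=> H s x Ux; have [U' [_ U'x sU]] := H x Ux; exact: sU. Qed.

Lemma smooth_near_entry (Y : E -> E) x i : smooth_near x Y -> smooth_near x (fun z => Y z i 0).
Proof.
move=> [U [oU Ux sY]]; exists U; split=> //.
exact: (smooth_on_linmx (@coord_mx R _ _ i 0) oU sY).
Qed.

Lemma smooth_near_sum (s : seq 'I_m) (f : 'I_m -> E -> R) x :
  (forall i, smooth_near x (f i)) -> smooth_near x (fun z => \sum_(i <- s) f i z *: (delta_mx i 0 : E)).
Proof.
move=> sf; elim: s => [|i s [U [oU Ux sU]]].
  by under eq_fun do rewrite big_nil; exact: smooth_near_cst.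
have [U' [oU' U'x sU']] := sf i; exists (U `&` U'); split=> //; first exact: openI.
under eq_fun do rewrite big_cons.
have oI := openI oU oU'; apply: smooth_onD => //; last by apply: smooth_on_sub sU => ? [].
apply: smooth_on_scale => //; first by apply: smooth_on_sub sU' => ? [].
exact: smooth_on_cst.
Qed.

Lemma field_sum (Y : E -> E) : Y = (fun z => \sum_i Y z i 0 *: (delta_mx i 0 : E)).
Proof.
by apply/funext => z; rewrite {1}(matrix_sum_delta (Y z)); apply: eq_bigr => i _; rewrite big_ord1.
Qed.

Lemma nabla0l x Y : V x -> smooth_near x Y -> nabla (cst 0) Y x = 0.
Proof.
move=> Vx sY; have s0 := smooth_near_cst (0 : E) x; have s1 := smooth_near_cst (1 : R) x.
have := conn_linearl cn Vx s1 s0 s0 sY.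
have -> : (fun z : E => cst (1 : R) z *: cst (0 : E) z + cst (0 : E) z) = cst (0 : E).
  by apply/funext => z; rewrite scaler0 addr0.
by rewrite scale1r => /esym/eqP; rewrite -subr_eq0 addrK => /eqP.
Qed.

Lemma nabla0r x X : V x -> smooth_near x X -> nabla X (cst 0) x = 0.
Proof.
move=> Vx sX; have s0 := smooth_near_cst (0 : E) x; have s1 := smooth_near_cst (1 : R) x.
have := conn_leibniz cn Vx s1 sX s0 s0.
have -> : (fun z : E => cst (1 : R) z *: cst (0 : E) z + cst (0 : E) z) = cst (0 : E).
  by apply/funext => z; rewrite scaler0 addr0.
by rewrite scaler0 add0r scale1r => /esym/eqP; rewrite -subr_eq0 addrK => /eqP.
Qed.

Lemma nabla_suml x (f : 'I_m -> E -> R) Y (s : seq 'I_m) : V x -> smooth_near x Y ->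
  (forall i, smooth_near x (f i)) ->
  nabla (fun z => \sum_(i <- s) f i z *: (delta_mx i 0 : E)) Y x =
  \sum_(i <- s) f i x *: nabla (cst (delta_mx i 0)) Y x.
Proof.
move=> Vx sY sf; elim: s => [|i s IH].
  by rewrite big_nil; under eq_fun do rewrite big_nil; exact: nabla0l.
rewrite big_cons -IH; under eq_fun do rewrite big_cons.
exact: (conn_linearl cn Vx (sf i) (smooth_near_cst _ x) (smooth_near_sum s sf) sY).
Qed.

Lemma nabla_sumr x (f : 'I_m -> E -> R) X (s : seq 'I_m) : V x -> smooth_near x X ->
  (forall i, smooth_near x (f i)) ->
  nabla X (fun z => \sum_(i <- s) f i z *: (delta_mx i 0 : E)) x =
  \sum_(i <- s) ('D_(X x) (f i) x *: (delta_mx i 0 : E) + f i x *: nabla X (cst (delta_mx i 0)) x).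
Proof.
move=> Vx sX sf; elim: s => [|i s IH].
  by rewrite big_nil; under eq_fun do rewrite big_nil; exact: nabla0r.
rewrite big_cons -IH; under eq_fun do rewrite big_cons.
exact: (conn_leibniz cn Vx (sf i) sX (smooth_near_cst _ x) (smooth_near_sum s sf)).
Qed.

Definition christoffel u x : 'M[R]_m := \matrix_(i, j) nabla (cst u) (cst (delta_mx j 0)) x i 0.

Lemma nabla_tensorial x X Y : V x -> smooth_near x X -> smooth_near x Y ->
  nabla X Y x = nabla (cst (X x)) Y x.
Proof.
move=> Vx sX sY; have e i := smooth_near_entry i sX.
have e' i := smooth_near_entry i (smooth_near_cst (X x) x).
by rewrite [X in LHS]field_sum (nabla_suml _ Vx sY e) (field_sum (cst (X x))) (nabla_suml _ Vx sY e').
Qed.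

Lemma nablaE x X Y : V x -> smooth_near x X -> smooth_near x Y ->
  nabla X Y x = 'D_(X x) Y x + christoffel (X x) x *m Y x.
Proof.
move=> Vx sX sY; have e i := smooth_near_entry i sY.
have [U [oU Ux sU]] := sY.
rewrite nabla_tensorial// [Y in LHS]field_sum.
rewrite (nabla_sumr _ Vx (smooth_near_cst (X x) x) e) big_split/=; congr (_ + _).
  rewrite [RHS](matrix_sum_delta ('D_(X x) Y x)); apply: eq_bigr => i _.
  by rewrite big_ord1 (derive_coord _ _ _ (smooth_on_diff sU Ux)).
apply/matrixP => i j; rewrite ord1 !mxE summxE; apply: eq_bigr => k _.
by rewrite !mxE mulrC.
Qed.

Local Notation Gm := christoffel.

Lemma nabla_cst u v x : V x -> nabla (cst u) (cst v) x = Gm u x *m v.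
Proof.
move=> Vx; rewrite (nablaE Vx (smooth_near_cst u x) (smooth_near_cst v x)).
by rewrite derive_cst add0r.
Qed.

Lemma smooth_christoffel u : smooth_on V (Gm u).
Proof.
apply/(smooth_on_mxP _ oV) => i j; under eq_fun do rewrite mxE.
apply: (smooth_on_linmx (@coord_mx R _ _ i 0) oV); apply: smooth_on_near => x Vx.
exact: (conn_smooth cn Vx (smooth_near_cst _ x) (smooth_near_cst _ x)).
Qed.

Lemma christoffel_linear x : V x -> forall r u v, Gm (r *: u + v) x = r *: Gm u x + Gm v x.
Proof.
move=> Vx r u v; apply: eq_mulmx_col => xi; rewrite mulmxDl -scalemxAl -!(nabla_cst _ _ Vx).
have c0 (W : normedModType R) (k : W) := smooth_near_cst k x.
exact: (conn_linearl cn Vx (c0 _ r) (c0 _ u) (c0 _ v) (c0 _ xi)).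
Qed.

Lemma lie_bracket_cst (u v : E) : lie_bracket (cst u) (cst v) = cst 0.
Proof. by apply: funext => x; rewrite /lie_bracket !derive_cst subrr. Qed.

Lemma christoffel_sym x : V x -> forall u v, Gm u x *m v = Gm v x *m u.
Proof.
move=> Vx u v; have := tf Vx (smooth_near_cst u x) (smooth_near_cst v x).
by rewrite lie_bracket_cst !nabla_cst// => /eqP; rewrite subr_eq0 => /eqP.
Qed.

Lemma curvature_cst u v z x : V x ->
  curvature nabla (cst u) (cst v) (cst z) x = curv Gm u v x *m z.
Proof.
move=> Vx; have c0 (k : E) := smooth_near_cst k x.
have sN a : smooth_near x (nabla (cst a) (cst z)) by exact: (conn_smooth cn).
have D2 a b : nabla (cst a) (nabla (cst b) (cst z)) x = 'D_a (Gm b) x *m z + Gm a x *m (Gm b x *m z).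
  rewrite (nablaE Vx (c0 a) (sN b)) nabla_cst//; congr (_ + _).
  have h := has_der_mulmx (has_der_smooth a (smooth_christoffel b) Vx) (has_der_cst z x a).
  have [_ ->] := has_der_near oV Vx (fun y Vy => esym (nabla_cst b z Vy)) h.
  by rewrite mulmx0 addr0.
rewrite /curvature lie_bracket_cst (nabla0l Vx (c0 z)) subr0 !D2 /curv.
rewrite mulmxDl !mulmxBl -!mulmxA opprD addrACA.
by [].
Qed.

(** On constant fields, [P a b c] is the second covariant derivative of [c] along [b], then [a]. It
    is symmetric in [b] and [c] by vanishing torsion, so the cyclic sum of its differences
    cancels. *)
Lemma first_bianchi x u v h : V x ->
  curv Gm u v x *m h + curv Gm v h x *m u + curv Gm h u x *m v = 0.
Proof.
move=> Vx; have sG := smooth_christoffel.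
have [P [C PS]] : exists P : E -> E -> E -> E,
    (forall a b c, curv Gm a b x *m c = P a b c - P b a c) /\ forall a b c, P a b c = P a c b.
  exists (fun a b c => 'D_a (Gm b) x *m c + Gm a x *m (Gm b x *m c)); split=> a b c.
    by rewrite /curv mulmxDl !mulmxBl -!mulmxA opprD addrACA.
  have h1 := has_der_mulmx (has_der_smooth a (sG b) Vx) (has_der_cst c x a).
  have h2 := has_der_mulmx (has_der_smooth a (sG c) Vx) (has_der_cst b x a).
  have := has_der_unique (has_der_near oV Vx (fun y Vy => christoffel_sym Vy b c) h1) h2.
  by rewrite !mulmx0 !addr0 (christoffel_sym Vx b c) => ->.
apply: (etrans (congr2 +%R (congr2 +%R (C u v h) (C v h u)) (C h u v))).
rewrite (PS u h v) (PS v h u) (PS h v u).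
move: (P u v h) (P v u h) (P h u v) => a b c.
by apply/matrixP => i j; rewrite !mxE; ring.
Qed.

Definition form_mx x : 'M[R]_m := \matrix_(i, j) w x (delta_mx i 0) (delta_mx j 0).

Lemma form_mxE x u v : V x -> w x u v = om form_mx x u v.
Proof.
move=> Vx; have [wl wa _ _ _] := sw.
have wD a u1 u2 v1 : w x (a *: u1 + u2) v1 = a * w x u1 v1 + w x u2 v1 by exact: wl.
have L0 v1 : w x 0 v1 = 0.
  by have := wD 1 0 0 v1; rewrite scaler0 addr0 mul1r => /esym/eqP; rewrite -subr_eq0 addrK => /eqP.
have S u1 v1 : w x u1 v1 = \sum_i u1 i 0 * w x (delta_mx i 0) v1.
  rewrite {1}(matrix_sum_delta u1).
  have : forall s : seq 'I_m, w x (\sum_(i <- s) \sum_j u1 i j *: delta_mx i j) v1 =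
      \sum_(i <- s) u1 i 0 * w x (delta_mx i 0) v1.
    by elim=> [|i s IH]; rewrite ?big_nil// !big_cons -IH -wD big_ord1.
  exact.
rewrite S /om /bform -mulmxA mxE; apply: eq_bigr => i _; rewrite !mxE; congr (_ * _).
rewrite (wa _ Vx) S -sumrN; apply: eq_bigr => j _.
by rewrite !mxE (wa _ Vx (delta_mx i 0)) mulNr mulrC.
Qed.

Lemma smooth_form_mx : smooth_on V form_mx.
Proof.
apply/(smooth_on_mxP _ oV) => i j; under eq_fun do rewrite mxE.
by have [_ _ sm _ _] := sw; exact: sm.
Qed.

Lemma form_mx_anti x : V x -> (form_mx x)^T = - form_mx x.
Proof. by move=> Vx; have [_ wa _ _ _] := sw; apply/matrixP => i j; rewrite !mxE (wa _ Vx). Qed.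

Lemma form_mx_unit x : V x -> form_mx x \in unitmx.
Proof.
move=> Vx; have [_ _ _ _ nd] := sw; apply: inj_unitmx => h Wh; apply: (nd _ Vx) => v.
rewrite form_mxE// /om (bform_antisym (form_mx_anti Vx)) /bform -mulmxA Wh mulmx0 mxE.
by rewrite oppr0.
Qed.

Lemma derive_form_mx x u : V x ->
  'D_u form_mx x = (Gm u x)^T *m form_mx x + form_mx x *m Gm u x.
Proof.
move=> Vx; apply: eq_mulmx_bilin => a b.
rewrite mulmxDr mulmxDl [RHS]mxE !mulmxA -trmx_mul -(mulmxA _ (Gm u x) b).
have c0 (k : E) := smooth_near_cst k x.
have := pf Vx (c0 u) (c0 a) (c0 b); rewrite !nabla_cst// !form_mxE//= => <-.
have hW := has_der_smooth u smooth_form_mx Vx.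
have h := has_der_linmx (@coord_mx R 1 1 0 0) (has_der_mulmx (has_der_mulmx (has_der_cst a^T x u) hW)
  (has_der_cst b x u)).
have [_ ->] := has_der_near oV Vx (fun y Vy => esym (form_mxE a b Vy)) h.
by rewrite mulmx0 addr0 mul0mx add0r.
Qed.

End ConnectionMatrices.

(** * The Ricci-type condition in terms of Christoffel matrices *)

Section RicciTypeChart.
Context {R : realType} {m : nat} (V : set 'cV[R]_m) (w : form2 R m) (nabla : covderiv R m).
Local Notation E := 'cV[R]_m.
Hypotheses (oV : open V) (sw : symplectic_form V w) (cn : linear_connection V nabla).
Hypotheses (tf : torsion_free V nabla) (pf : parallel_form V nabla w).
Hypothesis m2 : (2 < m)%N.
Variable rho : E -> E -> E.
Hypothesis rho_ricci : forall x, V x -> forall u v, w x u (rho x v) = ricci nabla x u v.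
Hypothesis rho_curv : forall x X Y Z, V x ->
  smooth_near x X -> smooth_near x Y -> smooth_near x Z ->
  curvature nabla X Y Z x = (m + 2)%:R^-1 *:
        ((2 * w x (X x) (Y x)) *: rho x (Z x) + w x (X x) (Z x) *: rho x (Y x)
         - w x (Y x) (Z x) *: rho x (X x) + w x (X x) (rho x (Z x)) *: Y x
         - w x (Y x) (rho x (Z x)) *: X x).
Local Notation Gm := (christoffel nabla).
Local Notation W := (form_mx w).

Lemma ricciE x u v : V x ->
  ricci nabla x u v = \sum_i (curv Gm u (delta_mx i 0) x *m v) i 0.
Proof.
by move=> Vx; rewrite /ricci /mxtrace; apply: eq_bigr => i _; rewrite mxE (curvature_cst oV cn).
Qed.

Definition ricci_mx x : 'M[R]_m := \matrix_(i, j) ricci nabla x (delta_mx i 0) (delta_mx j 0).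
Definition rho_mx x : 'M[R]_m := invmx (W x) *m ricci_mx x.

(** [rho] is given as a bare function; nondegeneracy of the form transfers to it the linearity of
    the Ricci form, and the explicit matrix then shows its smoothness. *)
Lemma rho_mxE x v : V x -> rho x v = rho_mx x *m v.
Proof.
move=> Vx; have Wu := form_mx_unit sw Vx; have WT := form_mx_anti sw Vx.
have rE u v' : om W x u (rho x v') = ricci nabla x u v' by rewrite -(form_mxE sw)// rho_ricci.
have rlin r a b : rho x (r *: a + b) = r *: rho x a + rho x b.
  apply: (bform_inj WT Wu) => t; rewrite (bform_antisym WT (rho x _)) (bform_antisym WT _ t).
  congr (- _); rewrite [LHS]rE [RHS](omDr W x (r *: rho x a) (rho x b)) (omZr W x r (rho x a)).
  rewrite !rE !ricciE// mulr_sumr -big_split; apply: eq_bigr => i _.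
  by rewrite mulmxDr -scalemxAr !mxE.
rewrite -(mul_col_matrix (f := rho x) v rlin); congr (_ *m _).
rewrite /rho_mx; apply: (can_inj (mulKmx Wu)); rewrite mulKVmx//.
apply/matrixP => i j; rewrite [RHS]mxE -rE /om /bform.
rewrite trmx_delta -mulmxA -rowE mxE; rewrite !mxE; apply: eq_bigr => k _.
by rewrite !mxE.
Qed.

Lemma smooth_rho_mx : smooth_on V rho_mx.
Proof.
apply: smooth_on_mulmx => //; first exact: (smooth_on_invmx oV (form_mx_unit sw) (smooth_form_mx oV sw)).
apply/(smooth_on_mxP _ oV) => i j; under eq_fun do rewrite mxE.
apply: (smooth_on_ext (f := fun x => \sum_k (curv Gm (delta_mx i 0) (delta_mx k 0) x *m delta_mx j 0) k 0) oV).
  by move=> x Vx; rewrite ricciE.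
apply: smooth_on_sum => // k _; apply: (smooth_on_linmx (@coord_mx R _ _ k 0) oV).
apply: smooth_on_mulmx => //; last exact: smooth_on_cst.
have sG := smooth_christoffel oV cn.
apply: smooth_onD => //; first by apply: smooth_onB => //; exact: smooth_on_derive.
by apply: smooth_onB => //; exact: smooth_on_mulmx.
Qed.

Definition ricci_endmx x : 'M[R]_m := (- (m + 2)%:R^-1) *: rho_mx x.

Lemma curv_ricci_type x u v h : V x -> curv Gm u v x *m h =
  (- 2 * om W x u v) *: (ricci_endmx x *m h) - om W x u h *: (ricci_endmx x *m v)
  + om W x v h *: (ricci_endmx x *m u) - om W x u (ricci_endmx x *m h) *: v
  + om W x v (ricci_endmx x *m h) *: u.
Proof.
move=> Vx; have c0 (k : E) := smooth_near_cst k x.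
rewrite -(curvature_cst oV cn u v h Vx) (rho_curv Vx (c0 u) (c0 v) (c0 h)).
rewrite /cst !(form_mxE sw)// !(rho_mxE _ Vx) /ricci_endmx -!scalemxAl !(omZr W x).
move: ((m + 2)%:R^-1) (om W x u v) (om W x u h) (om W x v h) (om W x u _) (om W x v _) => k a b c d e.
move: (rho_mx x *m h) (rho_mx x *m u) (rho_mx x *m v) => f g i.
by apply/matrixP => i' j; rewrite !mxE; ring.
Qed.

(** Inserting the Ricci-type formula into the first Bianchi identity leaves, for the antisymmetric
    part [S], the relation [S(u, v) h + S(v, h) u + S(h, u) v = 0]. Three distinct directions force
    [S = 0]. *)
Lemma ricci_endmx_sym x a b : V x -> om W x a (ricci_endmx x *m b) = om W x b (ricci_endmx x *m a).
Proof.
move=> Vx; pose B := ricci_endmx x.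
pose S := W x *m B - (W x *m B)^T.
have aS u v : om W x u (B *m v) - om W x v (B *m u) = (u^T *m S *m v) 0 0.
  have -> : om W x v (B *m u) = (u^T *m (W x *m B)^T *m v) 0 0.
    have tr1 (M : 'M[R]_1) : M 0 0 = M^T 0 0 by rewrite mxE.
    by rewrite [RHS]tr1 !trmx_mul !trmxK /om /bform !mulmxA.
  have E2 (M N : 'M[R]_1) : (M - N) 0 0 = M 0 0 - N 0 0 by rewrite !mxE.
  by rewrite /S mulmxBr mulmxBl E2 /om /bform !mulmxA.
suff S0 : S = 0.
  by apply/eqP; rewrite -subr_eq0 aS S0 mulmx0 mul0mx mxE.
have key (u v h : E) : (u^T *m S *m v) 0 0 *: h + (v^T *m S *m h) 0 0 *: u + (h^T *m S *m u) 0 0 *: v = 0.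
  have := first_bianchi oV cn tf u v h Vx; rewrite !(curv_ricci_type _ _ _ Vx) -!aS -/B => H0.
  have WT := form_mx_anti sw Vx; rewrite -[RHS]H0 /om.
  rewrite (bform_antisym WT v u) (bform_antisym WT h u) (bform_antisym WT h v).
  do ?[match goal with |- context [bform ?M ?p ?q] => move: (bform M p q) => ? end].
  move: (B *m h) (B *m u) (B *m v) => f g k.
  by apply/matrixP => i j; rewrite !mxE; ring.
apply/matrixP => i j; rewrite [RHS]mxE.
(* As [m > 2], some index differs from [i] and [j]; the coordinate of [key] along it is exactly
   [S i j]. *)
have [k] : exists k : 'I_m, k \in [predC [:: i; j]].
  apply/card_gt0P; rewrite -(ltn_add2l #|[:: i; j]|) addn0 cardC card_ord.
  apply: leq_ltn_trans m2; exact: (card_size [:: i; j]).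
rewrite !inE negb_or => /andP[ki kj].
have := congr1 (fun v : E => v k 0) (key (delta_mx i 0) (delta_mx j 0) (delta_mx k 0)).
by rewrite !mx_delta_entry !mxE !eqxx (negPf ki) (negPf kj) !mulr0 !addr0 mulr1.
Qed.

Lemma ricci_type_chart : ricci_type_data V Gm W ricci_endmx.
Proof.
have anti x := @form_mx_anti _ _ _ w sw x.
have Bsp x : V x -> forall a b, om W x (ricci_endmx x *m a) b = - om W x a (ricci_endmx x *m b).
  move=> Vx a b; apply: (etrans (bform_antisym (anti _ Vx) _ _)); congr (- _).
  exact: ricci_endmx_sym.
split.
- exact: oV.
- exact: (smooth_christoffel oV cn).
- exact: (christoffel_linear cn).
- exact: (christoffel_sym cn tf).
- exact: (smooth_form_mx oV sw).
- exact: anti.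
- exact: (form_mx_unit sw).
- by move=> x Vx u; exact: (derive_form_mx oV sw cn pf u Vx).
- by apply: smooth_on_scale => //; [exact: smooth_on_cst|exact: smooth_rho_mx].
- exact: Bsp.
move=> x Vx u v h t; rewrite (curv_ricci_type u v h Vx) /kform /bet !(Bsp _ Vx _ h).
move: (om W x u v) (om W x u h) (om W x v h) (om W x u _) (om W x v _) => a b c d e.
by rewrite !(omDl, omNl, omZl); ring.
Qed.

End RicciTypeChart.

(** * Embedding into Sigma A *)

Section LinearDarboux.
Context {R : realType} {m : nat} (W : 'M[R]_m).
Hypotheses (WT : W^T = - W) (Wu : W \in unitmx).

Definition isotropic_pair k (P Q : 'M[R]_(m, k)) :=
  [/\ P^T *m W *m P = 0, Q^T *m W *m Q = 0 & P^T *m W *m Q = 1%:M].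

Lemma mulmx_anti k l (P : 'M[R]_(m, k)) (Q : 'M[R]_(m, l)) :
  (P^T *m W *m Q)^T = - (Q^T *m W *m P).
Proof. by rewrite !trmx_mul trmxK WT mulNmx mulmxN mulmxA. Qed.

(** By rank, some nonzero [v] is orthogonal to the span of the pair. A vector dual to [v], projected
    to that orthogonal space, completes the next hyperbolic plane. *)
Lemma isotropic_pair_extend k (P Q : 'M[R]_(m, k)) : (k + k < m)%N ->
  isotropic_pair P Q -> exists P' Q' : 'M[R]_(m, k + 1), isotropic_pair P' Q'.
Proof.
move=> km [PP QQ PQ].
have QP : Q^T *m W *m P = - 1%:M.
  by rewrite -[LHS]opprK -mulmx_anti PQ trmx1.
pose K := kermx (W *m row_mx P Q).
have /rowV0Pn[u uK u0] : K != 0.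
  by rewrite kermx_eq0 /row_free neq_ltn (leq_ltn_trans (rank_leq_col _) km).
pose v := u^T.
have [vP vQ] : v^T *m W *m P = 0 /\ v^T *m W *m Q = 0.
  move/sub_kermxP: uK; rewrite mul_mx_row mul_mx_row !mulmxA -row_mx0 trmxK => /eq_row_mx[].
  by [].
have [x vx] : exists x : 'cV[R]_m, v^T *m W *m x = 1%:M.
  have /rV0Pn[i ci] : v^T *m W != 0.
    apply: contra u0 => /eqP vW; rewrite -(trmxK u) -/v -(mulmxK Wu v^T) vW mul0mx.
    exact: eqxx.
  move: (v^T *m W) ci => z ci; exists ((z 0 i)^-1 *: delta_mx i 0); rewrite -scalemxAr -colE.
  by apply/matrixP => a b; rewrite !ord1 !mxE mulVf.
(* The symplectic projection of [x] off the span of [P] and [Q]; its pairing with [v] is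
   unchanged. *)
pose f := x + P *m (Q^T *m W *m x) - Q *m (P^T *m W *m x).
have fE l (Z : 'M[R]_(m, l)) : Z^T *m W *m f = Z^T *m W *m x +
   Z^T *m W *m P *m (Q^T *m W *m x) - Z^T *m W *m Q *m (P^T *m W *m x).
  by rewrite /f mulmxBr mulmxDr !mulmxA.
have Pf : P^T *m W *m f = 0 by rewrite fE PP PQ mul0mx mul1mx addr0 subrr.
have Qf : Q^T *m W *m f = 0 by rewrite fE QP QQ mul0mx mulNmx mul1mx subr0 subrr.
have vf : v^T *m W *m f = 1%:M by rewrite fE vP vQ !mul0mx addr0 subr0.
have sk (z : 'cV[R]_m) : z^T *m W *m z = 0.
  apply/matrixP => i j; rewrite !ord1 [RHS]mxE -/(bform W z z).
  by have := bform_antisym WT z z; lra.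
have block l (a b : 'M[R]_(m, l)) (c d : 'cV[R]_m) : (row_mx a c)^T *m W *m row_mx b d =
    block_mx (a^T *m W *m b) (a^T *m W *m d) (c^T *m W *m b) (c^T *m W *m d).
  by rewrite tr_row_mx mul_col_mx mul_col_row.
exists (row_mx P v), (row_mx Q f); split.
- rewrite block PP vP sk -[P^T *m W *m v]trmxK mulmx_anti vP oppr0 trmx0.
  exact: block_mx0.
- rewrite block QQ sk Qf -[f^T *m W *m Q]trmxK mulmx_anti Qf oppr0 trmx0.
  exact: block_mx0.
by rewrite block PQ Pf vQ vf -scalar_mx_block.
Qed.

End LinearDarboux.

Lemma linear_darboux (R : realType) n (W : 'M[R]_(n + n)) : W^T = - W -> W \in unitmx ->
  exists T : 'M[R]_(n + n), T^T *m stdJ R n *m T = W.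
Proof.
move=> WT Wu.
have H k : (k <= n)%N -> exists P Q : 'M[R]_(n + n, k), isotropic_pair W P Q.
  elim: k => [_|k IH kn].
    by exists 0, 0; split; apply/matrixP => i j; case: i.
  have [P [Q PQ]] := IH (ltnW kn); rewrite -addn1.
  by apply: isotropic_pair_extend PQ => //; rewrite !addnn ltn_double.
have [P [Q [PP QQ PQ]]] := H n (leqnn n).
pose S := row_mx P Q.
have SJ : S^T *m W *m S = stdJ R n.
  rewrite /S tr_row_mx mul_col_mx mul_col_row PP QQ PQ -[Q^T *m W *m P]opprK.
  by rewrite -(mulmx_anti WT) PQ trmx1.
have Su : S \in unitmx.
  have : S^T *m (W *m S *m - stdJ R n) = 1%:M by rewrite !mulmxA SJ mulmxN stdJ_sq opprK.
  by move=> /mulmx1_unit[]; rewrite unitmx_tr.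
exists (invmx S).
by rewrite -SJ !mulmxA -trmx_mul mulmxV// trmx1 mul1mx -mulmxA mulmxV// mulmx1.
Qed.

(** The interface between the tractor frame and the reduction. In [hf_derive] the same [lam]
    multiplies [A] for [s] and for [H]: the error is an infinitesimal motion along the flow. *)
Record horizontal_frame (R : realType) n (A : 'M[R]_(2 + (n + n))) (U : set 'cV[R]_(n + n))
    (Gm : 'cV[R]_(n + n) -> 'cV[R]_(n + n) -> 'M[R]_(n + n)) (W : 'cV[R]_(n + n) -> 'M[R]_(n + n))
    (s : 'cV[R]_(n + n) -> 'cV[R]_(2 + (n + n)))
    (H : 'cV[R]_(n + n) -> 'M[R]_(2 + (n + n), n + n)) : Prop := HorizontalFrame {
  hf_open : open U;
  hf_s : smooth_on U s;
  hf_H : smooth_on U H;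
  hf_Sigma : forall y, U y -> Omega' (s y) (A *m s y) = 1;
  hf_orth : forall y, U y -> forall v, Omega' (H y *m v) (s y) = 0;
  hf_orthA : forall y, U y -> forall v, Omega' (H y *m v) (A *m s y) = 0;
  hf_symplectic : forall y, U y -> forall v w, Omega' (H y *m v) (H y *m w) = om W y v w;
  hf_derive : forall y, U y -> exists lam : 'cV[R]_(n + n) -> R, forall v,
    'D_v s y = H y *m v - lam v *: (A *m s y) /\
    forall w, 'D_v H y *m w = H y *m (Gm v y *m w)
      + Omega' (A *m (H y *m v)) (H y *m w) *: s y
      - Omega' (H y *m v) (H y *m w) *: (A *m s y) - lam v *: (A *m (H y *m w)) }.

(** * The tractor frame as an embedding into [Sigma A] *)

Section TractorEmbedding.
Context {R : realType} {n : nat} (V : set 'cV[R]_(n + n)).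
Local Notation E := 'cV[R]_(n + n).
Local Notation E' := 'cV[R]_(2 + (n + n)).
Variables (Gm : E -> E -> 'M[R]_(n + n)) (W B : E -> 'M[R]_(n + n)).
Hypothesis D : ricci_type_data V Gm W B.
Hypothesis n2 : (2 < n + n)%N.
Local Notation omW := (om W).
Local Notation betW := (bet W B).
Local Notation upsW := (ups Gm W B).
Local Notation Aa := (tr_endmx Gm W B).
Local Notation th := (tr_conn Gm W B).

Lemma flow_coord_e0 : flow_coord 1 0 0 = e0 R n.
Proof.
by apply: flow_coord_ext; rewrite ?(flow_coordK0, flow_coordK1, flow_coordKd) ?(o0_ix0, o0_ix1, dsubmx_o0).
Qed.

Lemma flow_coord_vertical (h : E) : flow_coord 0 0 h = col_mx 0 1%:M *m h :> E'.
Proof. by rewrite flow_coord_sum !scale0r !add0r. Qed.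

Lemma ups0 x : upsW x 0 = 0. Proof. exact: bform0l. Qed.
Lemma om0r x a : omW x a 0 = 0. Proof. exact: bform0r. Qed.
Lemma bet0r x a : betW x a 0 = 0. Proof. exact: bform0r. Qed.

Lemma tr_end_coord x a b h : Aa x *m flow_coord a b h =
  flow_coord (phi Gm W B x * b - upsW x h) a (b *: uvec Gm W B x + B x *m h).
Proof. by rewrite tr_endmxE /tr_end flow_coordK0 flow_coordK1 flow_coordKd. Qed.

Lemma tr_conn_coord v x a b h : th v x *m flow_coord a b h =
  flow_coord (- upsW x v * b + betW x v h) (- omW x v h) (a *: v + b *: (B x *m v) + Gm v x *m h).
Proof. by rewrite tr_connE /tr_act flow_coordK0 flow_coordK1 flow_coordKd. Qed.

Lemma gform_coord x a b h a' b' h' :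
  gform W x (flow_coord a b h) (flow_coord a' b' h') = a * b' - b * a' + omW x h h'.
Proof. by rewrite /gform !flow_coordK0 !flow_coordK1 !flow_coordKd. Qed.

Theorem tractor_embedding q0 : V q0 ->
  exists (A : 'M[R]_(2 + (n + n))) (U : set E) (s : E -> E') (H : E -> 'M[R]_(2 + (n + n), n + n)),
    [/\ in_sp A, Sigma A (e0 R n), U q0, U `<=` V & s q0 = e0 R n] /\ horizontal_frame A U Gm W s H.
Proof.
move=> Vq0.
have [T TW] := linear_darboux (rt_Wanti D Vq0) (rt_Wunit D Vq0).
(* The identity on [R^2] makes the embedding start at [e0]; the linear Darboux matrix [T] makes [F0]
   carry the tractor form at [q0] to [Omega']. *)
pose F0 : 'M[R]_(2 + (n + n)) := block_mx 1%:M 0 0 T.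
have F0g : F0^T *m OmegaMx R n *m F0 = tr_form W q0.
  rewrite /F0 /OmegaMx tr_block_mx !trmx0 trmx1 !mulmx_block.
  by rewrite !(mul0mx, mulmx0, addr0, add0r, mul1mx, mulmx1) TW.
have F0u : F0 \in unitmx.
  have : F0^T *m (OmegaMx R n *m F0 *m invmx (tr_form W q0)) = 1%:M.
    by rewrite !mulmxA F0g mulmxV//; exact: (tr_form_unit D).
  by move=> /mulmx1_unit[]; rewrite unitmx_tr.
(* [A] is the parallel endomorphism at [q0] conjugated by [F0]; it is determined before any
   reduction is chosen. *)
have [A AF0] : exists A, A *m F0 = F0 *m Aa q0.
  by exists (F0 *m Aa q0 *m invmx F0); rewrite mulmxKV.
have F0G : F0 *m invmx (tr_form W q0) *m F0^T *m OmegaMx R n = 1%:M.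
  rewrite -!mulmxA; apply: mulmx1C; rewrite -!mulmxA (mulmxA _ _ F0) F0g.
  by rewrite mulVmx//; exact: (tr_form_unit D).
pose c (u v x : E) : R := - 2 * omW x u v.
have sc u v : smooth_on V (c u v).
  apply: smooth_onM; [exact: rt_open D|exact: smooth_on_cst|].
  by apply: (smooth_om D); exact: smooth_on_cst.
have cs x r u v : c (r *: u) v x = r * c u v x by rewrite /c omZl; ring.
have [U [F [[oU Uq UV sF Fq] HF]]] := radial_frame_exists (rt_open D) Vq0 (smooth_tr_conn D)
  (fun x Vx r u v => tr_conn_linear D r u v Vx) (smooth_tr_endmx D) (smooth_tr_form D) sc cs
  (fun x Vx => tr_form_unit D Vx) (fun x Vx v => derive_tr_form D v Vx)
  (fun x Vx v => derive_tr_endmx D n2 v Vx) (fun x Vx u v => tr_curv D n2 u v Vx) AF0 F0G.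
have Fg y xi eta : U y -> Omega' (F y *m xi) (F y *m eta) = gform W y xi eta.
  move=> Uy; have [_ FG _] := HF y Uy.
  have : (F y)^T *m OmegaMx R n *m F y = tr_form W y.
    move: FG; rewrite -!mulmxA => /mulmx1C; rewrite -!mulmxA (mulmxA _ _ (F y)) => FG.
    by rewrite -[LHS](mulKVmx (tr_form_unit D (UV _ Uy))) FG mulmx1.
  by move=> E1; rewrite -tr_formE -E1 /Omega' trmx_mul !mulmxA.
have AF y xi : U y -> A *m (F y *m xi) = F y *m (Aa y *m xi).
  by move=> Uy; have [AFy _ _] := HF y Uy; rewrite mulmxA AFy mulmxA.
pose J : 'M[R]_(2 + (n + n), n + n) := col_mx 0 1%:M.
have J0 y h : F y *m J *m h = F y *m flow_coord 0 0 h by rewrite -mulmxA -flow_coord_vertical.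
have As y : U y -> A *m (F y *m e0 R n) = F y *m flow_coord 0 1 0.
  move=> Uy; rewrite AF// -flow_coord_e0 tr_end_coord ups0 mulr0 subr0.
  by rewrite scale0r mulmx0 addr0.
have Fq0 : F q0 *m e0 R n = e0 R n.
  rewrite Fq -flow_coord_e0 /flow_coord /F0 mul_block_col.
  by rewrite !(mul0mx, mulmx0, mul1mx, addr0).
have eA : Sigma A (e0 R n).
  have := Fg q0 (e0 R n) (flow_coord 0 1 0) Uq; rewrite -As// Fq0 -flow_coord_e0 gform_coord om0r.
  by rewrite /Sigma/= flow_coord_e0 => ->; ring.
have sA : in_sp A.
  move=> u v; rewrite -(mulKVmx F0u u) -(mulKVmx F0u v) -Fq.
  move: (invmx _ *m u) (invmx _ *m v) => xi eta; rewrite !AF// !Fg// -!tr_formE.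
  have := congr1 (fun M => (xi^T *m M *m eta) 0 0) (tr_end_sp D Vq0).
  by rewrite mulmxDr mulmxDl mulmx0 mul0mx [RHS]mxE [LHS]mxE trmx_mul !mulmxA.
exists A, U, (fun y => F y *m e0 R n), (fun y => F y *m J); split.
  by split.
split=> //.
- by apply: smooth_on_mulmx => //; exact: smooth_on_cst.
- by apply: smooth_on_mulmx => //; exact: smooth_on_cst.
- by move=> y Uy; rewrite As// -flow_coord_e0 Fg// gform_coord om0r; ring.
- by move=> y Uy v; rewrite J0 -flow_coord_e0 Fg// gform_coord om0r; ring.
- by move=> y Uy v; rewrite As// J0 Fg// gform_coord om0r; ring.
- by move=> y Uy v w; rewrite !J0 Fg// gform_coord; ring.
move=> y Uy; have [_ _ [lam dF]] := HF y Uy; exists lam => v; have Vy := UV _ Uy.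
have dFc k (N : 'M[R]_(2 + (n + n), k)) : 'D_v (fun y => F y *m N) y = 'D_v F y *m N.
  have [_ ->] := has_der_mulmx (has_der_smooth v sF Uy) (has_der_cst N y v).
  by rewrite mulmx0 addr0.
split=> [|w].
  rewrite dFc dF mulmxBl -scalemxAl -!mulmxA; congr (_ - _).
  rewrite -flow_coord_e0 tr_conn_coord om0r bet0r.
  by rewrite mulr0 oppr0 addr0 scale1r scale0r mulmx0 !addr0 flow_coord_vertical.
rewrite dFc dF -mulmxA -flow_coord_vertical mulmxBl -scalemxAl -!mulmxA.
rewrite -flow_coord_vertical tr_conn_coord mulr0 add0r !scale0r !add0r.
rewrite -!flow_coord_vertical (As _ Uy) !AF// !tr_end_coord.
rewrite !Fg// !gform_coord -flow_coord_e0 !(mul0r, mulr0, subr0, add0r) -/(bet W B y v w).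
congr (_ - _); rewrite !scale0r !add0r -/(bet W B y v w).
rewrite (scalemxAr _ (F y) (flow_coord 1 0 0)) (scalemxAr _ (F y) (flow_coord 0 1 0)).
rewrite -mulmxDr -mulmxBr; congr (_ *m _).
rewrite !flow_coordZ flow_coordN !flow_coordD !scaler0 oppr0 !addr0.
by congr flow_coord; [ring|ring|rewrite subr0].
Qed.

End TractorEmbedding.

(** * The reduced structures along the embedding *)

Lemma open_preimage (R : realType) (V W : normedModType R) (U : set V) (f : V -> W) (Z : set W) :
  open U -> smooth_on U f -> open Z -> open (U `&` f @^-1` Z).
Proof.
move=> oU sf oZ; rewrite openE => x [Ux Zx].
have fc : {for x, continuous f} by apply: differentiable_continuous; exact: smooth_on_diff sf Ux.
have nU : \near x, U x by exact: (open_nbhs_nbhs (conj oU Ux)).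
have nZ : \near x, Z (f x) by apply: (fc Z); exact: (open_nbhs_nbhs (conj oZ Zx)).
by rewrite /interior; near=> z; split; [exact: (near nU z)|exact: (near nZ z)].
Unshelve. all: by end_near. Qed.

Lemma has_der_comp (R : realType) (V W Z : normedModType R) (f : V -> W) (g : W -> Z) x v d e :
  has_der f x v d -> has_der g (f x) d e -> has_der (fun y => g (f y)) x v e.
Proof.
move=> [df <-] [dg <-]; split; first exact: (@differentiable_comp _ _ _ _ f g).
exact: derive_comp.
Qed.

Lemma has_der_pair (R : realType) (V W Z : normedModType R) (f : V -> W) (g : V -> Z) x v d e :
  has_der f x v d -> has_der g x v e -> has_der (fun y => (f y, g y)) x v (d, e).
Proof.
move=> [df <-] [dg <-]; have dp := differentiable_pair df dg; split; first exact: dp.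
by rewrite deriveE// diff_pair//= -!deriveE.
Qed.

Section FrameGauge.
Context {R : realType} {n : nat} (A : 'M[R]_(2 + (n + n))).
Local Notation E' := 'cV[R]_(2 + (n + n)).
Local Notation E := 'cV[R]_(n + n).
Hypothesis sA : in_sp A.

Lemma expmxCA t k (M : 'M[R]_(2 + (n + n), k)) :
  A *m (expmx (t *: A) *m M) = expmx (t *: A) *m (A *m M).
Proof. by rewrite !mulmxA expmx_comm. Qed.

Lemma has_der_expmx (V : normedModType R) (tau : V -> R) x v d : has_der tau x v d ->
  has_der (fun y => expmx (tau y *: A)) x v (d *: (A *m expmx (tau x *: A))).
Proof.
move=> ht; apply: (has_der_comp (g := fun t : R => expmx (t *: A)) ht).
by split; [exact: differentiable_expmx|exact: derive_expmx].
Qed.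

Lemma smooth_expmx_comp (V : normedModType R) (U : set V) (tau : V -> R) : open U ->
  smooth_on U tau -> smooth_on U (fun y => expmx (tau y *: A)).
Proof.
move=> oU st; 
by apply: (smooth_on_comp (U' := setT) finite_frame_R oU _ _ (smooth_expmx A)).
Qed.

Variables (U U1 : set E) (Gm : E -> E -> 'M[R]_(n + n)) (W : E -> 'M[R]_(n + n)).
Variables (s : E -> E') (H : E -> 'M[R]_(2 + (n + n), n + n)) (tau : E -> R).
Hypotheses (hf : horizontal_frame A U Gm W s H).
Hypotheses (oU1 : open U1) (U1U : U1 `<=` U) (st : smooth_on U1 tau).

(** The flow preserves [Omega'] and commutes with [A], so every condition survives and only [lam]
    changes, by the differential of [tau]. *)
Lemma hf_gauge : horizontal_frame A U1 Gm W
  (fun z => expmx (tau z *: A) *m s z) (fun z => expmx (tau z *: A) *m H z).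
Proof.
have sE := smooth_expmx_comp oU1 st.
split=> //.
- by apply: smooth_on_mulmx => //; exact: smooth_on_sub (hf_s hf).
- by apply: smooth_on_mulmx => //; exact: smooth_on_sub (hf_H hf).
- by move=> y /U1U Uy; rewrite expmxCA Omega_expmx//; exact: (hf_Sigma hf).
- by move=> y /U1U Uy v; rewrite -mulmxA Omega_expmx//; exact: (hf_orth hf).
- by move=> y /U1U Uy v; rewrite -mulmxA expmxCA Omega_expmx//; exact: (hf_orthA hf).
- by move=> y /U1U Uy v w; rewrite -!mulmxA Omega_expmx//; exact: (hf_symplectic hf).
move=> y U1y; have Uy := U1U U1y; have [lam dlam] := hf_derive hf Uy.
exists (fun v => lam v - 'D_v tau y) => v; have [ds dH] := dlam v.
have hE := has_der_expmx (has_der_smooth v st U1y).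
split=> [|w].
  have [_ ->] := has_der_mulmx hE (has_der_smooth v (hf_s hf) Uy).
  rewrite ds -scalemxAl mulmxBr -scalemxAr -!mulmxA !expmxCA.
  by apply/matrixP => i j; rewrite !mxE; ring.
have [_ ->] := has_der_mulmx hE (has_der_smooth v (hf_H hf) Uy).
rewrite mulmxDl -!mulmxA dH !expmxCA !Omega_expmx// -scalemxAl -!mulmxA.
rewrite !mulmxBr mulmxDr -!scalemxAr !expmxCA.
move: (Omega' _ _) (Omega' _ _) (lam v) ('D_v tau y) => a b c d.
do ?[match goal with |- context [@mulmx ?K ?k ?l ?n ?x ?y] => move: (@mulmx K k l n x y) => ? end].
by apply/matrixP => i j; rewrite !mxE; ring.
Qed.

End FrameGauge.

Section FrameBasis.
Context {R : realType} {n : nat} (A : 'M[R]_(2 + (n + n))).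
Local Notation E' := 'cV[R]_(2 + (n + n)).
Local Notation E := 'cV[R]_(n + n).
Hypothesis sA : in_sp A.
Variables (U : set E) (Gm : E -> E -> 'M[R]_(n + n)) (W : E -> 'M[R]_(n + n)).
Variables (s : E -> E') (H : E -> 'M[R]_(2 + (n + n), n + n)).
Hypothesis hf : horizontal_frame A U Gm W s H.
Hypotheses (WT : forall x, U x -> (W x)^T = - W x) (Wu : forall x, U x -> W x \in unitmx).

Lemma Omega0l (u : E') : Omega' 0 u = 0.
Proof. by rewrite -(scale0r (0 : E')) OmegaZl mul0r. Qed.

Lemma hf_inj y (v : E) : U y -> H y *m v = 0 -> v = 0.
Proof.
move=> Uy Hv; apply: (bform_inj (WT Uy) (Wu Uy)) => w.
rewrite -[LHS]/(om W y v w) -(hf_symplectic hf Uy) Hv Omega0l.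
by rewrite /bform trmx0 !mul0mx mxE.
Qed.

(** The vectors [s y], [A *m s y] and the columns of [H y] form a basis: their pairings make the
    combination map [f] injective, and the dimensions agree. A vector orthogonal to all of them
    vanishes. *)
Lemma hf_spans y d : U y -> Omega' d (s y) = 0 -> Omega' d (A *m s y) = 0 ->
  (forall w, Omega' d (H y *m w) = 0) -> d = 0.
Proof.
move=> Uy ds dA dH.
pose f (xi : E') : E' := xi (ix0 n) 0 *: s y + xi (ix1 n) 0 *: (A *m s y) + H y *m dsubmx xi.
have flin r u v : f (r *: u + v) = r *: f u + f v.
  rewrite /f linearP mulmxDr -scalemxAr /= !mxE.
  move: (H y *m dsubmx u) (H y *m dsubmx v) (s y) (A *m s y) (u (ix0 n) 0) (v (ix0 n) 0)
    (u (ix1 n) 0) (v (ix1 n) 0) => a b c e u0 v0 u1 v1.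
  by apply/matrixP => i j; rewrite !mxE; ring.
have S1 := hf_Sigma hf Uy.
have finj xi : f xi = 0 -> xi = 0.
  move=> f0.
  have hs v : Omega' (s y) (H y *m v) = 0 by rewrite Omega_antisym (hf_orth hf Uy) oppr0.
  have hA v : Omega' (A *m s y) (H y *m v) = 0 by rewrite Omega_antisym (hf_orthA hf Uy) oppr0.
  have E0 : xi (ix0 n) 0 = 0.
    have := congr1 (fun u => Omega' u (A *m s y)) f0.
    by rewrite /f !OmegaDl !OmegaZl (hf_orthA hf Uy) S1 Omega_self Omega0l mulr1 mulr0 !addr0.
  have E1 : xi (ix1 n) 0 = 0.
    have := congr1 (fun u => Omega' (s y) u) f0.
    rewrite /f !OmegaDr !OmegaZr hs S1 Omega_self mulr1 mulr0 add0r addr0 => ->.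
    by rewrite Omega_antisym Omega0l oppr0.
  have E2 : dsubmx xi = 0.
    by apply: (hf_inj Uy); move: f0; rewrite /f E0 E1 !scale0r !add0r.
  by apply: flow_coord_ext; rewrite ?E0 ?E1 ?E2 ?linear0 // mxE.
have fE xi := mul_col_matrix xi flin.
have Mu : col_matrix f \in unitmx by apply: inj_unitmx => h; rewrite fE; exact: finj.
apply: Omega_nondeg => v; rewrite -(mulKVmx Mu v) fE /f !OmegaDl !OmegaZl.
by rewrite !(Omega_antisym _ d) ds dA dH !oppr0 !mulr0 !addr0.
Qed.

Lemma hf_horizontal y u : U y -> horizontal A (s y) u -> exists v, u = H y *m v.
Proof.
move=> Uy [us uA].
(* The vector representing the linear form [w |-> Omega' u (H y *m w)] with respect to [W y]. *)
pose h : E := (u^T *m OmegaMx R n *m H y *m invmx (W y))^T.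
have hE w : om W y h w = Omega' u (H y *m w).
  by rewrite /om /bform /h trmxK (mulmxKV (Wu Uy)) /Omega' !mulmxA.
exists h; apply/eqP; rewrite -subr_eq0; apply/eqP; apply: (hf_spans Uy).
- by rewrite OmegaDl OmegaNl us (hf_orth hf Uy) subr0.
- by rewrite OmegaDl OmegaNl uA (hf_orthA hf Uy) subr0.
by move=> w; rewrite OmegaDl OmegaNl (hf_symplectic hf Uy) hE subrr.
Qed.

End FrameBasis.

(** * Lifts, form and connection of an arbitrary local reduction *)

Section ReducedStructure.
Context {R : realType} {n : nat} (A : 'M[R]_(2 + (n + n))).
Local Notation E' := 'cV[R]_(2 + (n + n)).
Local Notation E := 'cV[R]_(n + n).
Hypothesis sA : in_sp A.
Variables (x0 : E') (L : local_reduction A x0).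
Variables (U : set E) (Gm : E -> E -> 'M[R]_(n + n)) (W : E -> 'M[R]_(n + n)).
Variables (s : E -> E') (H : E -> 'M[R]_(2 + (n + n), n + n)).
Hypothesis hf : horizontal_frame A U Gm W s H.
Hypotheses (WT : forall x, U x -> (W x)^T = - W x) (Wu : forall x, U x -> W x \in unitmx).
Local Notation cyl := (cylinder (Defs.radius L) (epsilon L)).
Local Notation ambient := (nbhd_amb L).

Definition red_dom : set E := U `&` s @^-1` ambient.
Definition red_map z : E := (chi_inv L (s z)).1.
Definition red_time z : R := (chi_inv L (s z)).2.
(** Flowing [s z] back by its own time puts it on the slice [chi (y, 0)], where [omega_red] and
    [nabla_red] are computed. *)
Definition red_section z : E' := expmx (red_time z *: A) *m s z.
Definition red_frame z := expmx (red_time z *: A) *m H z.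

Lemma red_dom_open : open red_dom.
Proof. exact: (open_preimage (hf_open hf) (hf_s hf) (@nbhd_amb_open _ _ _ _ L)). Qed.

Lemma red_dom_sub : red_dom `<=` U. Proof. by move=> z []. Qed.

Lemma smooth_chi_inv_s : smooth_on red_dom (fun z => chi_inv L (s z)).
Proof.
apply: (smooth_on_comp (finite_frame_mx _ _) red_dom_open _ _ (@chi_inv_smooth _ _ _ _ L)).
  by move=> z [].
exact: smooth_on_sub red_dom_sub (hf_s hf).
Qed.

Lemma smooth_red_map : smooth_on red_dom red_map.
Proof.
apply: (@smooth_on_linear _ _ _ _ _ _ fst) smooth_chi_inv_s; first exact: red_dom_open.
by move=> p; exact: cvg_fst.
Qed.

Lemma smooth_red_time : smooth_on red_dom red_time.
Proof.
apply: (@smooth_on_linear _ _ _ _ _ _ snd) smooth_chi_inv_s; first exact: red_dom_open.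
by move=> p; exact: cvg_snd.
Qed.

Lemma hf_red : horizontal_frame A red_dom Gm W red_section red_frame.
Proof. exact: (hf_gauge sA hf red_dom_open red_dom_sub smooth_red_time). Qed.

(** Lifts are needed at nearby points of the fibre as well, since they are differentiated across the
    slice along [A x]. *)
Lemma hf_red_flow t : horizontal_frame A red_dom Gm W
  (fun z => expmx (- t *: A) *m red_section z) (fun z => expmx (- t *: A) *m red_frame z).
Proof.
apply: (hf_gauge (tau := fun=> - t) sA hf_red red_dom_open) => //; exact: smooth_on_cst.
Qed.

Lemma chi_red z : red_dom z -> cyl (red_map z, red_time z) /\ chi L (red_map z, red_time z) = s z.
Proof.
move=> [Uz Nz].
have : (ambient `&` Sigma A) (s z) by split=> //; exact: (hf_Sigma hf Uz).
rewrite -(@chi_image _ _ _ _ L) => -[p cp pz].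
have e : chi_inv L (s z) = p by rewrite -pz (chiK cp).
by rewrite /red_map /red_time e -surjective_pairing; split.
Qed.

Lemma chi_red_flow z t : red_dom z -> - epsilon L < t < epsilon L ->
  cyl (red_map z, t) /\ chi L (red_map z, t) = expmx (- t *: A) *m red_section z.
Proof.
move=> Uz ht; have [[r1 r2] cs] := chi_red Uz; have ct : cyl (red_map z, t) by split.
split=> //; rewrite (chi_flow ct) /red_section -cs (chi_flow (conj r1 r2)).
by rewrite (mulmxA (expmx (red_time z *: A))) expmxV mul1mx.
Qed.

Lemma expmx_0 : expmx (- 0 *: A) = 1%:M. Proof. by rewrite oppr0 expmx0. Qed.

Lemma epsilon_itv0 : - epsilon L < 0 < epsilon L.
Proof. by rewrite oppr_lt0 (@epsilon_gt0 _ _ _ _ L). Qed.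

Lemma chi_red0 z : red_dom z -> cyl (red_map z, 0) /\ chi L (red_map z, 0) = red_section z.
Proof. by move=> Uz; have := chi_red_flow Uz epsilon_itv0; rewrite expmx_0 mul1mx. Qed.

Lemma smooth_pi_red : smooth_on ambient (pi_red L).
Proof.
apply: (@smooth_on_linear _ _ _ _ _ _ fst) (@chi_inv_smooth _ _ _ _ L); first exact: nbhd_amb_open.
by move=> p; exact: cvg_fst.
Qed.

Lemma pi_red_flow z t : red_dom z -> - epsilon L < t < epsilon L ->
  ambient (expmx (- t *: A) *m red_section z) /\
  pi_red L (expmx (- t *: A) *m red_section z) = red_map z.
Proof.
move=> Uz ht; have [ct <-] := chi_red_flow Uz ht; split; last by rewrite /pi_red (chiK ct).
have [] // : (ambient `&` Sigma A) (chi L (red_map z, t)).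
by rewrite -(@chi_image _ _ _ _ L); exists (red_map z, t).
Qed.

Lemma has_der_flow (x : E') (t : R) :
  has_der (fun r : R => expmx (- r *: A) *m x) t 1 (- (A *m (expmx (- t *: A) *m x))).
Proof.
have h := has_der_mulmx (is_derive_has_der (is_derive_expmxN A t)) (has_der_cst x t 1).
by apply: (has_der_eq h); rewrite mulmx0 addr0 mulNmx mulmxA.
Qed.

Lemma derive_pi_flow z t : red_dom z -> - epsilon L < t < epsilon L ->
  let x := expmx (- t *: A) *m red_section z in 'D_(A *m x) (pi_red L) x = 0.
Proof.
move=> Uz ht x; have [Nx px] := pi_red_flow Uz ht.
have dp := smooth_on_diff smooth_pi_red Nx.
have h := has_der_comp (g := pi_red L) (has_der_flow (red_section z) t) (conj dp erefl).
have oI : open [set r : R | - epsilon L < r < epsilon L].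
  rewrite (_ : [set r : R | _] = `]- epsilon L, epsilon L[%classic); first exact: itv_open.
  by apply/seteqP; split=> r; rewrite /= in_itv.
have := has_der_unique (has_der_near oI ht (fun r hr => (pi_red_flow Uz hr).2) h)
  (has_der_cst (red_map z) t 1).
by rewrite -(scaleN1r (A *m x)) derive_scale_dir// => /eqP; rewrite scaler_eq0 oppr_eq0 oner_eq0 => /eqP.
Qed.

(** The vector [H v] differs from the derivative of the section by a multiple of [A x], which the
    differential of the projection kills. *)
Lemma derive_pi_frame z t v : red_dom z -> - epsilon L < t < epsilon L ->
  'D_(expmx (- t *: A) *m red_frame z *m v) (pi_red L) (expmx (- t *: A) *m red_section z)
  = 'D_v red_map z.
Proof.
move=> Uz ht; have [Nx px] := pi_red_flow Uz ht.
have dp := smooth_on_diff smooth_pi_red Nx; have hft := hf_red_flow t.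
have h := has_der_comp (g := pi_red L) (has_der_smooth v (hf_s hft) Uz) (conj dp erefl).
have := has_der_unique (has_der_near red_dom_open Uz (fun y Uy => (pi_red_flow Uy ht).2) h)
  (has_der_smooth v smooth_red_map Uz).
have [lam dlam] := hf_derive hft Uz; have [-> _] := dlam v.
rewrite addrC -scaleNr (derive_linear _ _ _ dp) (derive_pi_flow Uz ht) scaler0 add0r.
by [].
Qed.

(** The section is [chi (red_map z, 0)], so its derivative along [v] vanishes too and [H v] is a
    multiple of [A s]. Since [A s] is orthogonal to every horizontal vector, [v] pairs to zero with
    everything. *)
Lemma red_map_immersion z v : red_dom z -> 'D_v red_map z = 0 -> v = 0.
Proof.
move=> Uz dv; have Uz' := red_dom_sub Uz.
have [c0 c0E] := chi_red0 Uz.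
have hp := has_der_pair (has_der_smooth v smooth_red_map Uz) (has_der_cst (0 : R) z v).
have dc := smooth_on_diff (@chi_smooth _ _ _ _ L) c0.
have h := has_der_comp (g := chi L) hp (conj dc erefl).
have := has_der_unique (has_der_near red_dom_open Uz (fun y Uy => (chi_red0 Uy).2) h)
  (has_der_smooth v (hf_s hf_red) Uz).
rewrite dv (_ : ((0 : E), (0 : R)) = 0 :> E * R)//.
have D0 : 'D_(0 : E * R) (chi L) (red_map z, 0) = 0.
  by rewrite deriveE// linear0.
rewrite D0.
have [lam dlam] := hf_derive hf_red Uz; have [-> _] := dlam v.
move=> /(@esym _ _ _)/eqP; rewrite subr_eq0 => /eqP Hv.
apply: (bform_inj (WT Uz') (Wu Uz')) => w.
rewrite -[LHS]/(om W z v w) -(hf_symplectic hf_red Uz) Hv OmegaZl Omega_antisym.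
by rewrite (hf_orthA hf_red Uz) oppr0 mulr0 /bform trmx0 !mul0mx mxE.
Qed.

Lemma hlift_unique x u v : horizontal A x v -> 'd (pi_red L) x v = u ->
  (forall v', horizontal A x v' -> 'd (pi_red L) x v' = u -> v' = v) -> hlift L x u = v.
Proof.
move=> hv dv uni; rewrite /hlift.
have [h1 h2] := @xgetI _ 0 [set v | horizontal A x v /\ 'd (pi_red L) x v = u] v (conj hv dv).
exact: uni.
Qed.

(** [hlift] is defined by choice. Horizontal vectors are exactly the values of the frame, and the
    immersion property singles out one among them. *)
Lemma hlift_flow z t v : red_dom z -> - epsilon L < t < epsilon L ->
  hlift L (expmx (- t *: A) *m red_section z) ('D_v red_map z) =
  expmx (- t *: A) *m red_frame z *m v.
Proof.
move=> Uz ht; have hft := hf_red_flow t; have [Nx px] := pi_red_flow Uz ht.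
have dp := smooth_on_diff smooth_pi_red Nx.
apply: hlift_unique.
- by split; [exact: (hf_orth hft Uz)|exact: (hf_orthA hft Uz)].
- by rewrite -deriveE// derive_pi_frame.
move=> v' hv'; have WT' x : red_dom x -> (W x)^T = - W x by move=> [/WT].
have Wu' x : red_dom x -> W x \in unitmx by move=> [/Wu].
have [u ->] := hf_horizontal hft WT' Wu' Uz hv'.
rewrite -deriveE// derive_pi_frame// => duv; congr (_ *m _).
apply/eqP; rewrite -subr_eq0; apply/eqP; apply: (red_map_immersion Uz).
rewrite -[v]scale1r -scaleNr addrC derive_linear; last exact: smooth_on_diff smooth_red_map Uz.
by rewrite duv scaleN1r addNr.
Qed.

Lemma hlift_section z v : red_dom z ->
  hlift L (red_section z) ('D_v red_map z) = red_frame z *m v.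
Proof. by move=> Uz; have := hlift_flow v Uz epsilon_itv0; rewrite expmx_0 !mul1mx. Qed.

Lemma omega_red_pullback z u v : red_dom z ->
  omega_red L (red_map z) ('D_u red_map z) ('D_v red_map z) = om W z u v.
Proof.
move=> Uz; rewrite /omega_red; have [_ ->] := chi_red0 Uz.
by rewrite !hlift_section// (hf_symplectic hf_red Uz).
Qed.

(* nabla_red differentiates hlift_field off Sigma A: near Sigma A the lift of u
   is the solution v of the invertible system lift_system x *m v = (0, 0, u). *)
Definition lift_system x : 'M[R]_(2 + (n + n)) :=
  col_matrix (fun v => flow_coord (Omega' v x) (Omega' v (A *m x)) ('D_v (pi_red L) x)).

Lemma lift_systemE x v : ambient x ->
  lift_system x *m v = flow_coord (Omega' v x) (Omega' v (A *m x)) ('D_v (pi_red L) x).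
Proof.
move=> Nx; have dp := smooth_on_diff smooth_pi_red Nx; apply: mul_col_matrix => r u w.
by rewrite flow_coordZ flow_coordD !OmegaDl !OmegaZl (derive_linear _ _ _ dp).
Qed.

Lemma smooth_lift_system : smooth_on ambient lift_system.
Proof.
have oN := @nbhd_amb_open _ _ _ _ L; have sid := smooth_on_id oN.
apply/(smooth_on_mxP _ oN) => i j; under eq_fun do rewrite mxE.
apply: (smooth_on_linmx (@coord_mx R _ _ i 0) oN); apply: smooth_on_flow_coord => //.
- by apply: smooth_on_Omega => //; exact: smooth_on_cst.
- apply: smooth_on_Omega => //; first exact: smooth_on_cst.
  exact: (smooth_on_linmx (mulmx A) oN sid).
exact: (smooth_on_derive _ smooth_pi_red).
Qed.

Lemma red_section_ambient z : red_dom z ->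
  ambient (red_section z) /\ pi_red L (red_section z) = red_map z.
Proof. by move=> Uz; have := pi_red_flow Uz epsilon_itv0; rewrite expmx_0 mul1mx. Qed.

Lemma derive_pi_section z v : red_dom z ->
  'D_(red_frame z *m v) (pi_red L) (red_section z) = 'D_v red_map z.
Proof. by move=> Uz; have := derive_pi_frame v Uz epsilon_itv0; rewrite expmx_0 !mul1mx. Qed.

Lemma lift_system_unit z : red_dom z -> lift_system (red_section z) \in unitmx.
Proof.
move=> Uz; have [Nx _] := red_section_ambient Uz.
apply: inj_unitmx => v; rewrite lift_systemE// => K0.
have WT' x : red_dom x -> (W x)^T = - W x by move=> [/WT].
have Wu' x : red_dom x -> W x \in unitmx by move=> [/Wu].
have [h0 [h1 hd]] : Omega' v (red_section z) = 0 /\ Omega' v (A *m red_section z) = 0 /\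
    'D_v (pi_red L) (red_section z) = 0.
  have e0 := congr1 (fun u : E' => u (ix0 n) 0) K0.
  have e1 := congr1 (fun u : E' => u (ix1 n) 0) K0.
  have ed := congr1 dsubmx K0.
  by move: e0 e1 ed; rewrite flow_coordK0 flow_coordK1 flow_coordKd !mxE linear0.
have [u uE] := hf_horizontal hf_red WT' Wu' Uz (conj h0 h1).
by rewrite uE (red_map_immersion Uz (_ : 'D_u red_map z = 0)) ?mulmx0// -(derive_pi_section u Uz) -uE.
Qed.

Definition lift_dom : set E' := ambient `&` lift_system @^-1` [set K | \det K != 0].

Lemma lift_dom_open : open lift_dom.
Proof.
have oN := @nbhd_amb_open _ _ _ _ L.
have o0 : open [set x : R | x != 0] by exact: open_neq.
exact: (open_preimage oN (smooth_on_det oN smooth_lift_system) o0).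
Qed.

Lemma hlift_system x u : lift_dom x -> hlift L x u = invmx (lift_system x) *m flow_coord 0 0 u.
Proof.
move=> [Nx dx]; have Ku : lift_system x \in unitmx by rewrite unitmxE unitfE.
have dp := smooth_on_diff smooth_pi_red Nx.
have K v : lift_system x *m v = flow_coord 0 0 u <-> horizontal A x v /\ 'd (pi_red L) x v = u.
  rewrite lift_systemE// -deriveE//; split=> [|[[-> ->] -> //]].
  move=> e; have e0 := congr1 (fun u : E' => u (ix0 n) 0) e.
  have e1 := congr1 (fun u : E' => u (ix1 n) 0) e; have ed := congr1 dsubmx e.
  by move: e0 e1 ed; rewrite !flow_coordK0 !flow_coordK1 !flow_coordKd.
have [h1 h2] := (K (invmx (lift_system x) *m flow_coord 0 0 u)).1 (mulKVmx Ku _).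
apply: hlift_unique => // v' hv' dv'.
by rewrite -((K v').2 (conj hv' dv')) mulKmx.
Qed.

Lemma hlift_field_differentiable (Y : E -> E) z : red_dom z -> smooth_near (red_map z) Y ->
  differentiable (hlift_field L Y) (red_section z).
Proof.
move=> Uz [U' [oU' U'z sY]]; have [Nx px] := red_section_ambient Uz.
have oN := @nbhd_amb_open _ _ _ _ L.
have sp : smooth_on lift_dom (pi_red L) by apply: smooth_on_sub smooth_pi_red => x [].
pose Q := lift_dom `&` pi_red L @^-1` U'.
have oQ : open Q by exact: (open_preimage lift_dom_open sp oU').
have Qx : Q (red_section z).
  by split; [split=> //; rewrite /= -unitfE -unitmxE lift_system_unit|rewrite /= px].
have sF : smooth_on Q (fun x => invmx (lift_system x) *m flow_coord 0 0 (Y (pi_red L x))).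
  apply: smooth_on_mulmx => //.
    apply: smooth_on_invmx => //; first by move=> x [[_ +] _]; rewrite /= unitmxE unitfE.
    by apply: smooth_on_sub smooth_lift_system => x [[]].
  have c0 := @smooth_on_cst R E' R Q 0.
  apply: smooth_on_flow_coord => //.
  apply: (smooth_on_comp (finite_frame_mx _ _) oQ _ _ sY); first by move=> x [].
  by apply: smooth_on_sub sp => x [].
apply: smooth_on_diff Qx; apply: smooth_on_ext sF => // x [ldx _].
by rewrite /hlift_field hlift_system.
Qed.

(** The structure equation makes the corrections along [x] and [A x] in [nabla_red] cancel exactly.
    The [lam] term cancels against the derivative of the lift along the flow, leaving the horizontal
    lift of the covariant derivative. *)
Lemma nabla_red_pullback (O' : set E) (X Y X' Y' : E -> E) z :
  open O' -> O' `<=` red_dom -> O' z -> smooth_near z Y -> smooth_near (red_map z) Y' ->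
  X' (red_map z) = 'D_(X z) red_map z ->
  (forall q, O' q -> Y' (red_map q) = 'D_(Y q) red_map q) ->
  nabla_red L X' Y' (red_map z) = 'D_('D_(X z) Y z + Gm (X z) z *m Y z) red_map z.
Proof.
move=> oO' O'U O'z [UY [oUY UYz sY]] sY' X'E Y'E; have Uz := O'U _ O'z.
have [Nx px] := red_section_ambient Uz.
have dL := hlift_field_differentiable Uz sY'.
rewrite /nabla_red; have [_ ->] := chi_red0 Uz.
have XL : hlift_field L X' (red_section z) = red_frame z *m X z.
  by rewrite /hlift_field px X'E hlift_section.
have YL q : O' q -> hlift_field L Y' (red_section q) = red_frame q *m Y q.
  move=> O'q; have Uq := O'U _ O'q; have [_ pq] := red_section_ambient Uq.
  by rewrite /hlift_field pq Y'E// hlift_section.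
rewrite XL (YL _ O'z).
have [lam dlam] := hf_derive hf_red Uz; have [ds dH] := dlam (X z).
have hY : has_der Y z (X z) ('D_(X z) Y z) by exact: has_der_smooth sY UYz.
have h1 := has_der_mulmx (has_der_smooth (X z) (hf_H hf_red) Uz) hY.
have h2 := has_der_comp (g := hlift_field L Y') (has_der_smooth (X z) (hf_s hf_red) Uz) (conj dL erefl).
have E1 := has_der_unique (has_der_near oO' O'z YL h2) h1.
(* The lift is equivariant under the flow, so its derivative along [A x] is [A] applied to its
   value. *)
have Eflow : 'D_(A *m red_section z) (hlift_field L Y') (red_section z) = A *m (red_frame z *m Y z).
  have f0 := has_der_flow (red_section z) 0; rewrite expmx_0 !mul1mx in f0.
  have dL0 : differentiable (hlift_field L Y') (expmx (- 0 *: A) *m red_section z).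
    by rewrite expmx_0 mul1mx.
  have h3 := has_der_comp (g := hlift_field L Y') f0 (conj dL0 erefl).
  have oI : open [set r : R | - epsilon L < r < epsilon L].
    rewrite (_ : [set r : R | _] = `]- epsilon L, epsilon L[%classic); first exact: itv_open.
    by apply/seteqP; split=> r; rewrite /= in_itv.
  have YF r : - epsilon L < r < epsilon L ->
      hlift_field L Y' (expmx (- r *: A) *m red_section z) = expmx (- r *: A) *m (red_frame z *m Y z).
    move=> hr; have [_ pr] := pi_red_flow Uz hr.
    by rewrite /hlift_field pr Y'E// hlift_flow// mulmxA.
  have f1 := has_der_flow (red_frame z *m Y z) 0; rewrite expmx_0 !mul1mx in f1.
  have := has_der_unique (has_der_near oI epsilon_itv0 YF h3) f1.
  rewrite expmx_0 mul1mx -(scaleN1r (A *m red_section z)) derive_scale_dir//.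
  by rewrite scaleN1r => /oppr_inj.
(* The direction of differentiation is split into a flow part and a part tangent to the section,
   where the chart derivative is known. *)
have XS : red_frame z *m X z = lam (X z) *: (A *m red_section z) + 'D_(X z) red_section z.
  by rewrite ds addrC subrK.
rewrite {1}XS (derive_linear _ _ _ dL) Eflow E1 dH -deriveE; last exact: smooth_on_diff smooth_pi_red Nx.
rewrite -(derive_pi_section _ Uz) (mulmxDr (red_frame z)); congr ('D_ _ _ _).
move: (Omega' _ _) (Omega' _ _) (lam (X z)) => a b c.
do ?[match goal with |- context [@mulmx ?K ?k ?l ?n ?x ?y] => move: (@mulmx K k l n x y) => ? end].
by apply/matrixP => i j; rewrite !mxE; ring.
Qed.

Lemma red_dom_center q : U q -> s q = x0 -> red_dom q.
Proof.
move=> Uq sq; split=> //; rewrite /= sq.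
have c0 : cyl ((0 : E), (0 : R)).
  by split; [exact: eball0 (@radius_gt0 _ _ _ _ L)|exact: epsilon_itv0].
suff : (ambient `&` Sigma A) (chi L (0, 0)) by case; rewrite (chi_center L).
by rewrite -(@chi_image _ _ _ _ L); exists (0, 0).
Qed.

Lemma red_map_local_inverse q : red_dom q -> exists (Z : set E) (g : E -> E),
  [/\ open Z, Z q, Z `<=` red_dom, (forall Z', open Z' -> Z' `<=` Z -> open (red_map @` Z')) &
    smooth_on (red_map @` Z) g /\ forall x, Z x -> g (red_map x) = x].
Proof.
move=> Uq; apply: (inverse_function red_dom_open smooth_red_map Uq) => h.
exact: red_map_immersion.
Qed.

Lemma red_map_Dred z : red_dom z -> Dred L (red_map z).
Proof. by move=> Uz; have [[]] := chi_red Uz. Qed.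

End ReducedStructure.

(** * Changes of charts *)

Lemma smooth_pushforward (R : realType) m (f g : 'cV[R]_m -> 'cV[R]_m) (Z Z' : set 'cV[R]_m)
    (X : vfield R m) y : open Z -> open Z' -> smooth_on Z f -> smooth_on Z' g ->
  (forall z, Z' z -> Z (g z)) -> Z' y -> smooth_near (g y) X -> smooth_near y (Defs.pushforward f g X).
Proof.
move=> oZ oZ' sf sg gZ Z'y [UX [oX Xg sX]].
pose Q := Z' `&` g @^-1` UX; have oQ : open Q by exact: open_preimage oZ' sg oX.
exists Q; split=> //; have oZX := openI oZ oX.
have sh : smooth_on (Z `&` UX) (fun x => 'd f x (X x)).
  apply: (smooth_on_apply (finite_frame_mx _ _) oZX); first by apply: smooth_on_sub sf => ? [].
  by apply: smooth_on_sub sX => ? [].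
apply: (smooth_on_comp (finite_frame_mx _ _) oQ _ _ sh).
  by move=> z [Z'z Xz]; split=> //; exact: gZ.
by apply: smooth_on_sub sg => ? [].
Qed.

Lemma open_within_preimage (T S : topologicalType) (Z : set T) (f : T -> S) (Q : set S) :
  open Z -> {within Z, continuous f} -> open Q -> open (Z `&` f @^-1` Q).
Proof.
move=> oZ; rewrite continuous_open_subspace// => fc oQ.
exact: ((continuous_inP f oZ).1 fc _ oQ).
Qed.

Section Charts.
Context {R : realType} {m : nat} (M : smooth_manifold R m).
Local Notation E := 'cV[R]_m.

Lemma chart_invK (c : chart R m M) q : atlas c -> cdom c q -> cinv c (cmap c q) = q.
Proof. by move=> /atlas_chart[_ _ K _ _]; exact: K. Qed.

Lemma chart_image_open (c : chart R m M) (Q : set M) : atlas c -> open Q ->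
  open (cmap c @` (Q `&` cdom c)).
Proof.
move=> ac oQ; have [oD oR K _ ic] := atlas_chart ac.
rewrite (_ : cmap c @` _ = crange c `&` cinv c @^-1` (Q `&` cdom c)).
  by apply: open_within_preimage => //; exact: openI.
apply/seteqP; split=> [_ [q [Qq Dq] <-]|_ [[q Dq <-] /=]].
  by split; [exists q|rewrite /= K].
by rewrite K// => Qq; exists q.
Qed.

Lemma chart_preimage_open (c : chart R m M) (Z : set E) : atlas c -> open Z ->
  open (cdom c `&` cmap c @^-1` Z).
Proof. by move=> ac oZ; have [oD _ _ fc _] := atlas_chart ac; exact: open_within_preimage. Qed.

Variables (omega : manifold_form M) (nabla : manifold_covderiv M).
Hypothesis omega_compat : forall c d, atlas c -> atlas d ->
  symplectic_map (overlap c d) (omega c) (omega d) (cmap d \o cinv c).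
Hypothesis nabla_connection : manifold_connection nabla.
Variables (c : chart R m M) (Z D : set E) (phi g : E -> E) (w' : form2 R m) (nabla' : covderiv R m).
Hypotheses (ac : atlas c) (oZ : open Z) (Zc : Z `<=` crange c).
Hypotheses (sphi : smooth_on Z phi) (sg : smooth_on (phi @` Z) g) (gK : forall z, Z z -> g (phi z) = z).
Hypothesis phi_open : forall Z', open Z' -> Z' `<=` Z -> open (phi @` Z').
Hypothesis phiD : phi @` Z `<=` D.
Hypothesis phi_symplectic : forall z, Z z -> forall u v,
  w' (phi z) ('D_u phi z) ('D_v phi z) = omega c z u v.
(** Stated for fields that are [phi]-related to [X] and [Y] rather than for push-forwards, so that
    fields pushed forward through another chart can be inserted. *)
Hypothesis phi_affine : forall (Q : set E) (X Y X' Y' : vfield R m) z, open Q -> Q `<=` Z -> Q z ->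
  smooth_near z X -> smooth_near z Y -> smooth_near (phi z) Y' ->
  X' (phi z) = 'D_(X z) phi z -> (forall q, Q q -> Y' (phi q) = 'D_(Y q) phi q) ->
  nabla' X' Y' (phi z) = 'D_(nabla c X Y z) phi z.

(** The isomorphism is built in the single chart [c], whereas the definition quantifies over the
    atlas; composing with transition maps, which preserve the form and the connection, gives its
    expression in every chart. *)
Theorem locally_isomorphic_of_chart p : cdom c p -> Z (cmap c p) ->
  locally_isomorphic_at p omega nabla D w' nabla'.
Proof.
move=> cp Zp; pose Q := cdom c `&` cmap c @^-1` Z.
have oQ : open Q by exact: chart_preimage_open.
have fQ (S : set M) : S `<=` Q -> (phi \o cmap c) @` S = phi @` (cmap c @` S).
  by move=> _; rewrite image_comp.
have cQ : cmap c @` Q = Z.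
  apply/seteqP; split=> [_ [q [_ Zq] <-]//|z Zz].
  by have [q Dq qz] := Zc Zz; exists q => //; split=> //=; rewrite qz.
exists Q, (phi \o cmap c), (cinv c \o g); split.
  by split=> // q [Dq Zq] /=; rewrite gK// chart_invK.
split; first by rewrite fQ// cQ; exact: phi_open.
  by rewrite fQ// cQ.
move=> d ad /=; set fc := _ \o cinv d; set gc := cmap d \o _; set Qd := cmap d @` _.
pose psi : E -> E := cmap c \o cinv d; pose psi' : E -> E := cmap d \o cinv c.
pose Z' := cmap c @` (Q `&` cdom d).
have oQd : open Qd by exact: chart_image_open.
have oZ' : open Z'.
  rewrite /Z' (_ : Q `&` cdom d = (Q `&` cdom d) `&` cdom c).
    by apply: chart_image_open => //; apply: openI => //; have [] := atlas_chart ad.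
  by apply/seteqP; split=> [q [[Dq Zq] Ddq]|q []].
have Z'Z : Z' `<=` Z by move=> _ [q [[_ Zq] _] <-].
have spsi : smooth_on Qd psi.
  apply: smooth_on_sub (atlas_smooth ad ac) => _ [q [[Dq _] Ddq] <-].
  by exists q.
have spsi' : smooth_on Z' psi'.
  apply: smooth_on_sub (atlas_smooth ac ad) => _ [q [[Dq _] Ddq] <-].
  by exists q.
have psiQ x : Qd x -> Z' (psi x) /\ psi' (psi x) = x.
  move=> [q [Qq Ddq] <-]; rewrite /psi /psi' /= chart_invK//; split; first by exists q.
  by case: Qq => Dq _; rewrite chart_invK.
have psi'Q z : Z' z -> Qd (psi' z) /\ psi (psi' z) = z.
  move=> [q [Qq Ddq] <-]; have [Dq _] := Qq; rewrite /psi /psi' /= chart_invK//.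
  by split; [exists q|rewrite chart_invK].
have fcE x : fc x = phi (psi x) by [].
have gcE y : gc y = psi' (g y) by [].
have imE : (phi \o cmap c) @` (Q `&` cdom d) = phi @` Z' by rewrite /Z' image_comp.
have oP : open (phi @` Z') by exact: phi_open.
have sfc : smooth_on Qd fc.
  by apply: (smooth_on_comp (finite_frame_mx _ _) oQd _ spsi sphi) => x /psiQ[/Z'Z].
have sgc : smooth_on (phi @` Z') gc.
  apply: (smooth_on_comp (finite_frame_mx _ _) oP _ _ spsi').
    by move=> _ [z Z'z <-]; rewrite gK//; exact: Z'Z.
  by apply: smooth_on_sub sg; exact: image_subset.
have gcQ y : (phi @` Z') y -> Qd (gc y) /\ fc (gc y) = y.
  move=> [z Z'z <-]; have [h1 h2] := psi'Q z Z'z.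
  by rewrite gcE (gK (Z'Z _ Z'z)) fcE h2.
have dfc x u : Qd x -> 'd fc x u = 'D_('d psi x u) phi (psi x).
  move=> Qx; have [Z'x _] := psiQ x Qx.
  have dpsi := smooth_on_diff spsi Qx; have dphi := smooth_on_diff sphi (Z'Z _ Z'x).
  have e1 := deriveE u (smooth_on_diff sfc Qx).
  have e2 := @derive_comp _ _ _ _ psi phi x u dpsi dphi.
  have e3 := congr1 (fun v => 'D_v phi (psi x)) (deriveE u dpsi).
  exact: (etrans (esym e1) (etrans e2 e3)).
split.
- rewrite imE; split=> //.
    move=> x Qx; have [Z'x K] := psiQ x Qx; split; first by exists (psi x).
    by rewrite fcE gcE gK//; exact: Z'Z.
- move=> x Qx u v; have [Z'x _] := psiQ x Qx.
  apply: (etrans (congr2 (w' (fc x)) (dfc x u Qx) (dfc x v Qx))).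
  apply: (etrans (phi_symplectic (Z'Z _ Z'x) _ _)).
  apply: (omega_compat ad ac); case: Qx => q [[Dq _] Ddq] <-.
  by exists q.
move=> x X Y Qx sX sY; have [Z'x K] := psiQ x Qx.
have Ox : overlap d c x by case: Qx => q [[Dq _] Ddq] <-; exists q.
have := (nabla_connection.2 d c ad ac) x X Y Ox sX sY => Hn.
have psi'_Qd z : Z' z -> Qd (psi' z) by move=> /psi'Q[].
have sP (F : vfield R m) : smooth_near x F -> smooth_near (psi x) (Defs.pushforward psi psi' F).
  by rewrite -{1}K => sF; exact: (smooth_pushforward oQd oZ' spsi spsi' psi'_Qd Z'x sF).
apply: (etrans _ (esym (dfc x _ Qx))).
apply: (etrans _ (congr1 (fun v => 'D_v phi (psi x)) Hn)).
apply: (phi_affine oZ' Z'Z Z'x (sP _ sX) (sP _ sY)).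
- apply: (smooth_pushforward oQd oP sfc sgc (fun y Py => (gcQ y Py).1)); first by exists (psi x).
  by rewrite gcE (gK (Z'Z _ Z'x)) K.
- rewrite /Defs.pushforward gcE (gK (Z'Z _ Z'x)) K.
  exact: dfc.
move=> z Z'z; have [h1 h2] := psi'Q z Z'z.
rewrite /Defs.pushforward gcE (gK (Z'Z _ Z'z)).
by apply: (etrans (dfc _ _ h1)); rewrite h2.
Qed.

End Charts.

Theorem theorem4p6 (R : realType) (n : nat) (n_ge2 : (2 <= n)%N)
    (M : smooth_manifold R (n + n))
    (omega : manifold_form M) (nabla : manifold_covderiv M)
    (omega_symplectic : manifold_symplectic_form omega)
    (nabla_symplectic : symplectic_connection omega nabla)
    (nabla_ricci_type : manifold_ricci_type omega nabla)
    (p : M) :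
  exists A : 'M[R]_(2 + (n + n)),
    [/\ in_sp A,
        Sigma A (e0 R n),
        inhabited (local_reduction A (e0 R n)) &
        forall L : local_reduction A (e0 R n),
          locally_isomorphic_at p omega nabla
            (Dred L) (omega_red L) (nabla_red L)].
Proof.
have [c ac cp] := atlas_cover p.
have sw := omega_symplectic.1 c ac.
have [conn /(_ c ac)[tf pf]] := nabla_symplectic.
have cn := conn.1 c ac.
have [_ oV _ _ _] := atlas_chart ac.
have [rho [rho_ricci rho_curv]] := nabla_ricci_type c ac.
have m2 : (2 < n + n)%N by apply: leq_trans (leq_add n_ge2 n_ge2).
have RD := ricci_type_chart oV sw cn tf pf m2 rho_ricci rho_curv.
have Vp : crange c (cmap c p) by exists p.
have [A [U [s [H [[sA eA Up UV sp] hf]]]]] := tractor_embedding RD m2 Vp.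
exists A; split=> //; first exact: local_reduction_exists.
move=> L.
have WT x : U x -> (form_mx (omega c) x)^T = - form_mx (omega c) x.
  by move=> /UV; exact: (form_mx_anti sw).
have Wu x : U x -> form_mx (omega c) x \in unitmx.
  by move=> /UV; exact: (form_mx_unit sw).
(* The embedding passes through [e0], so the domain of its projection by [L] contains the chart
   point of [p]; shrinking it to [Z] makes that projection a diffeomorphism onto an open set. *)
have [Z [g [oZ Zp ZU phi_open [sg gK]]]] :=
  red_map_local_inverse sA hf WT Wu (red_dom_center L Up sp).
have ZV : Z `<=` crange c by move=> z /ZU/red_dom_sub/UV.
apply: (locally_isomorphic_of_chart omega_symplectic.2 conn ac oZ ZV _ sg gK phi_open) => //.
- exact: smooth_on_sub ZU (smooth_red_map hf).
- by move=> _ [z /ZU Uz <-]; exact: (red_map_Dred hf Uz).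
- move=> z Zz u v; rewrite (omega_red_pullback sA hf WT Wu _ _ (ZU _ Zz)).
  by rewrite (form_mxE sw _ _ (ZV _ Zz)).
move=> Q X Y X' Y' z oQ QZ Qz sX sY sY' X'E Y'E; have Vz := ZV _ (QZ _ Qz).
rewrite (nabla_red_pullback sA hf WT Wu oQ (subset_trans QZ ZU) Qz sY sY' X'E Y'E).
by rewrite (nablaE cn Vz sX sY).
Qed.
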